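(* Let $\mathcal{A}$ and $\mathcal{B}$ satisfy assumptions (B) and (A) stated in the context. Let $u_0\in\mathcal{V}$ with $\mathcal{B}u_0=g(0)$, let $g\in H^3(0,T;\mathcal{Q}^* )$, and let $f\colon[0,T]\times\mathcal{V}\to\mathcal{H}$ satisfy: (1) $v\mapsto f(t,v)$ is continuous for almost all $t\in[0,T]$, and $t\mapsto f(t,v)$ is measurable for all $v\in\mathcal{V}$; (2) there exists $k\in L^2(0,T)$ with $\|f(t,v)\|_{\mathcal{H}}\le k(t)(1+\|v\|_{\mathcal{V}})$ for all $v\in\mathcal{V}$ and almost all $t\in[0,T]$; (3) for every $v\in\mathcal{V}$ there exist an open ball $B_r(v)\subseteq\mathcal{V}$ with radius $r=r(v)>0$ and a constant $L(v)\ge0$ such that for almost every $t\in[0,T]$, $\|f(t,v_1)-f(t,v_2)\|_{\mathcal{H}}\le L(v)\|v_1-v_2\|_{\mathcal{V}}$ for all $v_1,v_2\in B_r(v)$. Let $(u,\lambda)$ be the unique solution, with $u\in C([0,T];\mathcal{V})\cap H^1(0,T;\mathcal{H})$, $\lambda\in L^2(0,T;\mathcal{Q})$, of $$\dot u(t)+\mathcal{A}u(t)+\mathcal{B}^*\lambda(t)=f(t,u(t))\ \text{ in }\mathcal{V}^*,\qquad\mathcal{B}u(t)=g(t)\ \text{ in }\mathcal{Q}^*,\qquad u(0)=u_0,$$ and assume $f(\cdot,u(\cdot))\in H^2(0,T;\mathcal{H})$. Let the step size $\tau$ be sufficiently small such that the discrete solution $u_n$ produced by the second-order exponential integrator defined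 in the context lies in a strip along $u$ where $f$ is locally Lipschitz continuous with a uniform constant $L>0$. Then the approximation $u_n$ satisfies $$\|u_n-u(t_n)\|_{\mathcal{V}}^2\le C\bigg[\tau^3\int_0^{t_n}\Big(\big\|\tfrac{\mathrm{d}}{\mathrm{d}t}f(t,u(t))\big\|_{\mathcal{H}}^2+\|\mathcal{B}^-\ddot g(t)\|_{\mathcal{H}}^2\Big)\mathrm{d}t+\tau^4\int_0^{t_n}\Big(\big\|\tfrac{\mathrm{d}^2}{\mathrm{d}t^2}f(t,u(t))\big\|_{\mathcal{H}}^2+\|\mathcal{B}^-\dddot g(t)\|_{\mathcal{H}}^2\Big)\mathrm{d}t\bigg],$$ where the constant $C$ depends only on $t_n$, $L$, and the operator $\mathcal{A}$.
   Context: $T>0$. $\mathcal{V}$, $\mathcal{Q}$, $\mathcal{H}$ are Hilbert spaces, and $\mathcal{V},\mathcal{H},\mathcal{V}^*$ form a Gelfand triple: $\mathcal{V}$ is continuously and densely embedded in $\mathcal{H}$, and $\mathcal{H}\equiv\mathcal{H}^*\hookrightarrow\mathcal{V}^*$. $\langle\cdot,\cdot\rangle$ denotes duality pairings, $\mathcal{B}^*\colon\mathcal{Q}\to\mathcal{V}^*$ is the dual operator of $\mathcal{B}$, and $L^2(0,T;X)$, $H^m(0,T;X)$ are Sobolev–Bochner spaces. Assumption (B): $\mathcal{B}\colon\mathcal{V}\to\mathcal{Q}^*$ is linear, continuous, and there is $\beta>0$ with $\inf_{q\in\mathcal{Q}\setminus\{0\}}\sup_{v\in\mathcal{V}\setminus\{0\}}\frac{\langle\mathcal{B}v,q\rangle}{\|v\|_{\mathcal{V}}\|q\|_{\mathcal{Q}}}\ge\beta$.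 Assumption (A): $\mathcal{A}\colon\mathcal{V}\to\mathcal{V}^*$ is linear and continuous, $\mathcal{A}=\mathcal{A}_1+\mathcal{A}_2$ with $\mathcal{A}_1\in\mathcal{L}(\mathcal{V},\mathcal{V}^* )$ self-adjoint and $\mathcal{A}_2\in\mathcal{L}(\mathcal{V},\mathcal{H})$; moreover $\mathcal{A}$ is elliptic on $\mathcal{V}_{\ker}:=\ker\mathcal{B}$, i.e. there is $\mu_{\mathcal{A}}>0$ with $\langle\mathcal{A}v,v\rangle\ge\mu_{\mathcal{A}}\|v\|_{\mathcal{V}}^2$ for all $v\in\mathcal{V}_{\ker}$. Right-inverse: $\mathcal{V}_{\mathrm{c}}:=\{v\in\mathcal{V}\mid\langle\mathcal{A}v,w\rangle=0\text{ for all }w\in\mathcal{V}_{\ker}\}$, and $\mathcal{B}^-\colon\mathcal{Q}^*\to\mathcal{V}$ is the right-inverse of $\mathcal{B}$ with image $\mathcal{V}_{\mathrm{c}}$. Equivalently, $x=\mathcal{B}^-h$ is the first component of the solution $(x,\nu)\in\mathcal{V}\times\mathcal{Q}$ of $\mathcal{A}x+\mathcal{B}^*\nu=0$ in $\mathcal{V}^*$, $\mathcal{B}x=h$ in $\mathcal{Q}^*$. Strip: that $u_n$ lies in a strip along $u$ where $f$ is locally Lipschitz continuous with uniform constant $L$ means that there is a radius $r>0$ such that, for arbitrary $s\in[0,T]$, the estimate $\|f(t,v_1)-f(t,v_2)\|_{\mathcal{H}}\le L\|v_1-v_2\|_{\mathcal{V}}$ holds for almost every $t\in[0,T]$ and all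 $v_1,v_2$ in the open ball $B_r(u(s))\subseteq\mathcal{V}$, and that $\|u_n-u(t_n)\|_{\mathcal{V}}<r$ for all $n$. Second-order exponential integrator: let $N\in\mathbb{N}$, $\tau=T/N$, $t_n=n\tau$, $g_n=g(t_n)$, $\dot g_n=\dot g(t_n)$. For initial data $\zeta\in\mathcal{V}_{\ker}$, the homogeneous problem on $[t_n,t_{n+1}]$ is: $\dot z(t)+\mathcal{A}z(t)+\mathcal{B}^*\mu(t)=0$ in $\mathcal{V}^*$, $\mathcal{B}z(t)=0$ in $\mathcal{Q}^*$, $z(t_n)=\zeta$. Starting from $u_0$, for $n=0,\dots,N-1$: (i) exponential Euler step: let $(w_n,\nu_n)\in\mathcal{V}\times\mathcal{Q}$ solve $\mathcal{A}w_n+\mathcal{B}^*\nu_n=f(t_n,u_n)-\mathcal{B}^-\dot g_n$ in $\mathcal{V}^*$, $\mathcal{B}w_n=0$ in $\mathcal{Q}^*$; let $\hat z$ solve the homogeneous problem with $\hat z(t_n)=u_n-\mathcal{B}^-g_n-w_n$; set $u_{n+1}^{\mathrm{Eul}}=\mathcal{B}^-g_{n+1}+\hat z(t_{n+1})+w_n$; (ii) let $(w_n',\nu_n')\in\mathcal{V}\times\mathcal{Q}$ solve $\mathcal{A}w_n'+\mathcal{B}^*\nu_n'=f(t_{n+1},u_{n+1}^{\mathrm{Eul}})-\mathcal{B}^-\dot g_{n+1}-f(t_n,u_n)+\mathcal{B}^-\dot g_n$ in $\mathcal{V}^*$, $\mathcal{B}w_n'=0$ in $\mathcal{Q}^*$;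 (iii) let $(w_n'',\nu_n'')\in\mathcal{V}\times\mathcal{Q}$ solve $\mathcal{A}w_n''+\mathcal{B}^*\nu_n''=\tfrac1\tau w_n'$ in $\mathcal{V}^*$, $\mathcal{B}w_n''=0$ in $\mathcal{Q}^*$; (iv) let $z$ solve the homogeneous problem with $z(t_n)=w_n''$; (v) set $u_{n+1}=u_{n+1}^{\mathrm{Eul}}+z(t_{n+1})-w_n''+w_n'$.
   Formalization: Added: at each t_n the strip Lipschitz estimate holds and f(t_n,u(t_n)) is the value of the continuous representative of f(·,u(·)); ''τ sufficiently small'' means below a problem-dependent threshold, or the Euler values also lie in the strip; C may depend on the ellipticity constant of A. *)

(* Defs.v *)
From HB Require Import structures.
From mathcomp Require Import all_boot all_order all_algebra.
From mathcomp Require Import all_classical all_reals all_analysis.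
From mathcomp Require Import ring lra.

Set Implicit Arguments.
Unset Strict Implicit.
Unset Printing Implicit Defensive.

Import Order.TTheory GRing.Theory Num.Theory.
Import numFieldNormedType.Exports.

Local Open Scope classical_set_scope.
Local Open Scope ring_scope.

HB.mixin Record CompleteNormedModule_isHilbert (R : realType) (V : Type)
    & CompleteNormedModule R V := {
  inner : V -> V -> R ;
  inner_sym : forall x y, inner x y = inner y x ;
  inner_linear : forall (a : R) (x y z : V),
    inner (a *: x + y) z = a * inner x z + inner y z ;
  inner_norm : forall x, inner x x = `|x| ^+ 2 }.

#[short(type="hilbertType")]
HB.structure Definition Hilbert (R : realType) :=
  {V of CompleteNormedModule R V & CompleteNormedModule_isHilbert R V}.

Record clinear (R : realType) (X Y : normedModType R) := CLinear {
  clinear_fun :> {linear X -> Y} ;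
  clinear_continuous : continuous clinear_fun }.

Section Dual.
Context {R : realType} {X : normedModType R}.

Definition dual_pred : {pred X -> R^o} :=
  fun f => `[< linear f /\ continuous f >].

Lemma dual_submod_closed : submod_closed dual_pred.
Proof.
split=> [|a f g].
  apply/asboolP; split; first by move=> a x y /=; rewrite scaler0 addr0.
  exact: cst_continuous.
move=> /asboolP[lf cf] /asboolP[lg cg]; apply/asboolP; split.
  move=> b x y; rewrite !fctE lf lg !scalerDr !scalerA (mulrC a b).
  by rewrite addrACA.
move=> x; apply: (@continuousD R R^o X (a *: f) g); last exact: cg.
by apply: continuousZl_tmp; exact: cf.
Qed.


HB.instance Definition _ :=
  GRing.isSubmodClosed.Build R (X -> R^o) dual_pred dual_submod_closed.

Record dual := Dual { dual_fun :> X -> R^o ; _ : dual_fun \in dual_pred }.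

HB.instance Definition _ := [isSub for dual_fun].
HB.instance Definition _ := [Choice of dual by <:].
HB.instance Definition _ := [SubChoice_isSubLmodule of dual by <:].

Lemma dual_is_linear (f : dual) : linear f.
Proof. by case: f => f /= /asboolP[]. Qed.

HB.instance Definition _ (f : dual) :=
  GRing.isLinear.Build R X R^o _ (dual_fun f) (dual_is_linear f).

Lemma dual_is_continuous (f : dual) : continuous (f : X -> R^o).
Proof. by case: f => f /= /asboolP[]. Qed.

Definition dual_norm (f : dual) : R := sup [set `|f x| | x in [set x | `|x| <= 1]].

Lemma dual_norm_has_sup (f : dual) :
  has_sup [set `|f x| | x in [set x : X | `|x| <= 1]].
Proof.
split; first by exists `|f 0|, 0 => //=; rewrite normr0.
have /linear_boundedP fr : bounded_near (f : X -> R^o) (nbhs (0 : X)).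
  exact: (@continuous_linear_bounded R X R^o 0 _ (@dual_is_continuous f 0)).
near +oo_R => r.
have r0 : 0 <= r by near: r; exact: nbhs_pinfty_ge.
have fxr : forall x, `|f x| <= r * `|x| by near: r.
exists r => _ /= [x x1 <-].
by rewrite (le_trans (fxr x))// ler_piMr.
Unshelve. all: by end_near. Qed.

Lemma dual_norm_ge (f : dual) (x : X) : `|x| <= 1 -> `|f x| <= dual_norm f.
Proof.
move=> x1; apply: ub_le_sup; last by exists x.
by case: (dual_norm_has_sup f).
Qed.

Lemma dual_norm_ub (f : dual) (x : X) : `|f x| <= dual_norm f * `|x|.
Proof.
have [->|x0] := eqVneq x 0; first by rewrite linear0 !normr0 mulr0.
have nx0 : 0 < `|x| by rewrite normr_gt0.
rewrite -ler_pdivrMr// mulrC -[X in X * _]ger0_norm ?invr_ge0 ?(ltW nx0)//.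
rewrite -[_ * _](normrZ _ (f x : R^o)) -linearZ.
apply: dual_norm_ge.
by rewrite normrZ ger0_norm ?invr_ge0 ?(ltW nx0)// mulVf ?gt_eqF.
Qed.

Lemma dual_normD (f g : dual) : dual_norm (f + g) <= dual_norm f + dual_norm g.
Proof.
apply: ge_sup; first by case: (dual_norm_has_sup (f + g)).
move=> _ /= [x x1 <-].
apply: (le_trans (ler_normD (f x : R) (g x))).
by apply: lerD; apply: dual_norm_ge.
Qed.

Lemma dual_normZ (a : R) (f : dual) : dual_norm (a *: f) = `|a| * dual_norm f.
Proof.
have le b (h : dual) : dual_norm (b *: h) <= `|b| * dual_norm h.
  apply: ge_sup; first by case: (dual_norm_has_sup (b *: h)).
  move=> _ /= [x x1 <-]; rewrite (normrZ b (h x : R^o)).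
  by apply: ler_wpM2l => //; apply: dual_norm_ge.
apply/eqP; rewrite eq_le le /=.
have [->|a0] := eqVneq a 0.
  rewrite normr0 mul0r.
  by apply: (le_trans _ (dual_norm_ge (0 *: f) (x := 0) _)); rewrite ?normr0.
rewrite -ler_pdivlMl ?normr_gt0// -normfV.
by apply: le_trans (le _ _); rewrite scalerA mulVf// scale1r.
Qed.

Lemma dual_norm0_eq0 (f : dual) : dual_norm f = 0 -> f = 0.
Proof.
move=> f0; apply: val_inj; apply/funext => x /=.
by apply/eqP; rewrite -normr_le0 (le_trans (dual_norm_ub f x))// f0 mul0r.
Qed.

HB.instance Definition _ :=
  Lmodule_isNormed.Build R dual dual_normD dual_normZ dual_norm0_eq0.

Lemma bounded_dual_pred (f : X -> R^o) (k : R) :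
  linear f -> (forall x, `|f x| <= k * `|x|) -> f \in dual_pred.
Proof.
move=> lf fk; apply/asboolP; split => //.
pose g := GRing.isLinear.Build R X R^o _ f lf.
pose F : {linear X -> R^o} := HB.pack f g.
apply: (@bounded_linear_continuous R X R^o F); apply/linear_boundedP.
near=> r => x; apply: le_trans (fk x) _; apply: ler_wpM2r => //.
Unshelve. all: by end_near. Qed.

Lemma dual_ballP (f g : dual) (e : R) : ball f e g -> dual_norm (f - g) < e.
Proof. by rewrite -ball_normE. Qed.

Lemma dual_complete (F : set_system dual) : ProperFilter F -> cauchy F -> cvg F.
Proof.
move=> FF /cauchyP Fc.
have ev_cauchy (x : X) : cvg ((fun f : dual => f x : R^o) @ F).
  apply: cauchy_cvg; apply: cauchy_exP => e e0.
  have x0 : 0 < `|x| + 1 by rewrite ltr_wpDl.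
  have [f0 Ff0] := Fc _ (divr_gt0 e0 x0).
  exists (f0 x); rewrite /nbhs /=; apply: filterS Ff0 => f.
    rewrite -!ball_normE /= ltr_pdivlMr// => h.
  apply: le_lt_trans h; apply: le_trans (dual_norm_ub (f0 - f) x) _.
  by apply: ler_wpM2l; rewrite ?lerDl// (normr_ge0 (f0 - f)).
pose l (x : X) : R^o := lim ((fun f : dual => f x : R^o) @ F).
have ll : linear l.
  move=> a x y; apply: cvg_lim => //.
  under eq_fun do rewrite linearP.
  apply: cvgD; last exact: ev_cauchy.
  by apply: cvgZl_tmp; exact: ev_cauchy.
have near_l e (f0 : dual) x : F (ball f0 e) -> `|f0 x - l x| <= e * `|x|.
  move=> Ff0.
  have : (fun f : dual => `|f0 x - f x| : R) @ F --> (`|f0 x - l x| : R).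
    by apply: cvg_norm; apply: cvgB; [exact: cvg_cst|exact: ev_cauchy].
  move=> /cvg_lim <- //; apply: limr_le.
    apply: is_cvg_norm; apply: is_cvgB; [exact: is_cvg_cst|exact: ev_cauchy].
  apply: filterS Ff0 => f /dual_ballP h.
  apply: le_trans (dual_norm_ub (f0 - f) x) _.
  by apply: ler_wpM2r => //; exact: ltW.
have [f1 Ff1] := Fc 1 ltr01.
have lb x : `|l x| <= (dual_norm f1 + 1) * `|x|.
  rewrite mulrDl -lerBlDl; apply: le_trans (near_l _ _ x Ff1).
  rewrite distrC; apply: le_trans (lerB_dist _ _).
  by rewrite lerB// dual_norm_ub.
pose L := Dual (bounded_dual_pred ll lb).
apply/cvg_ex; exists L; apply/fcvgrPdist_lt => e e0.
have [f0 Ff0] := Fc _ (divr_gt0 e0 (ltr0Sn R 2)).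
have f0L : `|L - f0| <= e / 3.
  apply: ge_sup; first by case: (dual_norm_has_sup (L - f0)).
  move=> _ /= [x x1 <-].
  have : `|(L - f0) x| <= e / 3 * `|x|.
    have -> : `|(L - f0) x| = `|f0 x - l x| by rewrite [RHS]distrC.
    exact: near_l Ff0.
  by move=> /le_trans; apply; rewrite ler_piMr// divr_ge0// ltW.
apply: filterS Ff0 => f /dual_ballP f0f.
apply: le_lt_trans (ler_distD f0 L f) _.
apply: lt_le_trans (ler_ltD f0L f0f) _.
by rewrite -mulrDl ler_pdivrMr//; lra.
Qed.

HB.instance Definition _ := Uniform_isComplete.Build dual dual_complete.

End Dual.
Arguments dual {R} X.

Section Operators.
Context {R : realType}.
Implicit Types (X Y : normedModType R) (V Q H : hilbertType R).

Lemma inner_ge0 H (x : H) : 0 <= inner x x.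
Proof. by rewrite inner_norm exprn_ge0. Qed.

Lemma innerDl H (x y z : H) : inner (x + y) z = inner x z + inner y z.
Proof. by rewrite -[x]scale1r inner_linear mul1r scale1r. Qed.

Lemma inner0l H (z : H) : inner 0 z = 0.
Proof. by apply: (@addIr _ (inner 0 z)); rewrite -innerDl !add0r. Qed.

Lemma innerZl H a (x z : H) : inner (a *: x) z = a * inner x z.
Proof. by rewrite -[a *: x]addr0 inner_linear inner0l addr0. Qed.

Lemma cauchy_schwarz H (x y : H) : `|inner x y| <= `|x| * `|y|.
Proof.
have [->|y0] := eqVneq y 0.
  by rewrite inner_sym inner0l !normr0 mulr0.
have ny : 0 < `|y| ^+ 2 by rewrite exprn_gt0// normr_gt0.
have := inner_ge0 (x + (- (inner x y / `|y| ^+ 2)) *: y).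
set c := - _; rewrite innerDl inner_sym innerDl innerZl [X in _ + X]innerZl.
rewrite [inner y (_ + _)]inner_sym innerDl innerZl !inner_norm.
rewrite (inner_sym y x).
have -> : `|x| ^+ 2 + c * inner x y + c * (inner x y + c * `|y| ^+ 2)
  = `|x| ^+ 2 - inner x y ^+ 2 / `|y| ^+ 2.
  by rewrite /c; field; rewrite gt_eqF// normr_gt0.
rewrite subr_ge0 ler_pdivrMr// -exprMn => h.
by rewrite -(@ler_pXn2r _ 2) ?nnegrE ?mulr_ge0//= real_normK ?num_real.
Qed.

Lemma clinear_bounded X Y (F : clinear X Y) :
  exists k : R, forall x, `|F x| <= k * `|x|.
Proof.
have /linear_boundedP Fr : bounded_near F (nbhs (0 : X)).
  exact: (continuous_linear_bounded 0 (@clinear_continuous _ _ _ F 0)).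
near +oo_R => r.
have Fxr : forall x, `|F x| <= r * `|x| by near: r.
by exists r.
Unshelve. all: by end_near. Qed.

Lemma pivot_dual V H (j : clinear V H) (h : H) :
  (fun v => inner h (j v) : R^o) \in dual_pred.
Proof.
have [k jk] := clinear_bounded j.
apply: (@bounded_dual_pred _ _ _ (`|h| * k)).
  by move=> a x y; rewrite linearP /= ![inner h _]inner_sym inner_linear.
move=> x; apply: le_trans (cauchy_schwarz _ _) _.
by rewrite -mulrA ler_wpM2l.
Qed.

(** The embedding of H into the dual of V that comes from H = H^*. *)
Definition pivot V H (j : clinear V H) (h : H) : dual V := Dual (pivot_dual j h).

Lemma adjoint_dual V Q (B : clinear V (dual Q)) (q : Q) :
  (fun v => B v q : R^o) \in dual_pred.
Proof.
have [k Bk] := clinear_bounded B.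
apply: (@bounded_dual_pred _ _ _ (k * `|q|)).
  by move=> a x y; rewrite linearP.
move=> x; apply: le_trans (dual_norm_ub _ _) _.
by rewrite mulrAC ler_wpM2r//; exact: Bk.
Qed.

Definition adjoint V Q (B : clinear V (dual Q)) (q : Q) : dual V :=
  Dual (adjoint_dual B q).

End Operators.

Section Bochner.
Context {R : realType} {X : completeNormedModType R}.
Local Notation mu := (@lebesgue_measure R).
Implicit Types (D : set R) (s u v : R -> X).

Definition simple_fun s : Prop :=
  finite_set (range s) /\ forall x, measurable (s @^-1` [set x]).

Definition simple_integral D s : X :=
  \sum_(x \in range s) fine (mu (D `&` s @^-1` [set x])) *: x.

Definition strongly_measurable D u : Prop :=
  exists s_ : nat -> R -> X, (forall n, simple_fun (s_ n)) /\
    {ae mu, forall t, D t -> s_ n t @[n --> \oo] --> u t}.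

(** Meant for D of finite measure. The norms integrated below are only almost
    everywhere equal to Borel functions; the library's integral of a nonnegative
    function is a supremum over Borel simple functions and still returns their
    Lebesgue integral. *)
Definition has_bochner_integral D u (I : X) : Prop :=
  exists s_ : nat -> R -> X,
    [/\ forall n, simple_fun (s_ n),
        {ae mu, forall t, D t -> s_ n t @[n --> \oo] --> u t},
        (\int[mu]_(t in D) `|u t - s_ n t|%:E)%E @[n --> \oo] --> 0%E &
        simple_integral D (s_ n) @[n --> \oo] --> I].

Definition bochner_integral D u : X := xget 0 (has_bochner_integral D u).

Definition bochner_L2 D u : Prop :=
  strongly_measurable D u /\
  (\int[mu]_(t in D) (`|u t| ^+ 2)%:E < +oo)%E.

Definition test_function (a b : R) (phi : R -> R) : Prop :=
  (forall n x, derivable (derive1n n phi) x 1) /\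
  exists c d, [/\ a < c, d < b & forall x, phi x != 0 -> c <= x <= d].

Definition weak_derivative (a b : R) u v : Prop :=
  forall phi, test_function a b phi ->
    bochner_integral `[a, b] (fun t => derive1 phi t *: u t) =
    - bochner_integral `[a, b] (fun t => phi t *: v t).

(** U 0 belongs to H^m(a, b; X) and U k is its k-th derivative. As usual, for
    k < m the class of U k is identified with its continuous representative, so
    that its point values make sense; U m is any representative. *)
Definition sobolev (m : nat) (a b : R) (U : nat -> R -> X) : Prop :=
  [/\ forall k, (k <= m)%N -> bochner_L2 `[a, b] (U k),
      forall k, (k < m)%N -> weak_derivative a b (U k) (U k.+1) &
      forall k, (k < m)%N -> {within `[a, b], continuous (U k)}].

End Bochner.

Section Assumptions.
Context {R : realType} {V Q H : hilbertType R}.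
Implicit Types (j : clinear V H) (A : clinear V (dual V)) (B : clinear V (dual Q)).

Definition gelfand_embedding j : Prop := injective j /\ dense (range j).

Definition inf_sup_condition B (beta : R) : Prop :=
  (beta%:E <= ereal_inf [set ereal_sup [set (B v q / (`|v| * `|q|))%:E
                                       | v in [set v : V | v != 0%R]]
                        | q in [set q : Q | q != 0%R]])%E.

Definition ker B : set V := [set v | B v = 0].

Definition self_adjoint A : Prop := forall v w, A v w = A w v.

Definition splitting j A : Prop :=
  exists (A1 : clinear V (dual V)) (A2 : clinear V H),
    self_adjoint A1 /\ forall v, A v = A1 v + pivot j (A2 v).

Definition elliptic_on A (S : set V) (muA : R) : Prop :=
  forall v, S v -> muA * `|v| ^+ 2 <= A v v.

Definition V_c A B : set V := [set v | forall w, ker B w -> A v w = 0].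

Definition right_inverse_of A B (Bm : dual Q -> V) : Prop :=
  cancel Bm B /\ range Bm = V_c A B.

End Assumptions.

Section Nonlinearity.
Context {R : realType} {V H : hilbertType R}.
Local Notation mu := (@lebesgue_measure R).
Implicit Types (T : R) (f : R -> V -> H).

Definition lipschitz_ball (h : V -> H) (v : V) (r L : R) : Prop :=
  forall v1 v2, ball v r v1 -> ball v r v2 -> `|h v1 - h v2| <= L * `|v1 - v2|.

Definition caratheodory T f : Prop :=
  {ae mu, forall t, t \in `[0, T] -> continuous (f t)} /\
  forall v, strongly_measurable `[0, T] (f ^~ v).

Definition linear_growth T f : Prop :=
  exists2 k : R -> R, bochner_L2 `[0, T] (k : R -> R^o) &
    {ae mu, forall t, t \in `[0, T] -> forall v, `|f t v| <= k t * (1 + `|v|)}.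

Definition locally_lipschitz T f : Prop :=
  forall v, exists r L : R, [/\ 0 < r, 0 <= L &
    {ae mu, forall t, t \in `[0, T] -> lipschitz_ball (f t) v r L}].

Definition lipschitz_strip T f (u : R -> V) (r L : R) : Prop :=
  forall s, s \in `[0, T] ->
    {ae mu, forall t, t \in `[0, T] -> lipschitz_ball (f t) (u s) r L}.

End Nonlinearity.

Section Integrator.
Context {R : realType} {V Q H : hilbertType R}.
Variables (j : clinear V H) (A : clinear V (dual V)) (B : clinear V (dual Q)).
Variable (Bm : dual Q -> V).
Local Notation mu := (@lebesgue_measure R).

Definition solution (a b : R) (rhs : R -> H) (g : R -> dual Q) (ini : V)
    (u : R -> V) (lam : R -> Q) : Prop :=
  [/\ {within `[a, b], continuous u},
      bochner_L2 `[a, b] lam,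
      exists U : nat -> R -> H, [/\ U 0%N = j \o u, sobolev 1 a b U &
        {ae mu, forall t, t \in `[a, b] ->
          pivot j (U 1%N t) + A (u t) + adjoint B (lam t) = pivot j (rhs t)}],
      forall t, t \in `[a, b] -> B (u t) = g t &
      u a = ini].

Definition homogeneous (a b : R) (zeta : V) (z : R -> V) : Prop :=
  exists lam : R -> Q, solution a b (fun=> 0) (fun=> 0) zeta z lam.

Definition saddle_point (h : H) (w : V) : Prop :=
  exists nu : Q, A w + adjoint B nu = pivot j h /\ B w = 0.

Variables (f : R -> V -> H) (g dg : R -> dual Q).

(** One step from t0 to t1 = t0 + tau: u is the current value, uE the exponential
    Euler value, u1 the new one. *)
Definition euler_step (t0 t1 : R) (u uE : V) : Prop :=
  exists w zh,
    [/\ saddle_point (f t0 u - j (Bm (dg t0))) w,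
        homogeneous t0 t1 (u - Bm (g t0) - w) zh &
        uE = Bm (g t1) + zh t1 + w].

Definition corrector_step (tau t0 t1 : R) (u uE u1 : V) : Prop :=
  exists w1 w2 z,
    [/\ saddle_point
          (f t1 uE - j (Bm (dg t1)) - f t0 u + j (Bm (dg t0))) w1,
        saddle_point (tau^-1 *: j w1) w2,
        homogeneous t0 t1 w2 z &
        u1 = uE + z t1 - w2 + w1].

Definition grid (T : R) (N n : nat) : R := n%:R * (T / N%:R).

Definition exp_integrator (T : R) (N : nat) (u0 : V) (u_ uE_ : nat -> V) : Prop :=
  u_ 0%N = u0 /\
  forall n, (n < N)%N ->
    euler_step (grid T N n) (grid T N n.+1) (u_ n) (uE_ n.+1) /\
    corrector_step (T / N%:R) (grid T N n) (grid T N n.+1)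
      (u_ n) (uE_ n.+1) (u_ n.+1).

(** The assumptions on f only concern almost every t, hence say nothing about the
    values f(t_n, .) used by the scheme. This is the same information at the grid
    points: phi, the continuous representative of f(., u(.)), takes the value
    f(t_n, u(t_n)) at t_n, and the Lipschitz estimate in the strip holds at t_n. *)
Definition regular_at_grid (T : R) (N : nat) (u : R -> V) (phi : R -> H)
    (r L : R) : Prop :=
  forall n, (n <= N)%N ->
    phi (grid T N n) = f (grid T N n) (u (grid T N n)) /\
    forall s, s \in `[0, T] -> lipschitz_ball (f (grid T N n)) (u s) r L.

End Integrator.

(* Main.v *)
Require Import Defs.
From HB Require Import structures.
From mathcomp Require Import all_boot all_order all_algebra.
From mathcomp Require Import all_classical all_reals all_analysis measurable_realfun.
From mathcomp Require Import ring lra.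

Set Implicit Arguments.
Unset Strict Implicit.
Unset Printing Implicit Defensive.

Import Order.TTheory GRing.Theory Num.Theory.
Import numFieldNormedType.Exports.

Local Open Scope classical_set_scope.
Local Open Scope ring_scope.

(** Let [K] be the kernel of [B]. The function [Bm g] satisfies the constraint and
    [A (Bm h)] vanishes on [K]; so [u - Bm g] has values in [K] and solves, tested with
    [K], the evolution equation with the source [phi = f(., u) - j Bm g']. The scheme
    solves the same equation exactly, for a source that is constant in a step (Euler) or
    affine (corrector): the saddle point solutions are stationary, a ramp
    [(t - t_n) / tau *: w] produces the linear part, and the homogeneous problems adjust
    the initial value. Consequently the error of either stage is the value at [t_(n+1)]
    of a solution [E] in [K] that starts from [u_n - u(t_n)], and only its source is left
    to estimate. For the Euler stage the source is the Lipschitz defect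
    [f(t_n, u_n) - f(t_n, u(t_n))] plus [phi(t_n) - phi(t)] ([euler_evolution]); for the
    corrected value it is the affine interpolant of the Lipschitz defects at both end
    points plus the interpolation error of [phi] ([corrector_evolution]).

    The energy [Phi v = A1 v v + kap |j v|^2] is coercive in the norm of [V] on [K], and
    a source bounded by [m] in [H] yields
    [Phi(E t1) + m^2 <= exp(c (t1 - t0)) (Phi(E t0) + m^2)] ([energy_estimate]).
    Formally one tests the equation with the velocity of [E], whose dissipation absorbs
    everything else ([energy_rate_bound]); as the velocity need not take values in [V],
    this is done for the Steklov averages of [E]. So sources measured in [H] control
    errors measured in [V].

    By Taylor's formula the interpolation error is at most [2 tau] times the integral of
    [|phi''|] over the step, and the Euler defect at most the integral of [|phi'|]. Their
    squares enter with the factor [exp(c tau) - 1 = O(tau)]. With the Cauchy-Schwarz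
    inequality this produces [tau^4] times the integral of [|phi''|^2] and, as the
    predictor error passes through [f] once more, [tau^3] times the integral of
    [|phi'|^2] ([scheme_recursion]). The sum over the steps is the theorem
    ([recursion_sum]). That the predictors stay in the strip for small [tau] follows by
    induction: the bound for the previous steps makes the square of the next predictor
    error [O(tau)].

    The point values used above have to be extracted from hypotheses on Bochner integrals
    against test functions. Functionals commute with these integrals
    ([has_bochner_integral_functional]), the spaces in question have norming functionals,
    and the du Bois-Reymond lemma turns a scalar weak derivative into increments
    ([weak_derivative_increment]). The right inverse is bounded by the inf-sup condition
    and the ellipticity on [K] ([right_inverse_bounded]). *)

(** * Hilbert spaces and the right inverse of B *)

Section HilbertSpaces.
Context {R : realType}.
Implicit Types (V Q H : hilbertType R).

Lemma innerDr H (x y z : H) : inner x (y + z) = inner x y + inner x z.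
Proof. by rewrite !(inner_sym x) innerDl. Qed.

Lemma innerZr H a (x y : H) : inner x (a *: y) = a * inner x y.
Proof. by rewrite !(inner_sym x) innerZl. Qed.

Lemma innerNl H (x y : H) : inner (- x) y = - inner x y.
Proof. by rewrite -scaleN1r innerZl mulN1r. Qed.

Lemma innerNr H (x y : H) : inner x (- y) = - inner x y.
Proof. by rewrite -scaleN1r innerZr mulN1r. Qed.

Lemma innerBl H (x y z : H) : inner (x - y) z = inner x z - inner y z.
Proof. by rewrite innerDl innerNl. Qed.

Lemma innerBr H (x y z : H) : inner x (y - z) = inner x y - inner x z.
Proof. by rewrite innerDr innerNr. Qed.

Lemma inner_le H (x y : H) : inner x y <= `|x| * `|y|.
Proof. exact: le_trans (ler_norm _) (cauchy_schwarz _ _). Qed.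

Lemma inner_functional_dual H (h : H) : (fun v => inner h v : R^o) \in dual_pred.
Proof.
apply: (@bounded_dual_pred _ _ _ `|h|); last exact: cauchy_schwarz.
by move=> a x y; rewrite innerDr innerZr.
Qed.

Definition inner_functional H (h : H) : dual H := Dual (inner_functional_dual h).

(** The minimising sequences of [b x x - 2 * l x] are Cauchy by the parallelogram
    identity, and the first variation vanishes at their limit. *)
Lemma symmetric_lax_milgram V (b : V -> V -> R) (k m : R) (l : dual V) :
    (forall a x y z, b (a *: x + y) z = a * b x z + b y z) ->
    (forall x y, b x y = b y x) ->
    (forall x y, `|b x y| <= k * (`|x| * `|y|)) ->
    0 < m -> (forall x, m * `|x| ^+ 2 <= b x x) ->
  exists x, forall v, b x v = l v.
Proof.
move=> bl bs bk m0 bm.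
have b0 z : b 0 z = 0.
  by have := bl (-1) 0 0 z; rewrite scaler0 addr0 mulN1r addNr.
have bD x y z : b (x + y) z = b x z + b y z.
  by rewrite -[x]scale1r bl mul1r scale1r.
have bZ a x z : b (a *: x) z = a * b x z.
  by rewrite -[a *: x]addr0 bl b0 addr0.
have bDr x y z : b z (x + y) = b z x + b z y by rewrite !(bs z) bD.
have bZr a x z : b z (a *: x) = a * b z x by rewrite !(bs z) bZ.
have lZ a x : l (a *: x) = a * l x by rewrite linearZ.
have lD x y : l (x + y) = l x + l y by rewrite linearD.
pose J x := b x x - 2 * l x.
have Jlb x : - (dual_norm l ^+ 2 / m) <= J x.
  rewrite /J lerNl opprB.
  have h1 : l x <= dual_norm l * `|x| := le_trans (ler_norm _) (dual_norm_ub l x).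
  have h2 := bm x.
  rewrite ler_pdivlMr//.
  have := sqr_ge0 (m * `|x| - dual_norm l); nra.
have hJ : has_inf (range J).
  by split; [exists (J 0), 0|exists (- (dual_norm l ^+ 2 / m)) => _ [x _ <-]].
pose d := inf (range J).
have dJ x : d <= J x by apply: ge_inf; [exact: hJ.2|exists x].
have /choice[x_ x_P] : forall n : nat, exists x, J x < d + n.+1%:R^-1.
  move=> n; have [_ [x _ <-] hx] := @inf_adherent _ (range J) n.+1%:R^-1 ltac:(by []) hJ.
  by exists x.
have Jmid x y : b (x - y) (x - y) = 2 * J x + 2 * J y - 4 * J (2^-1 *: (x + y)).
  rewrite /J -[- y]scaleN1r !(bD, bDr, bZ, bZr, lZ, lD) (bs y x).
  by field.
have x_C n p : m * `|x_ n - x_ p| ^+ 2 <= 2 * n.+1%:R^-1 + 2 * p.+1%:R^-1.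
  apply: le_trans (bm _) _; rewrite Jmid.
  have := dJ (2^-1 *: (x_ n + x_ p)); have := x_P n; have := x_P p.
  move: (J _) (J _) (J _) n.+1%:R^-1 p.+1%:R^-1 => j1 j2 j3 i1 i2; lra.
have x_cvg : cvgn x_.
  apply: cauchy_cvg; apply: cauchy_exP => e e0.
  have e1 : 0 < m * e ^+ 2 / 4 by rewrite divr_gt0// mulr_gt0// exprn_gt0.
  have /cvgrPdist_lt/(_ _ e1)[N _ NP] := @cvg_harmonic R.
  exists (x_ N), N => // p /= Np.
  rewrite -ball_normE /= -(@ltr_pXn2r _ 2) ?nnegrE ?(ltW e0)// -(ltr_pM2l m0).
  apply: le_lt_trans (x_C _ _) _.
  have := NP N (leqnn N); have := NP p Np.
  rewrite /= /harmonic !sub0r !normrN !ger0_norm//.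
  move: N.+1%:R^-1 p.+1%:R^-1 => i1 i2; lra.
pose x := lim (x_ @ \oo); exists x => v.
have bvv0 : 0 <= b v v by apply: le_trans (bm v); rewrite mulr_ge0 ?(ltW m0)// exprn_ge0.
have var n : (b (x_ n) v - l v) ^+ 2 <= (b v v + 1) * n.+1%:R^-1.
  set r := b (x_ n) v - l v.
  have := dJ (x_ n + (- (r / (b v v + 1))) *: v).
  have := x_P n; rewrite /J !(bD, bDr, bZ, bZr, lZ, lD) (bs v (x_ n)).
  set s := r / _; have rE : r = s * (b v v + 1) by rewrite /s divfK// gt_eqF// ltr_wpDl.
  have -> : b (x_ n) v = r + l v by rewrite /r subrK.
  rewrite rE => h1 h2.
  have h3 : s ^+ 2 * (b v v + 1) <= n.+1%:R^-1.
    have := sqr_ge0 s; move: h1 h2; clear.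
    move: (b v v) (b (x_ n) (x_ n)) (l (x_ n)) (l v) n.+1%:R^-1 s => w xx lx lv i s.
    nra.
  rewrite exprMn [X in _ * X]expr2 mulrA mulrC ler_wpM2l ?addr_ge0//.
have r0 : (b (x_ n) v - l v) @[n --> \oo] --> (0 : R).
  apply/cvgrPdist_lt => e e0.
  have e1 : 0 < e ^+ 2 / (b v v + 1) by rewrite divr_gt0 ?exprn_gt0// ltr_wpDl.
  have /cvgrPdist_lt/(_ _ e1)[N _ NP] := @cvg_harmonic R.
  exists N => // n /= Nn; rewrite sub0r normrN.
  rewrite -(@ltr_pXn2r _ 2) ?nnegrE ?(ltW e0)// real_normK ?num_real//.
  apply: le_lt_trans (var n) _.
  have := NP n Nn; rewrite /= /harmonic sub0r normrN ger0_norm//.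
  by rewrite ltr_pdivlMr ?ltr_wpDl// mulrC.
have bxv : (b (x_ n) v) @[n --> \oo] --> b x v.
  apply/cvgrPdist_lt => e e0.
  have k0 : 0 < (`|k| + 1) * (`|v| + 1) by rewrite mulr_gt0 ?ltr_wpDl.
  move/cvgrPdist_lt: (x_cvg) => /(_ _ (divr_gt0 e0 k0))[N _ NP].
  exists N => // n /= Nn.
  have -> : b x v - b (x_ n) v = b (x - x_ n) v by rewrite -[- x_ n]scaleN1r bD bZ mulN1r.
  apply: le_lt_trans (bk _ _) _.
  have := NP n Nn; rewrite ltr_pdivlMr// => h; apply: le_lt_trans h.
  rewrite mulrCA ler_wpM2l//; apply: (@le_trans _ _ (`|k| * `|v|)).
    by rewrite ler_wpM2r// ler_norm.
  by rewrite ler_pM// lerDl.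
have bl_cvg : (b (x_ n) v - l v) @[n --> \oo] --> b x v - l v.
  by apply: cvgB => //; exact: cvg_cst.
by apply/eqP; rewrite -subr_eq0; apply/eqP; exact: (cvg_unique _ bl_cvg r0).
Qed.

Corollary riesz V (l : dual V) : exists x, forall v, inner x v = l v.
Proof.
apply: (@symmetric_lax_milgram V (@inner R V) 1 1 l); rewrite ?ltr01//.
- exact: inner_linear.
- exact: inner_sym.
- by move=> x y; rewrite mul1r cauchy_schwarz.
- by move=> x; rewrite mul1r inner_norm.
Qed.

Lemma riesz_norm V (l : dual V) (x : V) :
  (forall v, inner x v = l v) -> `|l| = `|x|.
Proof.
move=> xl; apply/eqP; rewrite eq_le; apply/andP; split.
  apply: ge_sup; first by case: (dual_norm_has_sup l).
  move=> _ /= [v v1 <-]; rewrite -xl; apply: le_trans (cauchy_schwarz _ _) _.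
  by rewrite ler_piMr.
have [->|x0] := eqVneq x 0; first by rewrite normr0.
rewrite -(@ler_pM2r _ `|x|) ?normr_gt0// -expr2 -inner_norm xl.
exact: le_trans (ler_norm _) (dual_norm_ub _ _).
Qed.

End HilbertSpaces.

(** Spaces whose norms are attained by functionals of norm at most one: through
    them, an inequality between vectors becomes one between real numbers. *)
Definition norming {R : realType} (X : normedModType R) : Prop :=
  forall x : X, exists2 l : dual X, l x = `|x| & forall y, `|l y| <= `|y|.

Section Norming.
Context {R : realType}.

Lemma hilbert_norming (H : hilbertType R) : norming H.
Proof.
move=> x; have [->|x0] := eqVneq x 0.
  exists 0; first by rewrite normr0.
  by move=> y; rewrite (_ : (0 : dual H) y = 0)// normr0.
have nx0 : 0 < `|x| by rewrite normr_gt0.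
exists (inner_functional (`|x|^-1 *: x)) => [|y] /=.
  by rewrite innerZl inner_norm expr2 mulKf// gt_eqF.
apply: le_trans (cauchy_schwarz _ _) _.
by rewrite normrZ normfV normr_id mulVf ?mul1r// gt_eqF.
Qed.

Lemma evaluation_dual (X : normedModType R) (x : X) :
  (fun f : dual X => f x : R^o) \in dual_pred.
Proof.
apply: (@bounded_dual_pred _ _ _ `|x|) => // f.
by rewrite mulrC; exact: dual_norm_ub.
Qed.

Definition evaluation (X : normedModType R) (x : X) : dual (dual X) :=
  Dual (evaluation_dual x).

(** The norm of a functional is attained at its Riesz representative. *)
Lemma dual_norming (Q : hilbertType R) : norming (dual Q).
Proof.
move=> f; have [q qf] := riesz f.
have fq := riesz_norm qf.
have [q0|q0] := eqVneq q 0.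
  exists 0; first by rewrite fq q0 normr0.
  by move=> y; rewrite (_ : (0 : dual (dual Q)) y = 0)// normr0.
have nq0 : 0 < `|q| by rewrite normr_gt0.
exists (evaluation (`|q|^-1 *: q)) => [|y] /=.
  by rewrite linearZ /= -qf inner_norm fq /GRing.scale/= expr2 mulKf// gt_eqF.
apply: le_trans (dual_norm_ub _ _) _.
by rewrite normrZ normfV normr_id mulVf ?mulr1// gt_eqF.
Qed.

End Norming.

Section DualOperators.
Context {R : realType} {X Y : normedModType R}.
Implicit Types (F : clinear X (dual Y)).

Lemma dual_operatorD F x y w : F (x + y) w = F x w + F y w.
Proof. by rewrite linearD. Qed.

Lemma dual_operatorB F x y w : F (x - y) w = F x w - F y w.
Proof. by rewrite linearB. Qed.

Lemma dual_operatorZ F a x w : F (a *: x) w = a * F x w.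
Proof. by rewrite linearZ. Qed.

End DualOperators.

Lemma clinear_bounded_ge0 {R : realType} {X Y : normedModType R} (F : clinear X Y) :
  exists2 k : R, 0 <= k & forall x, `|F x| <= k * `|x|.
Proof.
have [k Fk] := clinear_bounded F; exists `|k| => // x.
by apply: le_trans (Fk x) _; rewrite ler_wpM2r// ler_norm.
Qed.

Section RightInverse.
Context {R : realType} {V Q : hilbertType R}.
Variables (A : clinear V (dual V)) (B : clinear V (dual Q)) (Bm : dual Q -> V).
Variables (beta muA : R).
Hypotheses (beta0 : 0 < beta) (hB : inf_sup_condition B beta).
Hypotheses (muA0 : 0 < muA) (hAB : elliptic_on A (ker B) muA).
Hypothesis hBm : right_inverse_of A B Bm.

Lemma right_inverse_orthogonal h w : B w = 0 -> A (Bm h) w = 0.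
Proof.
move=> Bw; have : range Bm (Bm h) by exists h.
by rewrite hBm.2; apply.
Qed.

Lemma right_inverse_unique v h : B v = h -> (forall w, B w = 0 -> A v w = 0) ->
  v = Bm h.
Proof.
move=> Bv Av; apply/eqP; rewrite -subr_eq0 -normr_le0.
have Bd : B (v - Bm h) = 0 by rewrite linearB /= hBm.1 Bv subrr.
have : A (v - Bm h) (v - Bm h) = 0.
  by rewrite dual_operatorB right_inverse_orthogonal// Av// subrr.
have := hAB Bd; set x := v - _ => /[swap] ->; rewrite pmulr_rle0// => h0.
rewrite -(@ler_pXn2r _ 2) ?nnegrE// expr0n /=//.
Qed.

Lemma right_inverse_linear : linear Bm.
Proof.
move=> a x y; apply/esym/right_inverse_unique.
  by rewrite linearP /= !hBm.1.
move=> w Bw; rewrite dual_operatorD dual_operatorZ.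
by rewrite !right_inverse_orthogonal// mulr0 addr0.
Qed.

(** By Riesz, [B] has a Hilbert adjoint [S : Q -> V], which the inf-sup condition
    makes bounded below; so [B \o S] is coercive and [h = B (S q)] is solvable.
    The ellipticity on the kernel bounds the remaining part [Bm h - S q]. *)
Lemma right_inverse_bounded : exists k, forall h, `|Bm h| <= k * `|h|.
Proof.
have /choice[S SP] : forall q, exists x, forall v, inner x v = B v q.
  by move=> q; have [x xP] := riesz (adjoint B q); exists x.
have S_ge q : beta * `|q| <= `|S q|.
  have [->|q0] := eqVneq q 0; first by rewrite normr0 mulr0.
  have nq0 : 0 < `|q| by rewrite normr_gt0.
  have := hB; rewrite /inf_sup_condition => /le_trans hq.
  have /hq : (ereal_inf [set ereal_sup [set (B v q / (`|v| * `|q|))%:E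
                                       | v in [set v : V | v != 0%R]]
                        | q in [set q : Q | q != 0%R]] <=
      ereal_sup [set (B v q / (`|v| * `|q|))%:E | v in [set v : V | v != 0%R]])%E.
    by apply: ereal_inf_lbound; exists q.
  move=> hq1; rewrite -ler_pdivlMr// -lee_fin; apply: le_trans hq1 _.
  apply: ge_ereal_sup => _ [v /= v0 <-]; rewrite lee_fin.
  have nv0 : 0 < `|v| by rewrite normr_gt0.
  rewrite ler_pdivrMr ?mulr_gt0// -SP.
  rewrite [X in _ <= X](_ : _ = `|S q| * `|v|) ?inner_le//.
  by field; rewrite gt_eqF.
have [kB kB0 B_le] := clinear_bounded_ge0 B.
have [kA kA0 A_le] := clinear_bounded_ge0 A.
have S_le q : `|S q| <= kB * `|q|.
  have [->|q0] := eqVneq (S q) 0; first by rewrite normr0 mulr_ge0.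
  rewrite -(@ler_pM2r _ `|S q|) ?normr_gt0// -expr2 -inner_norm SP.
  apply: le_trans (ler_norm _) _; apply: le_trans (dual_norm_ub _ _) _.
  by rewrite mulrAC ler_wpM2r//; exact: B_le.
have SD q q' v : inner (S q + S q') v = inner (S (q + q')) v.
  by rewrite innerDl !SP linearD.
have solve (h : dual Q) : exists q, B (S q) = h.
  have [|||||q hq] := @symmetric_lax_milgram _ Q (fun x y => inner (S x) (S y))
    (kB ^+ 2) (beta ^+ 2) h.
  - by move=> a x y z; rewrite !SP linearP.
  - by move=> x y; rewrite inner_sym.
  - move=> x y; apply: le_trans (cauchy_schwarz _ _) _.
    by rewrite expr2 mulrACA ler_pM.
  - by rewrite exprn_gt0.
  - move=> x; rewrite inner_norm -exprMn ler_pXn2r// nnegrE//.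
    by rewrite mulr_ge0// ltW.
  by exists q; apply: val_inj; apply/funext => x /=; rewrite -hq inner_sym SP.
exists ((1 + kA / muA) / beta) => h.
have [q qP] := solve h.
have Sq : `|S q| <= `|h| / beta.
  have [->|q0] := eqVneq (S q) 0; first by rewrite normr0 mulr_ge0// invr_ge0 ltW.
  rewrite -(@ler_pM2r _ `|S q|) ?normr_gt0// -expr2 -inner_norm SP qP.
  apply: le_trans (ler_norm _) _; apply: le_trans (dual_norm_ub _ _) _.
  by rewrite -mulrA ler_wpM2l ?(normr_ge0 h)// ler_pdivlMl.
pose k := Bm h - S q.
have Bk : B k = 0 by rewrite linearB /= hBm.1 qP subrr.
have hk : `|k| <= kA / muA * `|S q|.
  have [->|k0] := eqVneq k 0; first by rewrite normr0 !mulr_ge0// invr_ge0 ltW.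
  rewrite mulrAC ler_pdivlMr// -(@ler_pM2r _ `|k|) ?normr_gt0//.
  have := hAB Bk; rewrite {2}/k dual_operatorB.
  rewrite right_inverse_orthogonal// sub0r.
  rewrite expr2 mulrCA mulrC -mulrA mulrCA mulrA => /le_trans; apply.
  apply: le_trans (ler_norm _) _; rewrite normrN.
  apply: le_trans (dual_norm_ub _ _) _; rewrite ler_wpM2r//; exact: A_le.
have -> : Bm h = S q + k by rewrite /k addrC subrK.
apply: le_trans (ler_normD _ _) _.
apply: le_trans (lerD (lexx _) hk) _.
rewrite -[X in X + _]mul1r -mulrDl -mulrA ler_wpM2l ?addr_ge0 ?divr_ge0 ?(ltW muA0)//.
by rewrite mulrC.
Qed.

End RightInverse.

(** * Integrals compared almost everywhere, finitely valued functions *)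

Section NonmeasurableIntegrands.
Context {d} {T : measurableType d} {R : realType}.
Variable mu : {measure set T -> \bar R}.
Local Open Scope ereal_scope.
Implicit Types (D : set T) (f g : T -> \bar R).

(** The integral of a nonnegative function is the supremum over the simple functions
    below it. The norm of a strongly measurable function is only almost everywhere equal
    to a measurable one, so that the comparison has to reach arbitrary integrands. *)
Lemma nonneg_integral_mono D f g : (forall x, D x -> 0 <= f x) ->
  (forall x, D x -> f x <= g x) ->
  \int[mu]_(x in D) f x <= \int[mu]_(x in D) g x.
Proof.
move=> f0 fg; rewrite !(integral_mkcond D).
have fD0 x : 0 <= (f \_ D) x by apply: erestrict_ge0.
have fgD x : (f \_ D) x <= (g \_ D) x.
  by rewrite !patchE; case: ifPn => // /set_mem; exact: fg.
rewrite !ge0_integralTE//; last by move=> x; exact: le_trans (fgD x).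
by apply: ereal_sup_le => _ /= [h hf <-]; exists h => // x; exact: le_trans (fgD x).
Qed.

Lemma nonneg_integral_subset D D' f : D' `<=` D -> (forall x, D x -> 0 <= f x) ->
  \int[mu]_(x in D') f x <= \int[mu]_(x in D) f x.
Proof.
move=> D'D f0; rewrite (integral_mkcond D') (integral_mkcond D).
apply: nonneg_integral_mono => x _; rewrite !patchE.
  by case: ifPn => // /set_mem /D'D; exact: f0.
case: ifPn => [/set_mem /D'D Dx|_]; first by rewrite mem_set.
by case: ifPn => // /set_mem; exact: f0.
Qed.

(** Removing the exceptional null set from the domain leaves the integral of the
    measurable function [f] unchanged and can only decrease that of [g]. *)
Lemma ae_nonneg_integral_mono_l D f g : measurable D -> measurable_fun D f ->
  (forall x, D x -> 0 <= f x) -> (forall x, D x -> 0 <= g x) ->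
  {ae mu, forall x, D x -> f x <= g x} ->
  \int[mu]_(x in D) f x <= \int[mu]_(x in D) g x.
Proof.
move=> mD mf f0 g0 [N [mN muN fgN]].
rewrite (ge0_negligible_integral _ _ _ _ muN)//.
apply: (@le_trans _ _ (\int[mu]_(x in D `\` N) g x)).
  apply: nonneg_integral_mono => x [Dx Nx]; first exact: f0.
  by apply: contrapT => fgx; apply/Nx/fgN => /(_ Dx).
by apply: nonneg_integral_subset => // x [].
Qed.

(** Raising [g] to [+oo] on the exceptional null set leaves its integral unchanged and
    makes the comparison hold everywhere. *)
Lemma ae_nonneg_integral_mono_r D f g : measurable D -> measurable_fun D g ->
  (forall x, D x -> 0 <= f x) -> (forall x, D x -> 0 <= g x) ->
  {ae mu, forall x, D x -> f x <= g x} ->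
  \int[mu]_(x in D) f x <= \int[mu]_(x in D) g x.
Proof.
move=> mD mg f0 g0 [N [mN muN fgN]].
pose g' x := if x \in N then +oo else g x.
have g'0 x : D x -> 0 <= g' x by rewrite /g'; case: ifPn => // _; exact: g0.
have mg' : measurable_fun D g'.
  apply: measurable_fun_if => //.
  - apply: (measurable_fun_bool true); apply: measurableI => //.
    rewrite (_ : _ @^-1` _ = N)//.
    by apply/seteqP; split => x /=; [move/set_mem|move/mem_set].
  - by apply: measurable_funS mg.
have -> : \int[mu]_(x in D) g x = \int[mu]_(x in D) g' x.
  apply: ge0_ae_eq_integral => //.
  exists N; split => // x /= h; apply: contrapT => Nx; apply: h => _.
  by rewrite /g' memNset.
apply: nonneg_integral_mono => // x Dx; rewrite /g'; case: ifPn => [_|].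
  by rewrite leey.
by rewrite notin_setE => Nx; apply: contrapT => fgx; apply/Nx/fgN => /(_ Dx).
Qed.

End NonmeasurableIntegrands.

Section AlmostEverywhere.
Context {d} {T : measurableType d} {R : realType}.
Variable mu : {measure set T -> \bar R}.

Lemma ae_mono (P Q : T -> Prop) : (forall t, P t -> Q t) ->
  {ae mu, forall t, P t} -> {ae mu, forall t, Q t}.
Proof.
by move=> PQ; apply: negligibleS; apply: subsetC => t; exact: PQ.
Qed.

Lemma ae_and (P Q : T -> Prop) : {ae mu, forall t, P t} ->
  {ae mu, forall t, Q t} -> {ae mu, forall t, P t /\ Q t}.
Proof. exact: (@filterI _ _ (ae_filter_ringOfSetsType mu)). Qed.

End AlmostEverywhere.

Section FinitelyValued.
Context {R : realType}.

(** The condition of [simple_fun] for values in an arbitrary type, which makes pairs and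
    images of simple functions members of the same class. *)
Definition finitely_valued {S : Type} (s : R -> S) : Prop :=
  finite_set (range s) /\ forall x, measurable (s @^-1` [set x]).

Lemma finitely_valued_preimage {S : Type} (s : R -> S) (A : set S) :
  finitely_valued s -> measurable (s @^-1` A).
Proof.
move=> [fs ms].
have -> : s @^-1` A = \bigcup_(y in range s `&` A) (s @^-1` [set y]).
  apply/seteqP; split => t /=; first by move=> At; exists (s t).
  by move=> [y [_ Ay] ->].
apply: fin_bigcup_measurable => //.
by apply: sub_finite_set fs => y [].
Qed.

Lemma finitely_valued_comp {S S' : Type} (f : S -> S') (s : R -> S) :
  finitely_valued s -> finitely_valued (f \o s).
Proof.
move=> fs; split; last first.
  by move=> x; exact: (finitely_valued_preimage (f @^-1` [set x]) fs).
have -> : range (f \o s) = f @` range s.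
  apply/seteqP; split => [_ [t _ <-]|_ [_ [t _ <-] <-]]; last by exists t.
  by exists (s t) => //; exists t.
by apply: finite_image; case: fs.
Qed.

Lemma finitely_valued_pair {S S' : Type} (s : R -> S) (s' : R -> S') :
  finitely_valued s -> finitely_valued s' ->
  finitely_valued (fun t => (s t, s' t)).
Proof.
move=> [fs ms] [fs' ms']; split.
  apply: (@sub_finite_set _ _ (range s `*` range s')); last exact: finite_setX.
  by move=> _ [t _ <-]; split => /=; exists t.
move=> [x y]; rewrite (_ : _ @^-1` _ = s @^-1` [set x] `&` s' @^-1` [set y]).
  exact: measurableI.
by apply/seteqP; split => t /= [-> ->].
Qed.

Lemma finitely_valued_if {S : Type} (E : set R) (s s' : R -> S) :
  measurable E -> finitely_valued s -> finitely_valued s' ->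
  finitely_valued (fun t => if t \in E then s t else s' t).
Proof.
move=> mE fs fs'.
have fE : finitely_valued (fun t : R => t \in E).
  split; first exact: (sub_finite_set (B := [set` predT])).
  have preE : (fun t => t \in E) @^-1` [set true] = E.
    by apply/seteqP; split => t /=; [move/set_mem|move/mem_set].
  case; first by rewrite preE.
  rewrite (_ : _ @^-1` _ = ~` E); first exact: measurableC.
  apply/seteqP; split => t /=; first by move=> + Et; rewrite mem_set.
  by move=> Et; rewrite memNset.
have := finitely_valued_comp
  (fun p : bool * (S * S) => if p.1 then p.2.1 else p.2.2)
  (finitely_valued_pair fE (finitely_valued_pair fs fs')).
by [].
Qed.

Lemma finitely_valued_cst {S : Type} (x : S) : finitely_valued (fun _ : R => x).
Proof.
split; first by apply: (sub_finite_set _ (finite_set1 x)) => _ [t _ <-].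
move=> y; have [->|xy] := pselect (x = y).
  by rewrite (_ : _ @^-1` _ = setT)//; apply/seteqP; split.
by rewrite (_ : _ @^-1` _ = set0)//; apply/seteqP; split.
Qed.

Lemma finitely_valued_indic (E : set R) :
  measurable E -> finitely_valued (\1_E : R -> R).
Proof.
move=> mE.
have -> : (\1_E : R -> R) = (fun t => if t \in E then 1 else 0).
  by apply/funext => t; rewrite indicE; case: (t \in E).
by apply: finitely_valued_if; [|exact: finitely_valued_cst..].
Qed.

Lemma finitely_valued_measurable (s : R -> R) (D : set R) :
  finitely_valued s -> measurable_fun D s.
Proof.
move=> fs mD A mA; apply: measurableI => //.
exact: finitely_valued_preimage.
Qed.

Lemma finitely_valued_integrable (s : R -> R) (D : set R) :
  measurable D -> (lebesgue_measure D < +oo)%E -> finitely_valued s ->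
  lebesgue_measure.-integrable D (EFin \o s).
Proof.
move=> mD Dfin fs; apply: measurable_bounded_integrable => //.
  exact: finitely_valued_measurable.
have [M hM] : exists M, forall t, `|s t| <= M.
  have : finite_set (range s) by case: fs.
  move=> /finite_seqP[r rE]; exists (\sum_(x <- r) `|x|) => t.
  have : range s (s t) by exists t.
  rewrite rE /= => str; rewrite (big_rem (s t))//= lerDl sumr_ge0//.
exists M; split; first exact: num_real.
by move=> x Mx t _ /=; rewrite (le_trans (hM t))// ltW.
Qed.

End FinitelyValued.

(** * Bochner integrals and functionals *)

Section BochnerIntegral.
Context {R : realType} {X : completeNormedModType R}.
Local Notation mu := (@lebesgue_measure R).
Implicit Types (D : set R) (s u : R -> X) (l : dual X).

Lemma dual_functional_bound l : exists2 k : R, 0 < k & forall x, `|l x| <= k * `|x|.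
Proof.
exists (`|dual_norm l| + 1); first by rewrite ltr_wpDl.
move=> x; apply: le_trans (dual_norm_ub l x) _.
by rewrite ler_wpM2r// (le_trans (ler_norm _))// lerDl.
Qed.

Lemma simple_integral_functional D l s : measurable D -> (mu D < +oo)%E ->
  simple_fun s -> l (simple_integral D s) = (\int[mu]_(t in D) l (s t))%R.
Proof.
move=> mD Dfin [fs ms].
rewrite /simple_integral fsbig_finite// linear_sum /=.
rewrite /Rintegral.
have E t : l (s t) = \sum_(x <- finmap.enum_fset (fset_set (range s))) l x * \1_(s @^-1` [set x]) t.
  rewrite (bigD1_seq (s t)) ?finmap.fset_uniq//=; last first.
    by rewrite in_fset_set//; apply/mem_set; exists t.
  rewrite indicE mem_set// mulr1 big1 ?addr0// => x xst.
  by rewrite indicE memNset ?mulr0//= => /esym/eqP; exact/negP.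
under eq_integral do rewrite E -sumEFin.
rewrite integral_sum//; last first.
  move=> x; apply: finitely_valued_integrable => //.
  apply: (finitely_valued_comp (fun c : R => l x * c)).
  exact: (finitely_valued_indic (ms x)).
have mDx x : mu (D `&` s @^-1` [set x]) \is a fin_num.
  rewrite ge0_fin_numE//; apply: le_lt_trans Dfin.
  apply: le_measure; [|exact/mem_set|by move=> t []].
  by apply/mem_set; apply: measurableI => //; exact: ms.
rewrite (_ : (\sum_(i <- _) _)%E =
   (\sum_(x <- finmap.enum_fset (fset_set (range s))) fine (mu (D `&` s @^-1` [set x])) * l x)%:E).
  by apply: eq_bigr => x _; rewrite linearZ.
rewrite -sumEFin; apply: eq_bigr => x _.
under eq_integral do rewrite EFinM.
rewrite integralZl//; last first.
  by apply: finitely_valued_integrable => //; exact: (finitely_valued_indic (ms x)).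
rewrite integral_indic//; last exact: ms.
by rewrite setIC EFinM fineK// muleC.
Qed.

(** Set to zero on the exceptional set, the approximants converge everywhere. *)
Lemma strongly_measurable_representative D u : measurable D ->
  strongly_measurable D u -> exists (s_ : nat -> R -> X) (u' : R -> X),
    [/\ forall n, simple_fun (s_ n), forall t, s_ n t @[n --> \oo] --> u' t &
        {ae mu, forall t, D t -> u t = u' t}].
Proof.
move=> mD [s_ [ss [N [mN N0 sN]]]].
pose E := D `\` N.
exists (fun n t => if t \in E then s_ n t else 0).
exists (fun t => if t \in E then u t else 0); split.
- move=> n; apply: finitely_valued_if; [exact: measurableD|exact: ss|].
  exact: finitely_valued_cst.
- move=> t; case: ifPn => [/set_mem[Dt Nt]|_]; last exact: cvg_cst.
  by apply: contrapT => h; apply/Nt/sN => /(_ Dt).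
- exists N; split => // t /= h; apply: contrapT => Nt; apply: h => Dt.
  by rewrite mem_set.
Qed.

Lemma norm_limit_measurable (s_ : nat -> R -> X) u D :
  (forall n, simple_fun (s_ n)) -> (forall t, s_ n t @[n --> \oo] --> u t) ->
  measurable_fun D (fun t => `|u t|).
Proof.
move=> ss su; apply: (@measurable_fun_cvg _ _ _ _ (fun n t => `|s_ n t|)).
  move=> n; apply: finitely_valued_measurable.
  by apply: (finitely_valued_comp (fun x : X => `|x|)); exact: ss.
by move=> t _; apply: cvg_norm; exact: su.
Qed.

(** [s_ n t] is replaced by zero where it exceeds the bound: if [u t] is not zero, this
    happens for finitely many [n] only. *)
Lemma dominated_simple_approximation (s_ : nat -> R -> X) u :
  (forall n, simple_fun (s_ n)) -> (forall t, s_ n t @[n --> \oo] --> u t) ->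
  exists s'_ : nat -> R -> X,
    [/\ forall n, simple_fun (s'_ n), forall t, s'_ n t @[n --> \oo] --> u t &
        forall n t, `|s'_ n t| <= 2 * `|u t|].
Proof.
move=> ss su; pose E n := [set t | `|s_ n t| <= 2 * `|u t|].
have mE n : measurable (E n).
  have := @measurable_fun_ler _ _ R setT (fun t => `|s_ n t|) (fun t => 2 * `|u t|).
  have -> : E n = setT `&` (fun t => `|s_ n t| <= 2 * `|u t|) @^-1` [set true].
    by rewrite setTI.
  apply => //.
    apply: finitely_valued_measurable.
    by apply: (finitely_valued_comp (fun x : X => `|x|)); exact: ss.
  by apply: measurable_funM => //; exact: norm_limit_measurable ss su.
exists (fun n t => if t \in E n then s_ n t else 0); split.
- move=> n; apply: finitely_valued_if => //; first exact: ss.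
  exact: finitely_valued_cst.
- move=> t; have [u0|u0] := eqVneq (u t) 0.
    rewrite [X in X @ _ --> _](_ : _ = cst (u t)); first exact: cvg_cst.
    apply/funext => n; case: ifPn => [/set_mem|]; rewrite ?u0//.
    by rewrite /E /= u0 normr0 mulr0 normr_le0 => /eqP.
  apply: cvg_trans (su t); apply: near_eq_cvg.
  have nu0 : 0 < `|u t| by rewrite normr_gt0.
  move/cvgrPdist_lt: (su t) => /(_ _ nu0); apply: filterS => n h.
  rewrite mem_set// /E /=.
  have -> : s_ n t = u t - (u t - s_ n t) by rewrite subKr.
  by apply: le_trans (ler_normB _ _) _; rewrite mulr2n mulrDl mul1r lerD2l ltW.
- move=> n t; case: ifPn => [/set_mem//|_]; first by rewrite normr0 mulr_ge0.
Qed.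

(** Functionals commute with the integrals of simple functions, and both sides are limits
    along the same approximants. The function [c] stands for [l \o u], which is only
    almost everywhere equal to an integrable function. *)
Lemma has_bochner_integral_functional D u I l (c : R -> R) :
  measurable D -> (mu D < +oo)%E -> has_bochner_integral D u I ->
  mu.-integrable D (EFin \o c) -> {ae mu, forall t, D t -> l (u t) = c t} ->
  l I = \int[mu]_(t in D) c t.
Proof.
move=> mD Dfin [s_ [ss _ s_int sI]] ic luc.
have [k k0 lk] := dual_functional_bound l.
have ils n : mu.-integrable D (EFin \o (fun t => l (s_ n t) : R)).
  apply: finitely_valued_integrable => //.
  exact: (finitely_valued_comp (fun x => l x : R) (ss n)).
have mc : measurable_fun D c by apply/measurable_EFinP; exact: (measurable_int mu ic).
have bound n : (`|l (simple_integral D (s_ n)) - \int[mu]_(t in D) c t|%:E <=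
    k%:E * \int[mu]_(t in D) `|u t - s_ n t|%:E)%E.
  rewrite simple_integral_functional// -RintegralB//.
  have ids : mu.-integrable D (EFin \o (fun t => l (s_ n t) - c t)).
    by apply: eq_integrable (integrableB _ (ils n) ic).
  have mds : measurable_fun D (fun t => l (s_ n t) - c t).
    by apply/measurable_EFinP; exact: (measurable_int mu ids).
  rewrite EFin_normr_Rintegral//; apply: le_trans (le_abse_integral _ _ _) _ => //.
    exact: (measurable_int mu ids).
  rewrite -lee_pdivrMl// -ge0_integralZl//; last 2 first.
    by apply/measurable_EFinP; exact: measurableT_comp.
    by rewrite lee_fin invr_ge0 ltW.
  apply: ae_nonneg_integral_mono_l => //.
  - apply/measurable_EFinP; apply: measurable_funM => //.
    exact: measurableT_comp.
  - by move=> t _; rewrite -EFinM lee_fin mulr_ge0// invr_ge0 ltW.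
  - apply: ae_mono luc => t luc Dt; rewrite -EFinM lee_fin ler_pdivrMl//.
    by rewrite -luc// distrC -linearB; exact: lk.
have lim1 : l (simple_integral D (s_ n)) @[n --> \oo] --> \int[mu]_(t in D) c t.
  apply/cvgrPdist_lt => e e0.
  have ek : (0 < (e / k)%:E)%E by rewrite lte_fin divr_gt0.
  have : \forall n \near \oo, (\int[mu]_(t in D) `|u t - s_ n t|%:E < (e / k)%:E)%E.
    exact: (s_int _ (open_ereal_lt' ek)).
  apply: filterS => n h; rewrite distrC -lte_fin; apply: le_lt_trans (bound n) _.
  by rewrite -lte_pdivlMl// -EFinM mulrC.
have lim2 : l (simple_integral D (s_ n)) @[n --> \oo] --> l I.
  by apply: (cvg_comp _ _ sI); exact: dual_is_continuous.
by apply: (cvg_unique _ lim2 lim1).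
Qed.

(** Approximants dominated by [2 * `|u|] converge in mean by dominated convergence for
    real functions. Their integrals are a Cauchy sequence: a functional norming the
    difference of two of them reduces it to a difference of real integrals. *)
Lemma bochner_integrable D u : norming X -> measurable D -> (mu D < +oo)%E ->
  strongly_measurable D u -> (\int[mu]_(t in D) `|u t|%:E < +oo)%E ->
  exists I, has_bochner_integral D u I.
Proof.
move=> nX mD Dfin smu iu.
have [s1_ [u' [ss1 su1 uu']]] := strongly_measurable_representative mD smu.
have [s_ [ss su sb]] := dominated_simple_approximation ss1 su1.
have mu' : measurable_fun D (fun t => `|u' t|) := norm_limit_measurable ss su.
have iu' : mu.-integrable D (EFin \o (fun t => `|u' t|)).
  apply/integrableP; split; first exact/measurable_EFinP.
  apply: le_lt_trans iu; apply: ae_nonneg_integral_mono_l => //.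
    by apply/measurable_EFinP; exact: measurableT_comp.
  by apply: ae_mono uu' => t + Dt => ->//; rewrite /= normr_id.
have mdiff n : measurable_fun D (fun t => `|u' t - s_ n t|).
  apply: (@norm_limit_measurable (fun m t => s_ m t - s_ n t)).
    move=> m; exact: (finitely_valued_comp (fun p : X * X => p.1 - p.2)
      (finitely_valued_pair (ss m) (ss n))).
  by move=> t; apply: cvgB => //; exact: cvg_cst.
have dct : (\int[mu]_(t in D) `|u' t - s_ n t|%:E)%E @[n --> \oo] --> 0%E.
  have := @dominated_convergence _ _ R mu D mD
    (fun n t => `|u' t - s_ n t|%:E) (cst 0%E) (fun t => (3 * `|u' t|)%:E).
  case => //.
  - by move=> n; apply/measurable_EFinP; exact: mdiff.
  - apply: aeW => t _ /=.
    apply: cvg_EFin; first exact: nearW.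
    rewrite [X in X @ _ --> _](_ : _ = fun n => `|u' t - s_ n t|)//.
    rewrite -[X in _ --> X](normr0 X) -(subrr (u' t)).
    by apply: cvg_norm; apply: cvgB => //; exact: cvg_cst.
  - by apply: eq_integrable (integrableZl _ 3 iu').
  - apply: aeW => t n _; rewrite /= lee_fin normr_id.
    apply: le_trans (ler_normB _ _) _; have := sb n t; lra.
  move=> _ + _; apply: cvg_trans; apply: near_eq_cvg; near=> n => /=.
  by apply: eq_integral => t _; rewrite subr0 normr_id.
have dint n m : (`|simple_integral D (s_ n) - simple_integral D (s_ m)|%:E <=
    \int[mu]_(t in D) `|u' t - s_ n t|%:E + \int[mu]_(t in D) `|u' t - s_ m t|%:E)%E.
  have [l <- lc] := nX (simple_integral D (s_ n) - simple_integral D (s_ m)).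
  have ils p : mu.-integrable D (EFin \o (fun t => l (s_ p t) : R)).
    apply: finitely_valued_integrable => //.
    exact: (finitely_valued_comp (fun x => l x : R) (ss p)).
  rewrite linearB /= !simple_integral_functional// -RintegralB//.
  have ids : mu.-integrable D (EFin \o (fun t => l (s_ n t) - l (s_ m t))).
    by apply: eq_integrable (integrableB _ (ils n) (ils m)).
  have mds : measurable_fun D (fun t => l (s_ n t) - l (s_ m t)).
    by apply/measurable_EFinP; exact: (measurable_int mu ids).
  apply: le_trans (_ : (`|\int[mu]_(t in D) (l (s_ n t) - l (s_ m t))|%:E <= _)%E).
    by rewrite lee_fin ler_norm.
  rewrite EFin_normr_Rintegral//; apply: le_trans (le_abse_integral _ _ _) _ => //.
    exact: (measurable_int mu ids).
  rewrite -ge0_integralD//; [|by apply/measurable_EFinP; exact: mdiff..].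
  apply: ge0_le_integral => //.
  - by apply/measurable_EFinP; exact: measurableT_comp.
  - by apply: emeasurable_funD; apply/measurable_EFinP; exact: mdiff.
  - move=> t Dt; rewrite -EFinD lee_fin -linearB; apply: le_trans (lc _) _.
    rewrite (_ : s_ n t - s_ m t = - (u' t - s_ n t) + (u' t - s_ m t)).
      by rewrite (le_trans (ler_normD _ _))// normrN.
    by rewrite opprB addrA subrK.
have cv : cvgn (fun n => simple_integral D (s_ n)).
  apply: cauchy_cvg; apply: cauchy_exP => e e0.
  have e2 : (0 < (e / 2)%:E)%E by rewrite lte_fin divr_gt0.
  have [N _ NP] : \forall n \near \oo, (\int[mu]_(t in D) `|u' t - s_ n t|%:E < (e / 2)%:E)%E.
    exact: (dct _ (open_ereal_lt' e2)).
  exists (simple_integral D (s_ N)), N => // p /= Np.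
  rewrite -ball_normE /= -lte_fin; apply: le_lt_trans (dint _ _) _.
  rewrite (splitr e) EFinD; apply: lteD; apply: NP => //=.
exists (lim ((fun n => simple_integral D (s_ n)) @ \oo)), s_; split => //.
- apply: ae_mono uu' => t + Dt => ->//; exact: su.
- apply: cvg_trans dct; apply: near_eq_cvg; near=> n.
  apply/eqP; rewrite eq_le; apply/andP; split.
    apply: ae_nonneg_integral_mono_l => //; first by apply/measurable_EFinP; exact: mdiff.
    by apply: ae_mono uu' => t + Dt => ->.
  apply: ae_nonneg_integral_mono_r => //; first by apply/measurable_EFinP; exact: mdiff.
  by apply: ae_mono uu' => t + Dt => ->.
Unshelve. all: by end_near. Qed.

End BochnerIntegral.

(** * Calculus on the line *)

Section ContinuousFunctions.
Context {R : realType}.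

Lemma continuous_comp_shift (f : R -> R) (x : R) :
  continuous f -> continuous (fun t => f (t - x)).
Proof.
move=> cf t; apply: (@continuous_comp _ _ _ (fun t => t - x) f); last exact: cf.
by apply: (@continuousB _ _ _ id (cst x)); [exact: id|exact: cst_continuous].
Qed.

Lemma continuous_mul (f g : R -> R) :
  continuous f -> continuous g -> continuous (fun t => f t * g t).
Proof. by move=> cf cg t; apply: continuousM; [exact: cf|exact: cg]. Qed.

Lemma continuous_sub (f g : R -> R) :
  continuous f -> continuous g -> continuous (fun t => f t - g t).
Proof. by move=> cf cg t; apply: continuousB; [exact: cf|exact: cg]. Qed.

Lemma continuous_abs (f : R -> R) : continuous f -> continuous (fun t => `|f t|).
Proof. by move=> cf t; apply: cvg_norm; exact: cf. Qed.

Lemma div_small (d e : R) : 0 < d -> 0 < e -> \forall n \near \oo, d / n.+2%:R < e.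
Proof.
move=> d0 e0; have /cvgrPdist_lt/(_ _ (divr_gt0 e0 d0)) := @cvg_harmonic R.
apply: filterS => n; rewrite /= /harmonic sub0r normrN ger0_norm// ltr_pdivlMr// => h.
rewrite mulrC; apply: le_lt_trans h; rewrite ler_wpM2r ?(ltW d0)//.
by rewrite lef_pV2 ?posrE// ler_nat.
Qed.

End ContinuousFunctions.

Section VectorDerivative.
Context {R : realType}.

Lemma is_deriveE {W : normedModType R} (f : R -> W) (a : R) (df : W) :
  is_derive a 1 f df <->
  (fun h : R => h^-1 *: (f (h + a) - f a)) @ 0^' --> df.
Proof.
have -> : (fun h : R => h^-1 *: (f (h + a) - f a)) =
    (fun h : R => h^-1 *: ((f \o shift a) (h *: (1 : R)) - f a)).
  by apply/funext => h; rewrite /= [h *: 1]mulr1.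
split=> [[dfa <-]|cf]; first exact: dfa.
by apply: DeriveDef; [apply/cvg_ex; exists df|exact: cvg_lim cf].
Qed.

Lemma is_derive_shift_arg {W : normedModType R} (f : R -> W) (a s : R) (df : W) :
  is_derive (a + s) 1 f df -> is_derive a 1 (fun t => f (t + s)) df.
Proof. by move=> /is_deriveE d; apply/is_deriveE; under eq_fun do rewrite -addrA. Qed.

Lemma is_derive_continuous_at {W : normedModType R} (f : R -> W) (a : R) (df : W) :
  is_derive a 1 f df -> {for a, continuous f}.
Proof. by move=> [d _]; apply: differentiable_continuous; apply/derivable1_diffP. Qed.

Lemma is_derive_cvg {W : normedModType R} (f : R -> W) (a : R) (df : W) :
  is_derive a 1 f df -> f (h + a) @[h --> 0^'] --> f a.
Proof.
move=> d; have ha : (h + a : R) @[h --> (0 : R)^'] --> (a : R).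
  rewrite -[X in _ --> X]add0r; apply: cvgD; last exact: cvg_cst.
  exact: cvg_within.
exact: (cvg_comp _ _ ha (is_derive_continuous_at d)).
Qed.

End VectorDerivative.

Section Clamp.
Context {R : realType}.
Variables (a b : R) (ab : a <= b).

(** The projection onto [[a, b]]: composed with it, a function continuous on the segment
    becomes continuous on the line. *)
Definition clamp (t : R) : R := Num.max a (Num.min t b).

Lemma clamp_in t : clamp t \in `[a, b].
Proof.
rewrite in_itv /= /clamp le_max lexx /= ge_max ab/=.
by rewrite ge_min lexx orbT.
Qed.

Lemma clamp_id t : t \in `[a, b] -> clamp t = t.
Proof.
by rewrite in_itv /= => /andP[at_ tb]; rewrite /clamp (min_idPl tb) (max_idPr at_).
Qed.

Lemma clamp_continuous : continuous clamp.
Proof.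
move=> t; apply: (@continuous_max _ _ (cst a) (fun t => Num.min t b)); first exact: cst_continuous.
by apply: (@continuous_min _ _ id (cst b)); [exact: id|exact: cst_continuous].
Qed.

Lemma continuous_clamp {X : topologicalType} (f : R -> X) :
  {within `[a, b], continuous f} -> continuous (f \o clamp).
Proof.
move=> /subspace_continuousP cf t.
move=> S NS.
have N : nbhs t [set t' | clamp t' \in `[a, b] -> S (f (clamp t'))].
  exact: (clamp_continuous (cf (clamp t) (clamp_in t) S NS)).
change (nbhs t [set t' | S (f (clamp t'))]).
by apply: filterS N => t' /=; apply; exact: clamp_in.
Qed.

End Clamp.

Section Integrals.
Context {R : realType}.
Local Notation mu := (@lebesgue_measure R).

Lemma continuous_integrable (f : R -> R) (a b : R) : continuous f ->
  mu.-integrable `[a, b] (EFin \o f).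
Proof.
move=> cf; apply: continuous_compact_integrable; first exact: segment_compact.
exact: continuous_subspaceT.
Qed.

Lemma Rintegral_itv_split (f : R -> R) (a b c : R) : a <= b -> b <= c ->
  mu.-integrable `[a, c] (EFin \o f) ->
  \int[mu]_(t in `[a, c]) f t =
  \int[mu]_(t in `[a, b]) f t + \int[mu]_(t in `[b, c]) f t.
Proof.
move=> ab bc fi.
have ac_bc : mu.-integrable `]b, c] (EFin \o f).
  apply: integrableS fi => //; apply: subset_itv; rewrite bnd_simp//.
have := @Rintegral_itvB _ f (BLeft a) (BRight c) b fi.
rewrite !bnd_simp => /(_ ab bc) h.
by rewrite -[X in _ = _ + X]Rintegral_itv_obnd_cbnd// -h addrC subrK.
Qed.

Lemma Rintegral_cst_itv (x y c : R) : x <= y ->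
  \int[mu]_(t in `[x, y]) (c : R) = (y - x) * c.
Proof.
move=> xy; rewrite Rintegral_cst//= lebesgue_measure_itv/= lte_fin mulrC.
by case: ltP => // yx; rewrite (@le_anti _ _ x y) ?xy// subrr.
Qed.

(** Cauchy-Schwarz, from [2 * a * N t - a ^+ 2 <= N t ^+ 2] with [a] the mean of [N]. *)
Lemma Rintegral_sq_le (N : R -> R) (x y : R) : x <= y ->
  mu.-integrable `[x, y] (EFin \o N) ->
  mu.-integrable `[x, y] (EFin \o (fun t => N t ^+ 2)) ->
  (\int[mu]_(t in `[x, y]) N t) ^+ 2 <= (y - x) * \int[mu]_(t in `[x, y]) (N t ^+ 2).
Proof.
rewrite le_eqVlt => /predU1P[<- _ _|xy i1 i2].
  by rewrite set_itv1 !Rintegral_set1 expr0n /= mulr0.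
set I := \int[mu]_(t in _) N t; have d0 : 0 < y - x by rewrite subr_gt0.
pose a := I / (y - x).
have ia : mu.-integrable `[x, y] (EFin \o (fun t => 2 * a * N t)).
  by apply: eq_integrable (integrableZl _ (2 * a) i1).
have ic : mu.-integrable `[x, y] (EFin \o (fun=> a ^+ 2)).
  by apply: continuous_integrable; exact: cst_continuous.
have : \int[mu]_(t in `[x, y]) (2 * a * N t - a ^+ 2) <= \int[mu]_(t in `[x, y]) (N t ^+ 2).
  apply: le_Rintegral => //.
    by apply: eq_integrable (integrableB _ ia ic).
  by move=> t _; have := sqr_ge0 (N t - a); nra.
rewrite RintegralB// RintegralZl// Rintegral_cst_itv ?(ltW xy)// -/I.
have -> : 2 * a * I - (y - x) * a ^+ 2 = I ^+ 2 / (y - x).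
  by rewrite /a; field; rewrite gt_eqF.
by rewrite ler_pdivrMr// mulrC.
Qed.

End Integrals.

(** * Smooth bump functions *)

Section SmoothFunctions.
Context {R : realType}.
Implicit Types (p q : {poly R}) (f g : R -> R).

(** The sequence of all derivatives is part of the data, so that one differentiation rule
    for a whole family of functions shows their smoothness. *)
Definition smooth f : Prop := exists2 F : nat -> R -> R, F 0%N = f &
  forall n (x : R), is_derive x 1 (F n) (F n.+1 x).

Lemma smooth_derive1n f : smooth f ->
  forall n x, derivable (derive1n n f) x 1.
Proof.
move=> [F F0 dF] n.
have dFn k : derive1 (F k) = F k.+1.
  by apply/funext => x; rewrite derive1E; apply: derive_val.
have -> : derive1n n f = F n.
  by elim: n => [|n IH]; rewrite ?derive1n0 ?F0// derive1nS IH dFn.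
by move=> x; have := dF n x => -[].
Qed.

Lemma smooth_antiderivative f g : smooth g -> (forall x : R, is_derive x 1 f (g x)) ->
  smooth f.
Proof.
move=> [F F0 dF] df; exists (fun n => if n is m.+1 then F m else f) => // -[|n] x //=.
by rewrite F0.
Qed.

Lemma smooth_shift f c : smooth f -> smooth (fun x => f (x - c)).
Proof.
move=> [F F0 dF]; exists (fun n x => F n (x - c)); first by rewrite F0.
move=> n x; have -> : (fun x => F n (x - c)) = F n \o shift (- c) by [].
by rewrite -[F n.+1 _]mulr1; apply: is_derive1_comp; exact: is_derive_shift.
Qed.

Lemma smoothB f g : smooth f -> smooth g -> smooth (fun x => f x - g x).
Proof.
move=> [F <- dF] [G <- dG]; exists (fun n x => F n x - G n x) => // n x.
exact: is_deriveB.
Qed.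

Lemma smoothZ k f : smooth f -> smooth (fun x => k * f x).
Proof.
move=> [F <- dF]; exists (fun n x => k * F n x) => // n x.
exact: is_deriveZ.
Qed.

Lemma poly_le_expR p : exists2 C, 0 <= C & forall y, 0 <= y -> `|p.[y]| <= C * expR y.
Proof.
have X (i : nat) (y : R) : 0 <= y -> y ^+ i <= i`!%:R * expR y.
  move=> y0; case: i => [|i].
    by rewrite expr0 fact0 mul1r; apply: le_trans (expR_ge1Dx y); rewrite lerDl.
  rewrite mulrC -ler_pdivrMr ?ltr0n ?fact_gt0//.
  by apply: le_trans (expR_ge1Dxn i y0); rewrite lerDr.
exists (\sum_(i < size p) `|p`_i| * i`!%:R) => [|y y0].
  by apply: sumr_ge0 => i _; rewrite mulr_ge0.
rewrite horner_coef; apply: le_trans (ler_norm_sum _ _ _) _.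
rewrite mulr_suml; apply: ler_sum => i _.
rewrite normrM [`|y ^+ _|]ger0_norm ?exprn_ge0// -mulrA ler_wpM2l//.
exact: X.
Qed.

(** The family of the functions [p(1/x) * exp(-1/x)], extended by zero, contains its
    own derivatives: this is how flat functions are seen to be smooth. *)
Definition flat_exp p x : R := if 0 < x then p.[x^-1] * expR (- x^-1) else 0.

Definition flat_exp_deriv p : {poly R} := 'X^2 * (p - p^`()).

Lemma flat_exp_small p : exists2 C, 0 <= C & forall x, `|flat_exp p x| <= C * `|x|.
Proof.
have [C C0 CP] := poly_le_expR ('X * p); exists C => // x; rewrite /flat_exp.
case: ifPn => x0; last by rewrite normr0 mulr_ge0.
rewrite normrM [`|expR _|]ger0_norm ?expR_ge0// expRN ler_pdivrMr ?expR_gt0//.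
have := CP x^-1; rewrite invr_ge0 (ltW x0) hornerM hornerX normrM normfV => /(_ isT).
by rewrite ler_pdivrMl ?normr_gt0 ?gt_eqF// mulrA [`|x| * _]mulrC.
Qed.

(** At the origin the difference quotient of [flat_exp p] is [flat_exp ('X * p)], which
    tends to zero there by [flat_exp_small]. *)
Lemma is_derive_flat_exp p (x : R) :
  is_derive x 1 (flat_exp p) (flat_exp (flat_exp_deriv p) x).
Proof.
have [x0|x0|->] := ltrgtP x 0.
- rewrite {2}/flat_exp ltNge (ltW x0)/=.
  apply: (@near_eq_is_derive R R R (cst 0)).
  near=> y; rewrite /flat_exp ltNge ltW//.
  by near: y; exact: lt_nbhsl.
- apply: (@near_eq_is_derive R R R (fun y => p.[y^-1] * expR (- y^-1))).
    near=> y; rewrite /flat_exp ifT//; near: y; exact: lt_nbhsr.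
  have dV : is_derive x 1 (fun y : R => y^-1) (- x ^- 2).
    apply: is_derive_eq; first by apply: (is_deriveV (f := id)); rewrite ?gt_eqF.
    by rewrite /GRing.scale/= mulr1.
  have dp : is_derive x 1 (fun y : R => p.[y^-1]) (p^`().[x^-1] * - x ^- 2).
    by apply: (is_derive1_comp (f := horner p)).
  have de : is_derive x 1 (fun y : R => expR (- y^-1)) (expR (- x^-1) * (x ^- 2)).
    apply: (is_derive1_comp (f := expR) (g := fun y => - y^-1)).
    by rewrite -[x ^- 2]opprK; exact: is_deriveN.
  apply: (is_derive_eq (is_deriveM dp de)).
  rewrite /flat_exp x0 /flat_exp_deriv !hornerE /GRing.scale/=.
  by rewrite -exprVn; ring.
- apply/is_derive1_caratheodory; exists (flat_exp ('X * p)); split.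
  + move=> z; rewrite subr0 /flat_exp ltxx subr0; case: ifPn => z0; last by rewrite mul0r.
    by rewrite hornerM hornerX; field; rewrite gt_eqF.
  + have [C C0 CP] := flat_exp_small ('X * p).
    apply/cvgrPdist_lt => e e0; rewrite /flat_exp ltxx.
    have C1 : 0 < C + 1 by rewrite ltr_wpDl.
    exists (e / (C + 1)); first by rewrite /= divr_gt0.
    move=> z /=; rewrite !sub0r !normrN ltr_pdivlMr// => ze.
    apply: le_lt_trans (CP z) _; apply: le_lt_trans ze.
    by rewrite mulrC ler_wpM2l// lerDl.
  + by rewrite /flat_exp ltxx.
Unshelve. all: by end_near. Qed.

(** Sums of products [p(1/x) exp(-1/x) q(1/(h-x)) exp(-1/(h-x))]: a family of functions
    supported in [[0, h]] that contains its own derivatives. *)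
Fixpoint flat_sum (h : R) (s : seq ({poly R} * {poly R})) (x : R) : R :=
  if s is r :: s' then flat_exp r.1 x * flat_exp r.2 (h - x) + flat_sum h s' x else 0.

Definition flat_sum_deriv (s : seq ({poly R} * {poly R})) :=
  flatten [seq [:: (flat_exp_deriv r.1, r.2); (- r.1, flat_exp_deriv r.2)] | r <- s].

Lemma is_derive_flat_sum h s (x : R) :
  is_derive x 1 (flat_sum h s) (flat_sum h (flat_sum_deriv s) x).
Proof.
elim: s => [|[p q] s IH]; first exact: is_derive_cst.
have d1 := is_derive_flat_exp p x.
have d2 : is_derive x 1 (fun y => flat_exp q (h - y))
    (flat_exp (flat_exp_deriv q) (h - x) * -1).
  apply: (is_derive1_comp (f := flat_exp q) (g := fun y => h - y)).
    exact: is_derive_flat_exp.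
  apply: (is_derive_eq (is_deriveB (is_derive_cst h x 1) (is_derive_id x 1))).
  by rewrite sub0r.
apply: (is_derive_eq (is_deriveD (is_deriveM d1 d2) IH)).
rewrite /= /flat_sum_deriv /= -/(flat_sum_deriv s) /GRing.scale/=.
have -> : flat_exp (- p) x = - flat_exp p x.
  by rewrite /flat_exp hornerN mulNr; case: ifP => _; rewrite ?oppr0.
by ring.
Qed.

Definition flat_bump (h : R) : R -> R := flat_sum h [:: (1%:P, 1%:P)].

Lemma flat_bump_smooth h : smooth (flat_bump h).
Proof.
exists (fun n => flat_sum h (iter n flat_sum_deriv [:: (1%:P, 1%:P)])) => // n x.
exact: is_derive_flat_sum.
Qed.

Lemma flat_bumpE h x : flat_bump h x =
  if (0 < x) && (x < h) then expR (- x^-1) * expR (- (h - x)^-1) else 0.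
Proof.
rewrite /flat_bump /= addr0 /flat_exp !hornerC !mul1r subr_gt0.
by case: ifP => //= _; [case: ifP; rewrite ?mulr0|rewrite mul0r].
Qed.

Lemma flat_bump_ge0 h x : 0 <= flat_bump h x.
Proof. by rewrite flat_bumpE; case: ifP => // _; rewrite mulr_ge0// expR_ge0. Qed.

Lemma smooth_continuous f : smooth f -> continuous f.
Proof.
move=> [F <- dF] x; apply: differentiable_continuous; apply/derivable1_diffP.
by have := dF 0%N x => -[].
Qed.

End SmoothFunctions.

(** * Mollified steps *)

Section Step.
Context {R : realType}.
Local Notation mu := (@lebesgue_measure R).
Variables (h : R) (h0 : 0 < h).

(* The lower limit lies below the support of the bump, so that the integral is
   differentiable at every point of that support. *)
Let P (s : R) : R := \int[mu]_(t in `[-1, s]) flat_bump h t.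

Let bi (x y : R) : mu.-integrable `[x, y] (EFin \o flat_bump h).
Proof. by apply: continuous_integrable; exact: smooth_continuous (flat_bump_smooth h). Qed.

Let P_left s : s <= 0 -> P s = 0.
Proof.
move=> s0; rewrite /P (@eq_Rintegral _ _ _ _ _ (cst 0)).
  by rewrite Rintegral_cst// mul0r.
move=> t; rewrite inE /= in_itv /= => /andP[_ ts].
by rewrite flat_bumpE ltNge (le_trans ts s0).
Qed.

Let P_split s s' : 0 <= s -> s <= s' -> P s' = P s + \int[mu]_(t in `[s, s']) flat_bump h t.
Proof. by move=> s0 ss'; apply: Rintegral_itv_split => //; rewrite (le_trans _ s0)// lerN10. Qed.

Let P_mono s s' : 0 <= s -> s <= s' -> P s <= P s'.
Proof.
move=> s0 ss'; rewrite (P_split s0 ss') lerDl.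
by apply: Rintegral_ge0 => t _; exact: flat_bump_ge0.
Qed.

Let P_right s : h <= s -> P s = P h.
Proof.
move=> hs; rewrite (P_split (ltW h0) hs) (@eq_Rintegral _ _ _ _ _ (cst 0)).
  by rewrite Rintegral_cst// mul0r addr0.
move=> t; rewrite inE /= in_itv /= => /andP[ht _].
by rewrite flat_bumpE [t < h]ltNge ht andbF.
Qed.

Let P_derive (s : R) : is_derive s 1 P (flat_bump h s).
Proof.
have [s1|s1] := ltP (-1) s; last first.
  have s0 : s < 0 by rewrite (le_lt_trans s1)// ltrN10.
  rewrite flat_bumpE ltNge (ltW s0) /=; apply: (@near_eq_is_derive R R R (cst 0)).
  by near=> y; rewrite P_left// ltW//; near: y; exact: lt_nbhsl.
have s1' : s < s + 1 by rewrite ltrDl.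
have [dP P'] := continuous_FTC1_closed s1' (bi _ _) s1
  (smooth_continuous (flat_bump_smooth h) (x := s)).
by rewrite -P' derive1E; apply: derivableP.
Unshelve. all: by end_near. Qed.

(* If the mass vanished, [P] would vanish on [[0, h]], and so would its derivative, which
   is the bump. *)
Let P_gt0 : 0 < P h.
Proof.
have P0 : 0 <= P h by apply: Rintegral_ge0 => t _; exact: flat_bump_ge0.
rewrite lt_neqAle P0 andbT; apply/eqP => Ph.
have hh0 : 0 < h / 2 by rewrite divr_gt0.
have hh1 : h / 2 < h by rewrite ltr_pdivrMr// ltr_pMr// ltr1n.
have : is_derive (h / 2) 1 P 0.
  apply: (@near_eq_is_derive R R R (cst 0)); near=> y.
  have y0 : 0 <= y by rewrite ltW//; near: y; exact: lt_nbhsr.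
  have yh : y <= h by rewrite ltW//; near: y; exact: lt_nbhsl.
  apply/eqP; rewrite eq_le {2}Ph P_mono// andbT -[cst 0 y]/0.
  by apply: Rintegral_ge0 => t _; exact: flat_bump_ge0.
have d := P_derive (h / 2); move=> d'.
have : flat_bump h (h / 2) = 0.
  rewrite -(@derive_val _ _ _ _ _ _ _ d); exact: (@derive_val _ _ _ _ _ _ _ d').
rewrite flat_bumpE hh0 hh1 /= => /eqP; rewrite mulf_eq0.
by rewrite !gt_eqF ?expR_gt0.
Unshelve. all: by end_near. Qed.

(** A smooth probability density on [[0, h]] and its distribution function. *)
Definition mollifier (t : R) : R := flat_bump h t / P h.
Definition step (s : R) : R := P s / P h.

Lemma mollifier_ge0 t : 0 <= mollifier t.
Proof. by rewrite /mollifier divr_ge0 ?flat_bump_ge0// ltW. Qed.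

Lemma mollifier_out t : (t <= 0) || (h <= t) -> mollifier t = 0.
Proof.
rewrite /mollifier flat_bumpE; case: ifP => [/andP[t0 th]|_ _]; last by rewrite mul0r.
by rewrite leNgt t0 leNgt th.
Qed.

Lemma step_left s : s <= 0 -> step s = 0.
Proof. by move=> s0; rewrite /step P_left// mul0r. Qed.

Lemma step_right s : h <= s -> step s = 1.
Proof. by move=> hs; rewrite /step P_right// divff// gt_eqF. Qed.

Lemma step_itv s : 0 <= step s <= 1.
Proof.
have [s0|/ltW s0] := leP s 0; first by rewrite step_left// lexx ler01.
have [hs|/ltW hs] := leP h s; first by rewrite step_right// lexx ler01.
rewrite /step ler_pdivrMr// mul1r P_mono// andbT divr_ge0// ?(ltW P_gt0)//.
by apply: Rintegral_ge0 => t _; exact: flat_bump_ge0.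
Qed.

Lemma is_derive_step (s : R) : is_derive s 1 step (mollifier s).
Proof.
have -> : step = (P h)^-1 \*: P by apply/funext => t; rewrite /step mulrC.
by rewrite /mollifier mulrC; apply: is_deriveZ.
Qed.

Lemma mollifier_smooth : smooth mollifier.
Proof.
have -> : mollifier = fun t => (P h)^-1 * flat_bump h t by apply/funext => t; rewrite mulrC.
by apply: smoothZ; exact: flat_bump_smooth.
Qed.

Lemma step_smooth : smooth step.
Proof. exact: smooth_antiderivative mollifier_smooth is_derive_step. Qed.

End Step.

(** * From weak derivatives to increments *)

Section DuBoisReymond.
Context {R : realType}.
Local Notation mu := (@lebesgue_measure R).

Lemma mollifier_shift_continuous (h x : R) : continuous (fun t => mollifier h (t - x)).
Proof.
by apply: continuous_comp_shift; apply: smooth_continuous; exact: mollifier_smooth.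
Qed.

Lemma Rintegral_mollifier (a b x h : R) : 0 < h -> a <= x -> x + h <= b ->
  \int[mu]_(t in `[a, b]) mollifier h (t - x) = 1.
Proof.
move=> h0 ax xb; have ab : a < b by apply: le_lt_trans ax (lt_le_trans _ xb); rewrite ltrDl.
have dS (t : R) := is_derive_shift_arg (is_derive_step h (t - x)).
have cS : continuous (fun t => step h (t - x)).
  by apply: continuous_comp_shift; apply: smooth_continuous; exact: step_smooth.
rewrite /Rintegral (continuous_FTC2 (F := fun t => step h (t - x)))//=.
- by rewrite step_right ?step_left ?subr0// ?subr_le0// lerBrDl.
- by apply: continuous_subspaceT; exact: mollifier_shift_continuous.
- split.
  + by move=> t _; have [] := dS t.
  + by apply: cvg_at_right_filter; exact: cS.
  + by apply: cvg_at_left_filter; exact: cS.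
- by move=> t _; rewrite derive1E; apply: derive_val.
Qed.

(** The average of [m] for a probability density concentrated on [[x, x + h]]. *)
Lemma mollifier_limit (a b x e : R) (m : R -> R) : continuous m ->
  a <= x -> x < b -> 0 < e ->
  exists2 h0, 0 < h0 & forall h, 0 < h -> h <= h0 ->
    `|\int[mu]_(t in `[a, b]) (mollifier h (t - x) * m t) - m x| <= e.
Proof.
move=> cm ax xb e0.
have /cvgrPdist_lt/(_ _ e0)[d /= d0 dP] := cm x.
have bx0 : 0 < b - x by rewrite subr_gt0.
exists (Num.min (d / 2) (b - x)); first by rewrite lt_min bx0 divr_gt0.
move=> h h0; rewrite le_min => /andP[hd hb].
have xhb : x + h <= b by rewrite addrC -lerBrDr.
have ci := @mollifier_shift_continuous h x.
have -> : m x = \int[mu]_(t in `[a, b]) (mollifier h (t - x) * m x).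
  rewrite RintegralZr//; last exact: continuous_integrable.
  by rewrite Rintegral_mollifier// mul1r.
rewrite -RintegralB//; last 2 first.
- by apply: continuous_integrable; exact: continuous_mul.
- by apply: continuous_integrable; apply: continuous_mul => //; exact: cst_continuous.
apply: le_trans (le_normr_Rintegral _ _) _ => //.
  apply: continuous_integrable; apply: continuous_sub; apply: continuous_mul => //.
  exact: cst_continuous.
have -> : e = \int[mu]_(t in `[a, b]) (mollifier h (t - x) * e).
  rewrite RintegralZr//; last exact: continuous_integrable.
  by rewrite Rintegral_mollifier// mul1r.
apply: le_Rintegral => //.
- apply: continuous_integrable; apply: continuous_abs.
  apply: continuous_sub; apply: continuous_mul => //.
  exact: cst_continuous.
- by apply: continuous_integrable; apply: continuous_mul => //; exact: cst_continuous.
move=> t _; rewrite -mulrBr normrM ger0_norm ?mollifier_ge0//.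
have [t0|t0] := leP (t - x) 0; first by rewrite mollifier_out ?t0// !mul0r.
have [th|th] := leP h (t - x); first by rewrite mollifier_out ?th ?orbT// !mul0r.
rewrite ler_wpM2l ?mollifier_ge0// ltW// distrC; apply: dP.
rewrite /= distrC gtr0_norm//; apply: lt_le_trans th _; apply: le_trans hd _.
by rewrite ler_pdivrMr// ler_peMr ?ltW// ltr1n.
Qed.

Lemma step_difference_test (a b x y h : R) : 0 < h -> a < x -> x <= y -> y + h < b ->
  test_function a b (fun t => step h (t - x) - step h (t - y)).
Proof.
move=> h0 ax xy yb; split.
  apply: smooth_derive1n; apply: smoothB; apply: smooth_shift; exact: step_smooth.
exists x, (y + h); split => // t.
have [tx|tx] := leP t x.
  by rewrite !step_left ?subrr ?eqxx// subr_le0// (le_trans tx).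
have [ty|ty] := leP t (y + h); first by rewrite (ltW tx).
have hy : h <= t - y by rewrite lerBrDl ltW.
by rewrite !step_right ?subrr ?eqxx// (le_trans hy)// lerB.
Qed.

(** Test functions approximating the indicator of [`]x, y]] turn the weak derivative
    into an increment: their derivatives are mollifiers at [x] and at [y]. *)
Lemma weak_derivative_increment_interior (a b x y : R) (m c : R -> R) :
    continuous m -> mu.-integrable `[a, b] (EFin \o c) ->
    (forall phi, test_function a b phi ->
      \int[mu]_(t in `[a, b]) (derive1 phi t * m t) =
      - \int[mu]_(t in `[a, b]) (phi t * c t)) ->
    a < x -> x <= y -> y < b ->
  m y - m x = \int[mu]_(t in `[x, y]) c t.
Proof.
move=> cm ic wd ax xy yb.
pose h_ n : R := (b - y) / n.+2%:R.
have by0 : 0 < b - y by rewrite subr_gt0.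
have h_gt0 n : 0 < h_ n by rewrite divr_gt0.
have h_lt n : y + h_ n < b.
  by rewrite -ltrBrDl /h_ ltr_pdivrMr// ltr_pMr// ltr1n.
have h_small e : 0 < e -> \forall n \near \oo, h_ n <= e.
  by move=> e0; apply: filterS (div_small by0 e0) => n /ltW.
pose phi n t := step (h_ n) (t - x) - step (h_ n) (t - y).
have dphi n t : derive1 (phi n) t = mollifier (h_ n) (t - x) - mollifier (h_ n) (t - y).
  rewrite derive1E; apply: derive_val; apply: is_deriveB;
  by apply: is_derive_shift_arg; exact: is_derive_step.
have ab : a < b by rewrite (lt_le_trans ax)// (le_trans xy)// ltW.
have key n : \int[mu]_(t in `[a, b]) (phi n t * c t) =
    \int[mu]_(t in `[a, b]) (mollifier (h_ n) (t - y) * m t) -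
    \int[mu]_(t in `[a, b]) (mollifier (h_ n) (t - x) * m t).
  rewrite -[LHS]opprK -wd; last exact: step_difference_test.
  rewrite -RintegralB//; last 2 first.
  - by apply/continuous_integrable/continuous_mul => //; exact: mollifier_shift_continuous.
  - by apply/continuous_integrable/continuous_mul => //; exact: mollifier_shift_continuous.
  rewrite -[LHS]mulN1r -RintegralZl//; last first.
    under [X in _.-integrable _ X]eq_fun do rewrite /= dphi.
    apply/continuous_integrable/continuous_mul => //.
    by apply: continuous_sub; exact: mollifier_shift_continuous.
  by apply: eq_Rintegral => t _; rewrite dphi; ring.
have lim1 : \int[mu]_(t in `[a, b]) (phi n t * c t) @[n --> \oo] --> m y - m x.
  apply/cvgrPdist_le => e e0; have e2 : 0 < e / 2 by rewrite divr_gt0.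
  have [h1 h10 h1P] := mollifier_limit cm (ltW ax) (le_lt_trans xy yb) e2.
  have [h2 h20 h2P] := mollifier_limit cm (le_trans (ltW ax) xy) yb e2.
  have h3 : 0 < Num.min h1 h2 by rewrite lt_min h10.
  apply: filterS (h_small _ h3) => n; rewrite le_min => /andP[l1 l2].
  rewrite key; have := h2P _ (h_gt0 n) l2; have := h1P _ (h_gt0 n) l1.
  move: (\int[mu]_(t in _) _) (\int[mu]_(t in _) _) => I1 I2.
  by rewrite !ler_norml; lra.
have lim2 : \int[mu]_(t in `[a, b]) (phi n t * c t) @[n --> \oo] -->
    \int[mu]_(t in `[x, y]) c t.
  have sub : `]x, y] `<=` `[a, b].
    by apply: subset_itv; rewrite bnd_simp// ltW.
  have mc : measurable_fun `[a, b] c by apply/measurable_EFinP; exact: (measurable_int mu ic).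
  have isub : mu.-integrable `[a, b] (EFin \o (c \_ `]x, y])).
    rewrite -restrict_EFin; apply/(integrable_restrict mu) => //.
    by apply: integrableS ic => //; exact: measurableI.
  have mphi n : measurable_fun `[a, b] (phi n).
    apply: measurable_funS (measurableT) _ _ => //; apply: continuous_measurable_fun.
    by apply: continuous_sub; apply: continuous_comp_shift; apply: smooth_continuous;
      exact: step_smooth.
  have -> : \int[mu]_(t in `[x, y]) c t = \int[mu]_(t in `[a, b]) (c \_ `]x, y]) t.
    rewrite -Rintegral_mkcondr (_ : _ `&` _ = `]x, y]%classic); last first.
      by apply/seteqP; split => [t []|t xyt]//; split => //; exact: sub.
    by rewrite Rintegral_itv_obnd_cbnd//; exact: integrableS ic.
  have [|||||_ _] := @dominated_convergence _ _ R mu `[a, b] (measurable_itv _)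
    (fun n t => (phi n t * c t)%:E) (EFin \o (c \_ `]x, y])) (fun t => `|(c t)%:E|%E).
  - by move=> n; apply/measurable_EFinP; exact: (measurable_funM (mphi n) mc).
  - exact: (measurable_int mu isub).
  - apply: aeW => t _; apply: cvg_EFin; first exact: nearW.
    apply: cvg_near_cst => /=; rewrite patchE.
    have [tx|xt] := leP t x.
      rewrite memNset; last by rewrite /= in_itv/= ltNge tx.
      apply: nearW => n; rewrite /phi !step_left ?subrr ?mul0r// subr_le0//.
      exact: le_trans xy.
    have [ty|yt] := leP t y.
      rewrite mem_set; last by rewrite /= in_itv/= xt.
      have /h_small : 0 < t - x by rewrite subr_gt0.
      apply: filterS => n hn; rewrite /phi step_right//.
      by rewrite step_left ?subr0 ?mul1r// subr_le0.
    rewrite memNset; last by rewrite /= in_itv/= [t <= y]leNgt yt andbF.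
    have /h_small : 0 < t - y by rewrite subr_gt0.
    apply: filterS => n hn; rewrite /phi !step_right ?subrr ?mul0r//.
    by rewrite (le_trans hn)// lerB.
  - exact: integrable_abse.
  - apply: aeW => t n _ /=; rewrite lee_fin normrM ler_piMl//.
    have := step_itv (h_gt0 n) (t - x); have := step_itv (h_gt0 n) (t - y).
    by rewrite /phi ler_norml => /andP[? ?] /andP[? ?]; lra.
  rewrite (_ : (\int[mu]_(t in `[a, b]) (EFin \o (c \_ `]x, y])) t)%E =
    (\int[mu]_(t in `[a, b]) (c \_ `]x, y]) t)%:E); last first.
    by rewrite /Rintegral fineK//; exact: integrable_fin_num.
  by move=> /fine_cvg.
exact: (cvg_unique _ lim1 lim2).
Qed.

End DuBoisReymond.

Import HBSimple.

Section WeakDerivative.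
Context {R : realType}.
Local Notation mu := (@lebesgue_measure R).

(** The end points are approached along segments towards the midpoint. *)
Lemma continuous_constant_closure (D : R -> R) (a b v : R) : a < b -> continuous D ->
  (forall t, a < t -> t < b -> D t = v) -> forall x, a <= x -> x <= b -> D x = v.
Proof.
move=> ab cD Dv x ax xb; apply/eqP; rewrite -subr_eq0 -normr_le0 leNgt; apply/negP => e0.
have /cvgrPdist_lt/(_ _ e0)[d /= d0 dP] := cD x.
pose z := (a + b) / 2; pose s := Num.min (d / (2 * (b - a))) 1.
have ba0 : 0 < b - a by rewrite subr_gt0.
have s0 : 0 < s by rewrite lt_min ltr01 divr_gt0// mulr_gt0.
have s1 : s <= 1 by rewrite ge_min lexx orbT.
have sd : s * (b - a) <= d / 2.
  have h : s <= d / (2 * (b - a)) by rewrite ge_min lexx.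
  by rewrite -ler_pdivlMr// -mulrA -invfM.
have az : a < z by rewrite /z; lra.
have zb : z < b by rewrite /z; lra.
have /dP : ball_ [eta Num.norm] x d (x + s * (z - x)).
  rewrite /= opprD addNKr normrN normrM gtr0_norm//.
  apply: (@le_lt_trans _ _ (s * (b - a))); last by lra.
  by rewrite ler_wpM2l ?(ltW s0)// ler_norml; apply/andP; split; lra.
have h1 : 0 < s * (z - a) by rewrite mulr_gt0// subr_gt0.
have h2 : 0 < s * (b - z) by rewrite mulr_gt0// subr_gt0.
have h3 : 0 <= (1 - s) * (x - a) by rewrite mulr_ge0// subr_ge0.
have h4 : 0 <= (1 - s) * (b - x) by rewrite mulr_ge0// subr_ge0.
rewrite (Dv (x + s * (z - x))) ?ltxx//.
  rewrite -subr_gt0 (_ : _ - a = s * (z - a) + (1 - s) * (x - a)); last by ring.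
  by rewrite ltr_pwDl.
rewrite -subr_gt0 (_ : b - _ = s * (b - z) + (1 - s) * (b - x)); last by ring.
by rewrite ltr_pwDl.
Qed.

(** The difference of [m] and a primitive of [c] is constant in the interior by
    [weak_derivative_increment_interior], hence up to the end points. *)
Lemma weak_derivative_increment (a b : R) (m c : R -> R) : a < b ->
    continuous m -> mu.-integrable `[a, b] (EFin \o c) ->
    (forall phi, test_function a b phi ->
      \int[mu]_(t in `[a, b]) (derive1 phi t * m t) =
      - \int[mu]_(t in `[a, b]) (phi t * c t)) ->
  forall x y, a <= x -> x <= y -> y <= b -> m y - m x = \int[mu]_(t in `[x, y]) c t.
Proof.
move=> ab cm ic wd x y ax xy yb.
pose C t := \int[mu]_(s in `[a, t]) c s.
have ics p q : a <= p -> q <= b -> mu.-integrable `[p, q] (EFin \o c).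
  by move=> ap qb; apply: integrableS ic => //; apply: subset_itv; rewrite bnd_simp.
have CE p q : a <= p -> p <= q -> q <= b -> C q = C p + \int[mu]_(t in `[p, q]) c t.
  by move=> ap pq qb; apply: Rintegral_itv_split => //; exact: ics.
have cC : continuous (C \o clamp a b).
  have := parameterized_integral_continuous (ltW ab) ic.
  exact: (@continuous_clamp _ _ _ (ltW ab)).
pose D t := m t - C (clamp a b t).
have cD : continuous D by apply: continuous_sub.
have DE t : a <= t -> t <= b -> D t = m t - C t.
  by move=> at_ tb; rewrite /D clamp_id// in_itv/= at_.
pose z := (a + b) / 2.
have az : a < z by rewrite /z; lra.
have zb : z < b by rewrite /z; lra.
have Dcst t : a < t -> t < b -> D t = D z.
  move=> at_ tb; rewrite !DE ?(ltW at_) ?(ltW tb) ?(ltW az) ?(ltW zb)//.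
  have [tz|zt] := leP t z.
    have := weak_derivative_increment_interior cm ic wd at_ tz zb.
    by rewrite (CE t z) ?(ltW at_) ?(ltW zb)// => <-; ring.
  have := weak_derivative_increment_interior cm ic wd az (ltW zt) tb.
  by rewrite (CE z t) ?(ltW az) ?(ltW tb) ?(ltW zt)// => <-; ring.
have Dz := continuous_constant_closure ab cD Dcst.
have xb := le_trans xy yb; have ay := le_trans ax xy.
have ex : m x - C x = D z by rewrite -(DE x)//; exact: Dz.
have ey : m y - C y = D z by rewrite -(DE y)//; exact: Dz.
have := CE x y ax xy yb; move: (\int[mu]_(t in _) _) => I ec; lra.
Qed.

(** On a bounded interval [psi] is bounded and [`|u|] is dominated by the integrable
    function [1 + `|u| ^+ 2]. *)
Lemma bochner_L2_scale_integrable {X : completeNormedModType R} (a b : R)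
    (psi : R -> R) (u : R -> X) : norming X -> a <= b -> continuous psi ->
  bochner_L2 `[a, b] u -> exists I, has_bochner_integral `[a, b] (fun t => psi t *: u t) I.
Proof.
move=> nX ab cpsi [smu u2].
have Dfin : (mu `[a, b] < +oo)%E by rewrite lebesgue_measure_itv/=; case: ifP; rewrite ?ltry.
have mD : measurable `[a, b]%classic by exact: measurable_itv.
have [s_ [u' [ss su uu']]] := strongly_measurable_representative mD smu.
apply: bochner_integrable => //.
  have mpsi : measurable_fun setT (EFin \o psi).
    by apply/measurable_EFinP; exact: continuous_measurable_fun.
  have [p_ pP] := approximation_sfun measurableT mpsi.
  exists (fun n t => p_ n t *: s_ n t); split.
    move=> n; have fp : finitely_valued (p_ n).
      by split; [exact: fimfunP|move=> x; exact: measurable_sfunP].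
    exact: (finitely_valued_comp (fun q : R * X => q.1 *: q.2)
      (finitely_valued_pair fp (ss n))).
  apply: (ae_mono _ uu') => t + Dt => ->//; apply: cvgZ; last exact: su.
  exact: (fine_cvg (pP t Logic.I)).
have [c _ cP] : exists2 c, c \in `[a, b] & forall t, t \in `[a, b] -> `|psi t| <= `|psi c|.
  by apply: EVT_max => //; apply: continuous_subspaceT; exact: continuous_abs.
pose M := `|psi c|; have M0 : 0 <= M by exact: normr_ge0.
have mu' : measurable_fun `[a, b] (fun t => `|u' t|) := norm_limit_measurable ss su.
have mu2 : measurable_fun `[a, b] (fun t => `|u' t| ^+ 2) by exact: measurable_funX.
have i2 : (\int[mu]_(t in `[a, b]) (`|u' t| ^+ 2)%:E < +oo)%E.
  apply: le_lt_trans u2; apply: ae_nonneg_integral_mono_l => //.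
  - exact/measurable_EFinP.
  - by apply: (ae_mono _ uu') => t + Dt => ->//.
have mg : measurable_fun `[a, b] (fun t => M%:E * (1 + (`|u' t| ^+ 2)%:E)%E)%E.
  apply: measurable_funeM; apply: emeasurable_funD => //.
  exact/measurable_EFinP.
apply: (@le_lt_trans _ _ (\int[mu]_(t in `[a, b]) (M%:E * (1 + (`|u' t| ^+ 2)%:E)))%E).
  apply: ae_nonneg_integral_mono_r => //.
    by move=> t _; rewrite -EFinD -EFinM lee_fin mulr_ge0 ?addr_ge0 ?exprn_ge0.
  apply: (ae_mono _ uu') => t + Dt => ->//.
  rewrite -EFinD -EFinM lee_fin normrZ ler_pM// ?cP//.
  by have := sqr_ge0 (`|u' t| - 1); have := normr_ge0 (u' t); nra.
rewrite ge0_integralZl//; last 2 first.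
- by apply: emeasurable_funD => //; exact/measurable_EFinP.
- by move=> t _; rewrite adde_ge0// lee_fin exprn_ge0.
rewrite lte_mul_pinfty// ge0_integralD//; last exact/measurable_EFinP.
by rewrite lte_add_pinfty// integral_cst// mul1e.
Qed.

Lemma test_function_derivable (a b : R) (phi : R -> R) : test_function a b phi ->
  continuous phi /\ continuous (derive1 phi).
Proof.
move=> [dphi _]; split => x; apply: differentiable_continuous; apply/derivable1_diffP.
  exact: dphi 0%N x.
exact: dphi 1%N x.
Qed.

(** The functional [l], applied to both Bochner integrals in the definition of the weak
    derivative, reduces it to the scalar case. *)
Lemma weak_derivative_functional {X : completeNormedModType R} (a b : R)
    (u v : R -> X) (l : dual X) (c : R -> R) : norming X -> a < b ->
    bochner_L2 `[a, b] u -> bochner_L2 `[a, b] v -> weak_derivative a b u v ->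
    {within `[a, b], continuous u} -> mu.-integrable `[a, b] (EFin \o c) ->
    {ae mu, forall t, `[a, b]%classic t -> l (v t) = c t} ->
  forall x y, a <= x -> x <= y -> y <= b ->
    l (u y) - l (u x) = \int[mu]_(t in `[x, y]) c t.
Proof.
move=> nX ab u2 v2 uv cu ic lc x y ax xy yb.
have Dfin : (mu `[a, b] < +oo)%E by rewrite lebesgue_measure_itv/= lte_fin ab ltry.
pose m t : R := l (u (clamp a b t)).
have cm : continuous m.
  move=> t; have cuc := continuous_clamp (ltW ab) cu.
  exact: (continuous_comp (cuc t) (@dual_is_continuous _ _ l _)).
have mE t : t \in `[a, b] -> m t = l (u t) by move=> tab; rewrite /m clamp_id.
rewrite -!mE ?in_itv/= ?ax ?yb ?(le_trans ax xy) ?(le_trans xy yb)//.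
apply: (weak_derivative_increment ab cm ic) => // phi tphi.
have [cphi cphi'] := test_function_derivable tphi.
have [I1 I1P] := bochner_L2_scale_integrable nX (ltW ab) cphi' u2.
have [I2 I2P] := bochner_L2_scale_integrable nX (ltW ab) cphi v2.
have := uv phi tphi; rewrite /bochner_integral.
have := xgetPex 0 (ex_intro _ I1 I1P); set J1 := xget _ _ => J1P.
have := xgetPex 0 (ex_intro _ I2 I2P); set J2 := xget _ _ => J2P J12.
have <- : l J1 = \int[mu]_(t in `[a, b]) (derive1 phi t * m t).
  apply: (has_bochner_integral_functional _ Dfin J1P) => //.
    by apply/continuous_integrable/continuous_mul.
  by apply: aeW => t tab; rewrite linearZ mE.
have <- : l J2 = \int[mu]_(t in `[a, b]) (phi t * c t).
  apply: (has_bochner_integral_functional _ Dfin J2P) => //.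
    have [q _ qP] : exists2 q, q \in `[a, b] & forall t, t \in `[a, b] -> `|phi t| <= `|phi q|.
      by apply: EVT_max (ltW ab) _; apply: continuous_subspaceT; exact: continuous_abs.
    apply: (@integrableMr _ _ _ mu _ _ phi (EFin \o c)) => //.
      by apply: measurable_funS (measurableT) _ _ => //; exact: continuous_measurable_fun.
    exists `|phi q|; split; first exact: num_real.
    by move=> M qM t tab; apply: le_trans (qP _ tab) (ltW qM).
  by apply: ae_mono lc => t h tab; rewrite linearZ /= h.
by rewrite J12 linearN.
Qed.

Lemma sq_integrable_integrable (D : set R) (N : R -> R) : measurable D ->
    (mu D < +oo)%E -> measurable_fun D N ->
    (\int[mu]_(t in D) (N t ^+ 2)%:E < +oo)%E ->
  mu.-integrable D (EFin \o N) /\ mu.-integrable D (EFin \o (fun t => N t ^+ 2)).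
Proof.
move=> mD Dfin mN N2.
have i2 : mu.-integrable D (EFin \o (fun t => N t ^+ 2)).
  apply/integrableP; split; first by apply/measurable_EFinP; exact: measurable_funX.
  apply: le_lt_trans N2; apply: nonneg_integral_mono => // t _ /=.
  by rewrite lee_fin ger0_norm// sqr_ge0.
split=> //.
have i1 : mu.-integrable D (EFin \o (fun t => N t ^+ 2 + 1)).
  have i3 := finitely_valued_integrable mD Dfin (finitely_valued_cst (1 : R)).
  by apply: eq_integrable (integrableD _ i2 i3).
apply: le_integrable i1 => //; first exact/measurable_EFinP.
move=> t _ /=; rewrite lee_fin [X in _ <= X]ger0_norm ?addr_ge0 ?sqr_ge0//.
by rewrite -real_normK ?num_real//; have := sqr_ge0 (`|N t| - 1); nra.
Qed.

End WeakDerivative.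

Section LinearImage.
Context {R : realType} {X : completeNormedModType R} {H : hilbertType R}.
Local Notation mu := (@lebesgue_measure R).
Variables (M : X -> H) (k : R).
Hypotheses (linM : linear M) (Mk : forall x, `|M x| <= k * `|x|).

Lemma linear_image_functional (h : H) : exists l : dual X, forall x, l x = inner h (M x).
Proof.
have d : (fun x => inner h (M x) : R^o) \in dual_pred.
  apply: (@bounded_dual_pred _ _ _ (`|h| * k)).
    by move=> a x y; rewrite linM innerDr innerZr.
  by move=> x; apply: le_trans (cauchy_schwarz _ _) _; rewrite -mulrA ler_wpM2l.
by exists (Dual d).
Qed.

Lemma linear_image_cvg (x_ : nat -> X) x :
  x_ n @[n --> \oo] --> x -> M (x_ n) @[n --> \oo] --> M x.
Proof.
move=> xx; have k0 : 0 < `|k| + 1 by rewrite ltr_wpDl.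
apply/cvgrPdist_lt => e e0; move/cvgrPdist_lt: xx => /(_ _ (divr_gt0 e0 k0)).
apply: filterS => n; rewrite ltr_pdivlMr// => h.
have -> : M x - M (x_ n) = M (x - x_ n).
  by rewrite addrC -scaleN1r -linM scaleN1r addrC.
apply: le_lt_trans (Mk _) _; apply: le_lt_trans h; rewrite mulrC ler_wpM2l//.
by rewrite (le_trans (ler_norm _))// lerDl.
Qed.

(** Borel functions that stand for the norm and for the components of [M (v t)], which are
    only almost everywhere equal to Borel functions. *)
Lemma bochner_L2_linear_image (a b : R) (v : R -> X) : bochner_L2 `[a, b] v ->
  exists N : R -> R,
    [/\ measurable_fun setT N, forall t, 0 <= N t,
        {ae mu, forall t, `[a, b]%classic t -> N t = `|M (v t)|},
        (\int[mu]_(t in `[a, b]) (N t ^+ 2)%:E < +oo)%E &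
        forall h, exists c : R -> R, [/\ measurable_fun setT c,
          {ae mu, forall t, `[a, b]%classic t -> inner h (M (v t)) = c t} &
          forall t, `|c t| <= `|h| * N t]].
Proof.
move=> [smv v2].
have mD : measurable `[a, b]%classic by exact: measurable_itv.
have [s_ [v' [ss sv vv']]] := strongly_measurable_representative mD smv.
have ssM n : simple_fun (fun t => M (s_ n t)) := finitely_valued_comp M (ss n).
have svM t : M (s_ n t) @[n --> \oo] --> M (v' t) by exact: linear_image_cvg.
have mN : measurable_fun setT (fun t => `|M (v' t)|) := norm_limit_measurable ssM svM.
exists (fun t => `|M (v' t)|); split => //.
- by apply: ae_mono vv' => t + Dt => ->.
- apply: (@le_lt_trans _ _ ((k ^+ 2)%:E * \int[mu]_(t in `[a, b]) (`|v' t| ^+ 2)%:E)%E).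
    have mv' : measurable_fun `[a, b] (fun t => (`|v' t| ^+ 2)%:E).
      apply/measurable_EFinP/measurable_funX; exact: norm_limit_measurable ss sv.
    rewrite -ge0_integralZl//; last by rewrite lee_fin sqr_ge0.
    apply: nonneg_integral_mono => // t _; rewrite -EFinM lee_fin -exprMn.
    by rewrite ler_pXn2r// nnegrE// (le_trans _ (Mk _)).
  rewrite lte_mul_pinfty ?lee_fin ?sqr_ge0//; apply: le_lt_trans v2.
  apply: ae_nonneg_integral_mono_l => //.
    apply/measurable_EFinP/measurable_funX; exact: norm_limit_measurable ss sv.
  by apply: ae_mono vv' => t + Dt => ->.
- move=> h; exists (fun t => inner h (M (v' t))); split.
  + apply: (@measurable_fun_cvg _ _ _ _ (fun n t => inner h (M (s_ n t)))).
      move=> n; apply: finitely_valued_measurable.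
      exact: (finitely_valued_comp (fun y => inner h y) (ssM n)).
    move=> t _; apply: (continuous_cvg _ _ (svM t)).
    exact: (@dual_is_continuous _ _ (inner_functional h)).
  + by apply: ae_mono vv' => t + Dt => ->.
  + by move=> t; exact: cauchy_schwarz.
Qed.

(** The increment is tested with itself: the component of [M (v t)] along it is at most
    [N t] times its norm. *)
Lemma linear_image_increment (a b : R) (u v : R -> X) : norming X -> a < b ->
    bochner_L2 `[a, b] u -> bochner_L2 `[a, b] v -> weak_derivative a b u v ->
    {within `[a, b], continuous u} ->
  exists N : R -> R,
    [/\ measurable_fun setT N, forall t, 0 <= N t,
        {ae mu, forall t, `[a, b]%classic t -> N t = `|M (v t)|},
        (\int[mu]_(t in `[a, b]) (N t ^+ 2)%:E < +oo)%E &
        forall x y, a <= x -> x <= y -> y <= b ->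
          `|M (u y) - M (u x)| <= \int[mu]_(t in `[x, y]) N t].
Proof.
move=> nX ab u2 v2 uv cu.
have [N [mN N0 Nv N2 cP]] := bochner_L2_linear_image v2.
exists N; split => // x y ax xy yb.
have Dfin : (mu `[a, b] < +oo)%E by rewrite lebesgue_measure_itv/= lte_fin ab ltry.
have mND D : measurable_fun D N by exact: measurable_funTS.
have [iN _] := sq_integrable_integrable (measurable_itv _) Dfin (mND _) N2.
set h := M (u y) - M (u x).
have [->|h0] := eqVneq h 0; first by rewrite normr0 Rintegral_ge0.
have [c [mc lc cN]] := cP h.
have [l lP] := linear_image_functional h.
have ic : mu.-integrable `[a, b] (EFin \o c).
  apply: le_integrable (integrableZl _ `|h| iN) => //.
    by apply/measurable_EFinP; exact: measurable_funTS.
  by move=> t _ /=; rewrite lee_fin [X in _ <= X]ger0_norm ?mulr_ge0.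
have lc' : {ae mu, forall t, `[a, b]%classic t -> l (v t) = c t}.
  by apply: ae_mono lc => t; rewrite lP.
have := weak_derivative_functional nX ab u2 v2 uv cu ic lc' ax xy yb.
rewrite !lP -innerBr -/h inner_norm => e.
rewrite -(@ler_pM2l _ `|h|) ?normr_gt0// -expr2 e.
have sub : `[x, y] `<=` `[a, b] by apply: subset_itv; rewrite bnd_simp.
have iS (f : R -> R) : mu.-integrable `[a, b] (EFin \o f) ->
    mu.-integrable `[x, y] (EFin \o f).
  by move=> fi; apply: integrableS fi => //; exact: measurable_itv.
rewrite -RintegralZl//; last exact: iS.
apply: le_Rintegral => //; [exact: iS| |].
  by apply: eq_integrable (integrableZl _ `|h| (iS _ iN)).
by move=> t _; apply: le_trans (ler_norm _) (cN t).
Qed.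

End LinearImage.

(** * Quadratic forms along curves and weak primitives *)

Section BilinearForm.
Context {R : realType} {V : normedModType R}.
Variables (b : V -> V -> R) (k : R).
Hypotheses (bl : forall a x y z, b (a *: x + y) z = a * b x z + b y z)
  (bs : forall x y, b x y = b y x) (bk : forall x y, `|b x y| <= k * (`|x| * `|y|)).

Let bB x y z : b (x - y) z = b x z - b y z.
Proof. by rewrite addrC -scaleN1r bl mulN1r addrC. Qed.

Let bD x y z : b (x + y) z = b x z + b y z.
Proof. by rewrite -{1}[x]scale1r bl mul1r. Qed.

Let bZ c x z : b (c *: x) z = c * b x z.
Proof.
have b0 : b 0 z = 0 by apply: (@addIr _ (b 0 z)); rewrite -bD !add0r.
by rewrite -[c *: x]addr0 bl b0 addr0.
Qed.

Lemma bilinear_cvg {T : Type} {F : set_system T} {FF : Filter F} (u w : T -> V) u0 w0 :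
  u @ F --> u0 -> w @ F --> w0 -> b (u t) (w t) @[t --> F] --> b u0 w0.
Proof.
move=> cu cw; pose d t := k * (`|u t - u0| * `|w t|) + k * (`|w t - w0| * `|u0|).
have cd : d t @[t --> F] --> (0 : R).
  have z (v : T -> V) v0 : v @ F --> v0 -> `|v t - v0| @[t --> F] --> (0 : R).
    move=> cv; rewrite -[X in _ --> X](normr0 V) -(subrr v0).
    by apply: cvg_norm; apply: cvgB => //; exact: cvg_cst.
  have ck : k @[_ --> F] --> k by exact: cvg_cst.
  have c0 : `|u0| @[_ --> F] --> `|u0| by exact: cvg_cst.
  have := cvgD (cvgM ck (cvgM (z _ _ cu) (cvg_norm cw))) (cvgM ck (cvgM (z _ _ cw) c0)).
  rewrite !mul0r !mulr0 addr0 => H; exact: H.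
apply/cvgrPdist_lt => e e0; move/cvgrPdist_lt: cd => /(_ _ e0).
apply: filterS => t; rewrite sub0r normrN => h; rewrite distrC; apply: le_lt_trans h.
have -> : b (u t) (w t) - b u0 w0 = b (u t - u0) (w t) + b (w t - w0) u0.
  by rewrite !bB (bs (w t)) (bs w0); ring.
apply: le_trans (ler_normD _ _) _; apply: le_trans (lerD (bk _ _) (bk _ _)) _.
exact: ler_norm.
Qed.

Lemma is_derive_quadratic (x : R -> V) (a : R) (dx : V) : is_derive a 1 x dx ->
  is_derive a 1 (fun t => b (x t) (x t)) (2 * b (x a) dx).
Proof.
move=> d; have cx := is_derive_cvg d; move/is_deriveE: d => d; apply/is_deriveE.
have h1 : x (h + a) + x a @[h --> 0^'] --> x a + x a.
  by apply: cvgD => //; exact: cvg_cst.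
have E h : h^-1 *: (b (x (h + a)) (x (h + a)) - b (x a) (x a)) =
    b (x (h + a) + x a) (h^-1 *: (x (h + a) - x a)).
  rewrite bs bZ bB !(bs _ (_ + _)) !bD (bs (x a) (x (h + a))) /GRing.scale/=; ring.
have -> : 2 * b (x a) dx = b (x a + x a) dx by rewrite bD; ring.
by under eq_fun do rewrite E; exact: bilinear_cvg.
Qed.

End BilinearForm.

Section Gronwall.
Context {R : realType}.

(** [expR (- c * t) * (M + f t)] is nonincreasing. *)
Lemma gronwall (f : R -> R) (df : R -> R) (a b c M : R) : a <= b ->
  (forall t, a <= t -> t <= b -> is_derive t 1 f (df t)) ->
  (forall t, a <= t -> t <= b -> df t <= c * (M + f t)) ->
  M + f b <= expR (c * (b - a)) * (M + f a).
Proof.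
move=> ab fd dfle.
pose G t := expR (- c * t) * (M + f t).
have dG t : a <= t -> t <= b ->
    is_derive t 1 G (expR (- c * t) * (df t - c * (M + f t))).
  move=> at_ tb.
  have d1 : is_derive t 1 (fun t => expR (- c * t)) (expR (- c * t) * - c).
    apply: (is_derive1_comp (f := expR) (g := fun t => - c * t)).
    by rewrite -[X in is_derive _ _ _ X]mulr1; apply: (is_deriveZ (- c) (is_derive_id t 1)).
  have d2 : is_derive t 1 (fun t => M + f t) (0 + df t).
    by apply: is_deriveD; exact: fd.
  apply: (is_derive_eq (is_deriveM d1 d2)); rewrite /GRing.scale/=; ring.
have Gab : G b <= G a.
  apply: (@ler0_derive1_nincr _ G a b) => //.
  - by move=> t; rewrite in_itv /= => /andP[at_ tb]; have [] := dG t (ltW at_) (ltW tb).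
  - move=> t; rewrite in_itv /= => /andP[at_ tb].
    have d := dG t (ltW at_) (ltW tb); rewrite derive1E (@derive_val _ _ _ _ _ _ _ d).
    by rewrite mulr_ge0_le0 ?expR_ge0// subr_le0 dfle ?ltW.
  - apply: derivable_within_continuous => t; rewrite in_itv /= => /andP[at_ tb].
    by have [] := dG t at_ tb.
have -> : M + f b = expR (c * b) * G b.
  by rewrite /G mulrA -expRD mulNr subrr expR0 mul1r.
have -> : expR (c * (b - a)) * (M + f a) = expR (c * b) * G a.
  by rewrite /G mulrA -expRD mulNr mulrBr.
by rewrite ler_wpM2l ?expR_ge0.
Qed.

End Gronwall.

Section WeakPrimitive.
Context {R : realType} {V : hilbertType R}.
Local Notation mu := (@lebesgue_measure R).
Variables (E : R -> V) (a : R).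
Hypothesis cE : continuous E.

Lemma inner_continuous (v : V) : continuous (fun t => inner v (E t)).
Proof.
move=> t.
exact: (continuous_comp (@cE t) (@dual_is_continuous _ _ (inner_functional v) _)).
Qed.

(** A vector-valued integral, determined by its inner products: Riesz provides it from
    real integrals alone. *)
Definition weak_primitive (P : R -> V) : Prop := forall x y, a <= x -> x <= y ->
  forall v, inner v (P y - P x) = \int[mu]_(t in `[x, y]) inner v (E t).

Lemma weak_primitive_exists : exists P, weak_primitive P.
Proof.
have iE v x y : mu.-integrable `[x, y] (EFin \o (fun t => inner v (E t))).
  by apply: continuous_integrable; exact: inner_continuous.
have cnE : continuous (fun t => `|E t|) by move=> t; apply: cvg_norm; exact: cE.
have /choice[P PP] : forall t, exists p : V, forall v,
    inner p v = \int[mu]_(s in `[a, t]) inner v (E s).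
  move=> t.
  have d : (fun v => \int[mu]_(s in `[a, t]) inner v (E s) : R^o) \in dual_pred.
    apply: (@bounded_dual_pred _ _ _ (\int[mu]_(s in `[a, t]) `|E s|)).
      move=> c v w.
      transitivity (\int[mu]_(s in `[a, t]) (c * inner v (E s) + inner w (E s))).
        by apply: eq_Rintegral => s _; rewrite inner_linear.
      rewrite RintegralD ?RintegralZl//.
      by apply: continuous_integrable => s; apply: cvgM; [exact: cvg_cst|exact: inner_continuous].
    move=> v; apply: le_trans (le_normr_Rintegral _ _) _ => //.
    rewrite -RintegralZr//; last exact: continuous_integrable.
    apply: le_Rintegral => //.
    - by apply: continuous_integrable; apply: continuous_abs; exact: inner_continuous.
    - by apply: continuous_integrable; apply: continuous_mul => //; exact: cst_continuous.
    - by move=> s _; rewrite mulrC cauchy_schwarz.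
  by have [p pP] := riesz (Dual d); exists p => v; rewrite pP.
exists P => x y ax xy v; rewrite inner_sym innerBl !PP.
by rewrite (Rintegral_itv_split ax xy)// addrAC subrr add0r.
Qed.

Variable P : R -> V.
Hypothesis PP : weak_primitive P.

Lemma weak_primitive_functional (l : dual V) x y : a <= x -> x <= y ->
  l (P y - P x) = \int[mu]_(t in `[x, y]) l (E t).
Proof.
move=> ax xy; have [v vl] := riesz l.
by rewrite -vl PP//; apply: eq_Rintegral => t _; rewrite vl.
Qed.

(** The vector to be estimated serves as the test vector. *)
Lemma weak_primitive_bound x y (w : V) e : a <= x -> x <= y ->
  (forall t, x <= t -> t <= y -> `|E t - w| <= e) ->
  `|P y - P x - (y - x) *: w| <= (y - x) * e.
Proof.
move=> ax xy Ew; set h := _ - _ *: w.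
have [->|h0] := eqVneq h 0.
  by rewrite normr0 mulr_ge0 ?subr_ge0// (le_trans _ (Ew x _ _)).
rewrite -(@ler_pM2l _ `|h|) ?normr_gt0// -expr2 -inner_norm.
have -> : inner h h = \int[mu]_(t in `[x, y]) inner h (E t - w).
  transitivity (\int[mu]_(t in `[x, y]) (inner h (E t) - inner h w)).
    rewrite RintegralB//; last 2 first.
    - by apply: continuous_integrable; exact: inner_continuous.
    - by apply: continuous_integrable; exact: cst_continuous.
    by rewrite -PP// Rintegral_cst_itv// -innerZr -innerBr.
  by apply: eq_Rintegral => t _; rewrite innerBr.
have -> : `|h| * ((y - x) * e) = \int[mu]_(t in `[x, y]) (`|h| * e).
  by rewrite Rintegral_cst_itv//; ring.
have ci : continuous (fun t => inner h (E t - w)).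
  have -> : (fun t => inner h (E t - w)) = (fun t => inner h (E t) - inner h w).
    by apply/funext => t; rewrite innerBr.
  by apply: continuous_sub; [exact: inner_continuous|exact: cst_continuous].
apply: le_Rintegral => //.
- exact: continuous_integrable.
- by apply: continuous_integrable; exact: cst_continuous.
move=> t; rewrite /= in_itv /= => /andP[xt ty].
by apply: le_trans (inner_le _ _) _; rewrite ler_wpM2l// Ew.
Qed.

Lemma weak_primitive_derive (t : R) : a < t -> is_derive t 1 P (E t).
Proof.
move=> at_; apply/is_deriveE; apply/cvgrPdist_le => e e0.
have /cvgrPdist_lt/(_ _ e0)[d /= d0 dP] := @cE t.
have at0 : 0 < Num.min d (t - a) by rewrite lt_min d0 subr_gt0.
exists (Num.min d (t - a)) => // h; rewrite /ball_ /= sub0r normrN lt_min => /andP[hd ha] hn0.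
rewrite -(@ler_pM2l _ `|h|) ?normr_gt0// -normrZ scalerBr scalerA divff// scale1r.
have [h0|h0] := leP 0 h.
  have := @weak_primitive_bound t (h + t) (E t) e (ltW at_).
  rewrite lerDr h0 addrK -normrN opprB ger0_norm// => /(_ isT); apply => s ts st.
  rewrite distrC ltW//; apply: dP; rewrite /= distrC ger0_norm ?subr_ge0//.
  by apply: le_lt_trans hd; rewrite ger0_norm// lerBlDr.
have h0' := ltW h0.
have := @weak_primitive_bound (h + t) t (E t) e.
rewrite ltr0_norm// in hd ha *.
have -> : t - (h + t) = - h by ring.
have -> : P t - P (h + t) - - h *: E t = h *: E t - (P (h + t) - P t).
  by rewrite scaleNr opprK opprB addrC.
apply; [lra|lra|].
move=> s hs st; rewrite distrC ltW//; apply: dP; rewrite /= ger0_norm ?subr_ge0//.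
by apply: le_lt_trans hd; lra.
Qed.

End WeakPrimitive.

(** * The energy estimate *)

Section Energy.
Context {R : realType} {V H : hilbertType R}.
Local Notation mu := (@lebesgue_measure R).
Variables (j : clinear V H) (A A1 : clinear V (dual V)) (A2 : clinear V H).
Variables (muA c1 c2 cj : R).
Hypotheses (A1_sym : self_adjoint A1) (AE : forall v, A v = A1 v + pivot j (A2 v)).
Hypotheses (muA0 : 0 < muA) (c20 : 0 <= c2) (cj0 : 0 <= cj).
Hypotheses (A1_le : forall v, `|A1 v| <= c1 * `|v|).
Hypotheses (A2_le : forall v, `|A2 v| <= c2 * `|v|) (j_le : forall v, `|j v| <= cj * `|v|).

Let kap : R := c2 ^+ 2 / (2 * muA).

(** [A1] alone need not be coercive on the kernel of [B]; the multiple of the [H]-norm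
    compensates for the part of [A] that [A2] contributes. *)
Definition energy_form (v w : V) : R := A1 v w + kap * inner (j v) (j w).

Definition energy (v : V) : R := energy_form v v.

Definition energy_rate : R := 1 + 2 * (c2 + kap * cj) ^+ 2 / muA.

Let kap0 : 0 <= kap.
Proof. by rewrite divr_ge0 ?sqr_ge0// mulr_ge0// ltW. Qed.

Lemma energy_rate_ge0 : 0 <= energy_rate.
Proof.
by rewrite addr_ge0// divr_ge0 ?(ltW muA0)// mulr_ge0// sqr_ge0.
Qed.

Lemma energy_form_linear a x y z :
  energy_form (a *: x + y) z = a * energy_form x z + energy_form y z.
Proof.
rewrite /energy_form dual_operatorD dual_operatorZ linearP /= inner_linear; ring.
Qed.

Lemma energy_form_sym x y : energy_form x y = energy_form y x.
Proof. by rewrite /energy_form A1_sym inner_sym. Qed.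

Lemma energy_form_bounded x y :
  `|energy_form x y| <= (c1 + kap * cj ^+ 2) * (`|x| * `|y|).
Proof.
rewrite /energy_form mulrDl; apply: le_trans (ler_normD _ _) _; apply: lerD.
  apply: le_trans (dual_norm_ub _ _) _; rewrite mulrA ler_wpM2r//; exact: A1_le.
rewrite normrM ger0_norm// -mulrA ler_wpM2l//; apply: le_trans (cauchy_schwarz _ _) _.
by rewrite expr2 mulrACA ler_pM.
Qed.

Let AvE v w : A v w = A1 v w + inner (A2 v) (j w).
Proof. by rewrite AE. Qed.

Let A2j v : `|inner (A2 v) (j v)| <= c2 * `|v| * `|j v|.
Proof. by apply: le_trans (cauchy_schwarz _ _) _; rewrite ler_wpM2r. Qed.

(** Young's inequality for [c2 * `|v| * `|j v|]; [kap] is the constant for which half of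
    the ellipticity of [A] is left. *)
Lemma energy_coercive v : muA * `|v| ^+ 2 <= A v v -> muA / 2 * `|v| ^+ 2 <= energy v.
Proof.
rewrite AvE /energy /energy_form inner_norm => h.
have : inner (A2 v) (j v) <= c2 * `|v| * `|j v| := le_trans (ler_norm _) (A2j v).
move: h; rewrite /kap.
move: `|v| `|j v| (A1 v v : R) (inner _ _) => x y p q h1 h2.
suff : c2 * x * y <= muA / 2 * x ^+ 2 + c2 ^+ 2 / (2 * muA) * y ^+ 2 by lra.
rewrite -(@ler_pM2l _ (2 * muA)) ?mulr_gt0//.
have -> : 2 * muA * (muA / 2 * x ^+ 2 + c2 ^+ 2 / (2 * muA) * y ^+ 2) =
    muA ^+ 2 * x ^+ 2 + c2 ^+ 2 * y ^+ 2.
  by field; rewrite gt_eqF.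
by have := sqr_ge0 (muA * x - c2 * y); nra.
Qed.

(** Testing the equation with the velocity [d] itself: the dissipation [- |j d|^2]
    absorbs every other term that contains [j d]. *)
Lemma energy_rate_bound (x d : V) (r : H) (m : R) : `|r| <= m ->
    inner (j d) (j d) = - A x d + inner r (j d) ->
    muA / 2 * `|x| ^+ 2 <= energy x ->
  2 * energy_form x d <= energy_rate * (m ^+ 2 + energy x).
Proof.
move=> rm; rewrite AvE => e coerc.
(* Up to the dissipation, the equation expresses [energy_form x d] by [j d] alone. *)
pose sg := r - A2 x + kap *: j x.
have -> : 2 * energy_form x d = 2 * inner sg (j d) - 2 * inner (j d) (j d).
  by rewrite /energy_form /sg innerDl innerBl innerZl e; ring.
have h1 : inner sg (j d) <= `|sg| * `|j d| := inner_le _ _.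
have h2 : `|sg| <= m + (c2 + kap * cj) * `|x|.
  rewrite /sg mulrDl addrA; apply: le_trans (ler_normD _ _) _; apply: lerD.
    by apply: le_trans (ler_normB _ _) _; apply: lerD.
  by rewrite normrZ ger0_norm// -mulrA ler_wpM2l.
have m0 : 0 <= m := le_trans (normr_ge0 _) rm.
have x2 : `|x| ^+ 2 <= 2 / muA * energy x.
  by rewrite mulrAC ler_pdivlMr// mulrC; lra.
have E0 : 0 <= energy x.
  by apply: le_trans coerc; rewrite mulr_ge0 ?divr_ge0 ?sqr_ge0 ?(ltW muA0).
rewrite inner_norm.
apply: (@le_trans _ _ (`|sg| ^+ 2 / 2)).
  by have := sqr_ge0 (`|sg| - 2 * `|j d|); nra.
set q := c2 + kap * cj in h2 *.
have q0 : 0 <= q by rewrite addr_ge0// mulr_ge0.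
have sg2 : `|sg| ^+ 2 / 2 <= m ^+ 2 + q ^+ 2 * `|x| ^+ 2.
  have : `|sg| ^+ 2 <= (m + q * `|x|) ^+ 2.
    by rewrite ler_pXn2r// nnegrE// addr_ge0// mulr_ge0.
  by have := sqr_ge0 (m - q * `|x|); nra.
apply: le_trans sg2 _.
have h3 : q ^+ 2 * `|x| ^+ 2 <= 2 * q ^+ 2 / muA * energy x.
  have -> : 2 * q ^+ 2 / muA * energy x = q ^+ 2 * (2 / muA * energy x) by ring.
  by rewrite ler_wpM2l ?sqr_ge0.
rewrite /energy_rate -/q; set w := 2 * q ^+ 2 / muA in h3 *.
have w0 : 0 <= w by rewrite divr_ge0 ?(ltW muA0)// mulr_ge0// sqr_ge0.
by have := sqr_ge0 m; nra.
Qed.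

Context {Q : hilbertType R} (B : clinear V (dual Q)).
Hypothesis hAB : elliptic_on A (ker B) muA.

(** The weak form of the evolution equation, tested with the kernel of [B] and
    integrated in time, so that no derivative of [E] occurs. *)
Definition weak_solution (a b : R) (E : R -> V) (rho : R -> H) : Prop :=
  forall k, B k = 0 -> forall x y, a <= x -> x <= y -> y <= b ->
    inner (j (E y) - j (E x)) (j k) =
    \int[mu]_(t in `[x, y]) (- A (E t) k + inner (rho t) (j k)).

(** The Steklov averages [X s t] of [E] over [[t, t + s]] are differentiable with
    values in [V], so their velocity is an admissible test function; the estimate for
    them passes to the limit [s -> 0]. *)
Lemma energy_estimate (a b : R) (E : R -> V) (rho : R -> H) (m : R) : a < b ->
    continuous E -> continuous rho ->
    (forall t, a <= t -> t <= b -> B (E t) = 0) ->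
    (forall t, a <= t -> t <= b -> `|rho t| <= m) ->
    weak_solution a b E rho ->
  m ^+ 2 + energy (E b) <= expR (energy_rate * (b - a)) * (m ^+ 2 + energy (E a)).
Proof.
move=> ab cE cr BE rm sol.
(* The primitives start at [a - 1], which makes them differentiable at [a] too. *)
have [P PP] := weak_primitive_exists (a - 1) cE.
have [S SP] := weak_primitive_exists (a - 1) cr.
have a1 : a - 1 < a by rewrite ltrBlDr ltrDl.
pose X s t := s^-1 *: (P (t + s) - P t).
pose D s t := s^-1 *: (E (t + s) - E t).
have step_estimate s : 0 < s -> s < b - a ->
    m ^+ 2 + energy (X s (b - s)) <=
    expR (energy_rate * (b - a)) * (m ^+ 2 + energy (X s a)).
  move=> s0 sba.
  have abs : a <= b - s by lra.
  have BX t : a <= t -> t <= b - s -> B (X s t) = 0.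
    move=> at_ tb; apply: val_inj; apply/funext => q.
    rewrite /X /= dual_operatorZ.
    rewrite (_ : B (P (t + s) - P t) q = \int[mu]_(z in `[t, t + s]) B (E z) q); last first.
      by apply: (weak_primitive_functional PP (adjoint B q)); lra.
    rewrite (@eq_Rintegral _ _ _ _ _ (cst 0)); first by rewrite Rintegral_cst// mul0r mulr0.
    by move=> z; rewrite inE /= in_itv/= => /andP[tz zt]; rewrite BE//; lra.
  have BD t : a <= t -> t <= b - s -> B (D s t) = 0.
    by move=> at_ tb; rewrite /D linearZ linearB /= !BE ?subrr ?scaler0//; lra.
  have XD t : a <= t -> t <= b - s -> is_derive t 1 (X s) (D s t).
    move=> at_ tb; apply: is_deriveZ; apply: is_deriveB.
      by apply: is_derive_shift_arg; apply: (weak_primitive_derive cE PP); lra.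
    by apply: (weak_primitive_derive cE PP); lra.
  have coerc t : a <= t -> t <= b - s -> muA / 2 * `|X s t| ^+ 2 <= energy (X s t).
    by move=> at_ tb; apply: energy_coercive; apply: hAB; exact: BX.
  have key := @gronwall _ (fun t => energy (X s t))
    (fun t => 2 * energy_form (X s t) (D s t)) a (b - s) energy_rate (m ^+ 2) abs.
  apply: le_trans (key _ _) _.
  - move=> t at_ tb.
    apply: (is_derive_quadratic energy_form_linear energy_form_sym energy_form_bounded).
    exact: XD.
  - move=> t at_ tb; pose r := s^-1 *: (S (t + s) - S t).
    apply: (@energy_rate_bound _ _ r); [| |exact: coerc].
      have := weak_primitive_bound cr SP (x := t) (y := t + s) (w := 0) (e := m).
      rewrite scaler0 subr0 addrAC subrr add0r => h.
      rewrite /r normrZ normfV gtr0_norm// ler_pdivrMl//; apply: h; [lra|lra|].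
      by move=> z tz zt; rewrite subr0 rm//; lra.
    set k := D s t; have Bk : B k = 0 by exact: BD.
    have e1 := weak_primitive_functional PP (adjoint A k) (x := t) (y := t + s).
    have e2 := SP t (t + s) _ _ (j k).
    have jk : j k = s^-1 *: (j (E (t + s)) - j (E t)) by rewrite /k /D linearZ linearB.
    rewrite {1}jk innerZl (sol k Bk); [|lra..].
    rewrite /X dual_operatorZ /r innerZl -mulrN -mulrDr; congr (_ * _).
    rewrite inner_sym e2; [|lra|lra].
    rewrite (_ : A (P (t + s) - P t) k = \int[mu]_(z in `[t, t + s]) A (E z) k); last first.
      by apply: e1; lra.
    have cA : continuous (fun z => A (E z) k).
      move=> z; exact: (continuous_comp (cE z) (@dual_is_continuous _ _ (adjoint A k) _)).
    rewrite [RHS]addrC -RintegralB//; last 2 first.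
    + by apply: continuous_integrable; exact: inner_continuous.
    + exact: continuous_integrable.
    by apply: eq_Rintegral => z _; rewrite addrC [inner (rho z) _]inner_sym.
  rewrite ler_wpM2r//.
    by rewrite addr_ge0 ?sqr_ge0// (le_trans _ (coerc a _ _))// mulr_ge0 ?divr_ge0 ?sqr_ge0 ?(ltW muA0).
  by rewrite ler_expR ler_wpM2l ?energy_rate_ge0//; lra.
pose s_ n : R := (b - a) / n.+2%:R.
have ba0 : 0 < b - a by rewrite subr_gt0.
have s_gt0 n : 0 < s_ n by rewrite divr_gt0.
have s_lt n : s_ n < b - a by rewrite /s_ ltr_pdivrMr// ltr_pMr// ltr1n.
have s_small e : 0 < e -> \forall n \near \oo, s_ n < e by exact: div_small.
have average_close s t w e : 0 < s -> a - 1 <= t ->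
    (forall z, t <= z -> z <= t + s -> `|E z - w| <= e) -> `|w - X s t| <= e.
  move=> s0 at_ he.
  have := weak_primitive_bound cE PP (x := t) (y := t + s) (w := w) (e := e) at_.
  rewrite lerDl (ltW s0) (_ : t + s - t = s) => [/(_ isT he) h|]; last by ring.
  rewrite -(@ler_pM2l _ s)// -{1}[s]gtr0_norm// -normrZ scalerBr /X scalerA divff ?gt_eqF//.
  by rewrite scale1r distrC.
have lim_a : X (s_ n) a @[n --> \oo] --> E a.
  apply/cvgrPdist_le => e e0; have /cvgrPdist_lt/(_ _ e0)[d /= d0 dP] := cE a.
  apply: filterS (s_small _ d0) => n sd; apply: average_close => //; first exact: ltW.
  move=> z az zs; rewrite distrC ltW//; apply: dP; rewrite /= distrC ger0_norm; lra.
have lim_b : X (s_ n) (b - s_ n) @[n --> \oo] --> E b.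
  apply/cvgrPdist_le => e e0; have /cvgrPdist_lt/(_ _ e0)[d /= d0 dP] := cE b.
  apply: filterS (s_small _ d0) => n sd; have sb := s_lt n.
  apply: average_close => //; first by lra.
  rewrite subrK => z bz zb; rewrite distrC ltW//; apply: dP; rewrite /= ger0_norm; lra.
have bcvg := bilinear_cvg energy_form_linear energy_form_sym energy_form_bounded.
have cm : m ^+ 2 @[_ --> \oo] --> m ^+ 2 by exact: cvg_cst.
apply: (ler_cvg_to (cvgD cm (bcvg _ _ _ _ _ _ _ lim_b lim_b))
  (cvgM (cvg_cst _) (cvgD cm (bcvg _ _ _ _ _ _ _ lim_a lim_a)))).
by apply: nearW => n; exact: step_estimate.
Qed.

End Energy.

(** * Weak evolution equations *)

Section Evolution.
Context {R : realType} {V Q H : hilbertType R}.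
Local Notation mu := (@lebesgue_measure R).
Variables (j : clinear V H) (A : clinear V (dual V)) (B : clinear V (dual Q)).

Lemma clinear_comp_continuous {X Y : normedModType R} (F : clinear X Y) (E : R -> X) :
  continuous E -> continuous (fun t => F (E t)).
Proof. by move=> cE t; exact: (continuous_comp (cE t) (@clinear_continuous _ _ _ F _)). Qed.

Lemma dual_operator_continuous (E : R -> V) (k : V) :
  continuous E -> continuous (fun t => A (E t) k).
Proof.
by move=> cE t; exact: (continuous_comp (cE t) (@dual_is_continuous _ _ (adjoint A k) _)).
Qed.

(** Continuous solutions of the evolution equation with a continuous source, tested
    with the kernel of [B]. They form a vector space, in which the error of one step
    of the scheme is a combination of a few elementary members. *)
Definition evolves (a b : R) (E : R -> V) (rho : R -> H) : Prop :=
  [/\ continuous E, continuous rho & weak_solution j A B a b E rho].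

Let integrand_continuous (E : R -> V) (rho : R -> H) k : continuous E -> continuous rho ->
  continuous (fun t => - A (E t) k + inner (rho t) (j k)).
Proof.
move=> cE cr.
have -> : (fun t => - A (E t) k + inner (rho t) (j k)) =
    (fun t => inner (j k) (rho t) - A (E t) k).
  by apply/funext => t; rewrite addrC inner_sym.
by apply: continuous_sub; [exact: inner_continuous|exact: dual_operator_continuous].
Qed.

Lemma evolvesD a b E1 r1 E2 r2 : evolves a b E1 r1 -> evolves a b E2 r2 ->
  evolves a b (fun t => E1 t + E2 t) (fun t => r1 t + r2 t).
Proof.
move=> [cE1 cr1 s1] [cE2 cr2 s2]; split.
- by move=> t; apply: cvgD; [exact: cE1|exact: cE2].
- by move=> t; apply: cvgD; [exact: cr1|exact: cr2].
move=> k Bk x y ax xy yb.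
have -> : j (E1 y + E2 y) - j (E1 x + E2 x) = (j (E1 y) - j (E1 x)) + (j (E2 y) - j (E2 x)).
  by rewrite -!linearB -linearD; congr (j _); rewrite opprD addrACA.
rewrite innerDl (s1 k Bk)// (s2 k Bk)//.
rewrite -RintegralD//; [|exact/continuous_integrable/integrand_continuous..].
by apply: eq_Rintegral => t _; rewrite dual_operatorD innerDl; ring.
Qed.

Lemma evolvesB a b E1 r1 E2 r2 : evolves a b E1 r1 -> evolves a b E2 r2 ->
  evolves a b (fun t => E1 t - E2 t) (fun t => r1 t - r2 t).
Proof.
move=> [cE1 cr1 s1] [cE2 cr2 s2]; split.
- by move=> t; apply: cvgB; [exact: cE1|exact: cE2].
- by move=> t; apply: cvgB; [exact: cr1|exact: cr2].
move=> k Bk x y ax xy yb.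
have -> : j (E1 y - E2 y) - j (E1 x - E2 x) = (j (E1 y) - j (E1 x)) - (j (E2 y) - j (E2 x)).
  by rewrite -!linearB; congr (j _); rewrite !opprD !opprK addrACA.
rewrite innerBl (s1 k Bk)// (s2 k Bk)//.
rewrite -RintegralB//; [|exact/continuous_integrable/integrand_continuous..].
by apply: eq_Rintegral => t _; rewrite dual_operatorB innerBl; ring.
Qed.

Lemma evolves_restrict a b a' b' E rho : a <= a' -> b' <= b ->
  evolves a b E rho -> evolves a' b' E rho.
Proof.
move=> aa bb [cE cr s]; split => // k Bk x y ax xy yb.
by apply: s => //; [exact: le_trans ax|exact: le_trans bb].
Qed.

Lemma saddle_point_kernel h w : saddle_point j A B h w ->
  B w = 0 /\ forall k, B k = 0 -> A w k = inner h (j k).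
Proof.
move=> [nu [e Bw]]; split=> // k Bk.
have e' : A w k + B k nu = inner h (j k) := congr1 (fun l : dual V => l k) e.
by rewrite -e' Bk (_ : (0 : dual Q) nu = 0)// addr0.
Qed.

Lemma evolves_stationary a b h w : saddle_point j A B h w ->
  evolves a b (fun=> w) (fun=> h).
Proof.
move=> /saddle_point_kernel[_ wk]; split; [exact: cst_continuous..|].
move=> k Bk x y ax xy yb; rewrite subrr inner0l.
rewrite (@eq_Rintegral _ _ _ _ _ (cst 0)); first by rewrite Rintegral_cst// mul0r.
by move=> t _; rewrite wk// addNr.
Qed.

(** The velocity of the ramp is the second term of its source. *)
Lemma evolves_ramp a b (t0 tau : R) h w : saddle_point j A B h w ->
  evolves a b (fun t => ((t - t0) / tau) *: w)
    (fun t => ((t - t0) / tau) *: h + tau^-1 *: j w).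
Proof.
move=> /saddle_point_kernel[_ wk].
have cth : continuous (fun t : R => (t - t0) / tau).
  apply: continuous_mul; last exact: cst_continuous.
  by apply: continuous_sub; [move=> s; exact: cvg_id|exact: cst_continuous].
split.
- by move=> t; apply: cvgZ; [exact: cth|exact: cvg_cst].
- move=> t; apply: cvgD; last exact: cvg_cst.
  by apply: cvgZ; [exact: cth|exact: cvg_cst].
move=> k Bk x y ax xy yb.
rewrite (@eq_Rintegral _ _ _ _ _ (cst (tau^-1 * inner (j w) (j k)))); last first.
  by move=> t _; rewrite dual_operatorZ wk// innerDl !innerZl /=; ring.
rewrite Rintegral_cst_itv//.
have -> : j (((y - t0) / tau) *: w) - j (((x - t0) / tau) *: w) = ((y - x) / tau) *: j w.
  by rewrite -linearB -scalerBl linearZ; congr (_ *: _); ring.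
by rewrite innerZl; ring.
Qed.

(** The multiplier disappears in the test with the kernel of [B]. *)
Lemma evolves_solution a b rhs g ini z lam rho : a < b ->
    solution j A B a b rhs g ini z lam -> {within `[a, b], continuous rho} ->
    {ae mu, forall t, t \in `[a, b] -> rhs t = rho t} ->
  evolves a b (z \o clamp a b) (rho \o clamp a b).
Proof.
move=> ab [cz _ [U [U0 [U2 dU cU] eqU]] Bz _] crho rr.
have cz' := continuous_clamp (ltW ab) cz.
have cr' := continuous_clamp (ltW ab) crho.
split => // k Bk x y ax xy yb.
have cl t : a <= t -> t <= b -> clamp a b t = t.
  by move=> at_ tb; rewrite clamp_id// in_itv/= at_.
have U20 := U2 0%N isT; have U21 := U2 1%N isT.
have dU0 := dU 0%N isT; have cU0 := cU 0%N isT.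
have := weak_derivative_functional (l := inner_functional (j k))
  (c := fun t => - A (z (clamp a b t)) k + inner (rho (clamp a b t)) (j k))
  (@hilbert_norming _ H) ab U20 U21 dU0 cU0 _ _ ax xy yb.
rewrite U0 /= => <-.
- by rewrite !cl ?(le_trans xy)// ?(le_trans ax)// inner_sym innerBr.
- exact/continuous_integrable/integrand_continuous.
apply: ae_mono (ae_and eqU rr) => t [e1 e2] tab.
have e3 : inner (U 1%N t) (j k) + A (z t) k + B k (lam t) = inner (rhs t) (j k) :=
  congr1 (fun l : dual V => l k) (e1 tab).
move: e3; rewrite Bk (_ : (0 : dual Q) _ = 0)// addr0 (e2 tab) clamp_id// => <-.
by rewrite inner_sym; ring.
Qed.

End Evolution.

(** * The error equations of the two substeps *)

Section BoundedLinear.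
Context {R : realType} {X Y : normedModType R}.

Lemma bounded_linear_clinear (M : X -> Y) (k : R) : linear M ->
  (forall x, `|M x| <= k * `|x|) -> exists F : clinear X Y, forall x, F x = M x.
Proof.
move=> linM Mk; pose g := GRing.isLinear.Build R X Y _ M linM.
pose F : {linear X -> Y} := HB.pack M g.
have cF : continuous F.
  apply: bounded_linear_continuous; apply/linear_boundedP; near=> r => x.
  by apply: le_trans (Mk x) _; rewrite ler_wpM2r.
by exists (CLinear cF).
Unshelve. all: by end_near. Qed.

End BoundedLinear.

(** Two vectors with the same inner products are equal: identities in a Hilbert space
    become ring identities. *)
Lemma inner_injl {R : realType} {H : hilbertType R} (x y : H) :
  (forall h, inner x h = inner y h) -> x = y.
Proof.
move=> xy; apply/eqP; rewrite -subr_eq0 -normr_eq0 -sqrf_eq0 -inner_norm.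
by rewrite innerBl xy subrr.
Qed.

Section Taylor.
Context {R : realType} {X : completeNormedModType R} {H : hilbertType R}.
Local Notation mu := (@lebesgue_measure R).
Variables (M : clinear X H) (a b : R) (u v : R -> X).
Hypotheses (nX : norming X) (ab : a < b) (u2 : bochner_L2 `[a, b] u)
  (v2 : bochner_L2 `[a, b] v) (uv : weak_derivative a b u v)
  (cu : {within `[a, b], continuous u}) (cv : {within `[a, b], continuous v}).

Lemma clinear_clamp_continuous : continuous (fun t => M (v (clamp a b t))).
Proof. by apply: clinear_comp_continuous; exact: (continuous_clamp (ltW ab) cv). Qed.

Lemma linear_image_increment_inner (h : H) x y : a <= x -> x <= y -> y <= b ->
  inner h (M (u y) - M (u x)) = \int[mu]_(t in `[x, y]) inner h (M (v (clamp a b t))).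
Proof.
move=> ax xy yb; have [k Mk] := clinear_bounded M.
have [l lP] := linear_image_functional (linearP M) Mk h.
rewrite innerBr -!lP.
apply: (weak_derivative_functional nX ab u2 v2 uv cu) => //.
  by apply: continuous_integrable; apply: inner_continuous; exact: clinear_clamp_continuous.
by apply: aeW => t tab; rewrite lP clamp_id.
Qed.

(** [M (u y) - M (u x)] is the integral of [M (v t)], which differs from [M (v x)] by at
    most an integral of [N]. With [z] the end of a time step, one constant serves all [y]
    in the step. *)
Lemma linear_image_taylor (N : R -> R) : (forall t, 0 <= N t) ->
    (forall x y, a <= x -> y <= b -> mu.-integrable `[x, y] (EFin \o N)) ->
    (forall x y, a <= x -> x <= y -> y <= b ->
      `|M (v y) - M (v x)| <= \int[mu]_(t in `[x, y]) N t) ->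
  forall x y z, a <= x -> x <= y -> y <= z -> z <= b ->
    `|M (u y) - M (u x) - (y - x) *: M (v x)| <= (y - x) * \int[mu]_(t in `[x, z]) N t.
Proof.
move=> N0 iN vN x y z ax xy yz zb.
have [P PP] := weak_primitive_exists a clinear_clamp_continuous.
have yb := le_trans yz zb.
have -> : M (u y) - M (u x) = P y - P x.
  apply/eqP; rewrite -subr_eq0 -normr_eq0 -sqrf_eq0 -inner_norm innerBr.
  by rewrite linear_image_increment_inner// PP// subrr.
apply: (weak_primitive_bound clinear_clamp_continuous PP) => // t xt ty.
have tb := le_trans ty yb.
rewrite clamp_id ?in_itv/= ?(le_trans ax xt)//.
apply: le_trans (vN _ _ ax xt tb) _.
rewrite (Rintegral_itv_split xt (le_trans ty yz)) ?iN// lerDl.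
by apply: Rintegral_ge0.
Qed.

End Taylor.

Section Steps.
Context {R : realType} {V Q H : hilbertType R}.
Local Notation mu := (@lebesgue_measure R).
Variables (j : clinear V H) (A : clinear V (dual V)) (B : clinear V (dual Q)).
Variables (Bm : clinear (dual Q) V).
Hypotheses (BBm : cancel Bm B) (ABm : forall h w, B w = 0 -> A (Bm h) w = 0).

Definition lifting : clinear (dual Q) H :=
  @CLinear R (dual Q) H (j \o Bm)
    (fun x => continuous_comp (@clinear_continuous _ _ _ Bm x)
                              (@clinear_continuous _ _ _ j _)).

(** [A (Bm h)] vanishes on the kernel, so the only source of [Bm (g t)] is its own
    velocity. *)
Lemma evolves_lifting (a b : R) (g0 g1 : R -> dual Q) : a < b ->
    bochner_L2 `[a, b] g0 -> bochner_L2 `[a, b] g1 -> weak_derivative a b g0 g1 ->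
    {within `[a, b], continuous g0} -> {within `[a, b], continuous g1} ->
  evolves j A B a b (fun t => Bm (g0 (clamp a b t))) (fun t => lifting (g1 (clamp a b t))).
Proof.
move=> ab g02 g12 dg cg0 cg1; split.
- by apply: clinear_comp_continuous; exact: (continuous_clamp (ltW ab) cg0).
- by apply: clinear_comp_continuous; exact: (continuous_clamp (ltW ab) cg1).
move=> k Bk x y ax xy yb; rewrite !clamp_id ?in_itv/= ?ax ?yb ?(le_trans xy) ?(le_trans ax)//.
have := linear_image_increment_inner lifting (@dual_norming _ _) ab g02 g12 dg cg0 cg1
  (j k) ax xy yb.
rewrite /= inner_sym => ->; apply: eq_Rintegral => t _.
by rewrite ABm// oppr0 add0r inner_sym.
Qed.

Variables (T : R) (g0 g1 : R -> dual Q) (f : R -> V -> H) (F0 : R -> H) (u : R -> V).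
Hypotheses (hu : evolves j A B 0 T (u \o clamp 0 T) (F0 \o clamp 0 T))
  (hg : evolves j A B 0 T (fun t => Bm (g0 (clamp 0 T t))) (fun t => lifting (g1 (clamp 0 T t))))
  (Bu : forall t, t \in `[0, T] -> B (u t) = g0 t).

(** The inhomogeneity of the equation for the part of the solution in the kernel. *)
Definition source t : H := F0 t - lifting (g1 t).

Lemma homogeneous_evolves (t0 t1 : R) zeta z : t0 < t1 ->
    homogeneous j A B t0 t1 zeta z ->
  [/\ evolves j A B t0 t1 (z \o clamp t0 t1) (fun=> 0), z t0 = zeta &
      forall t, t \in `[t0, t1] -> B (z t) = 0].
Proof.
move=> t01 [lam sol]; have [_ _ _ Bz z0] := sol; split => //.
apply: (@evolves_solution _ _ _ _ _ _ _ _ _ _ _ _ _ _ (fun=> 0) t01 sol); last exact: aeW.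
by apply: continuous_subspaceT; exact: cst_continuous.
Qed.

(** The error is the homogeneous solution plus the stationary solution [w], minus the part
    of [u] in the kernel. *)
Lemma euler_evolution (t0 t1 : R) (un uE : V) : 0 <= t0 -> t0 < t1 -> t1 <= T ->
    euler_step j A B Bm f g0 g1 t0 t1 un uE ->
  exists E rho, [/\ evolves j A B t0 t1 E rho,
    forall t, t \in `[t0, t1] -> B (E t) = 0, E t0 = un - u t0, E t1 = uE - u t1 &
    forall t, t \in `[t0, t1] ->
      rho t = (f t0 un - F0 t0) + (source t0 - source t)].
Proof.
move=> t00 t01 t1T [w [z [sw hz ->]]].
have [ez z0 Bz] := homogeneous_evolves t01 hz.
have [Bw _] := saddle_point_kernel sw.
have cl t : t \in `[t0, t1] -> clamp t0 t1 t = t /\ clamp 0 T t = t.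
  rewrite in_itv /= => /andP[tt0 tt1]; rewrite !clamp_id ?in_itv/= ?tt0 ?tt1//.
  by rewrite (le_trans t00)// (le_trans tt1).
have in0T t : t \in `[t0, t1] -> t \in `[0, T].
  by rewrite !in_itv /= => /andP[tt0 tt1]; rewrite (le_trans t00)// (le_trans tt1).
have i0 : t0 \in `[t0, t1] by rewrite in_itv /= lexx ltW.
have i1 : t1 \in `[t0, t1] by rewrite in_itv /= lexx ltW.
have eu := evolves_restrict t00 t1T hu; have eg := evolves_restrict t00 t1T hg.
have := evolvesB (evolvesD ez (evolves_stationary t0 t1 sw)) (evolvesB eu eg).
set E := (X in evolves _ _ _ _ _ X _); set rho := (X in evolves _ _ _ _ _ _ X) => e.
exists E, rho; split => //.
- move=> t tt; rewrite /E /=; have [-> ->] := cl t tt.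
  by rewrite linearB linearD linearB /= Bz// Bw Bu ?in0T// BBm subrr addr0 subrr.
- by rewrite /E /=; have [-> ->] := cl t0 i0; rewrite z0 subrK opprB addrA subrK.
- rewrite /E /=; have [-> ->] := cl t1 i1.
  by apply: inner_injl => h; rewrite !(innerDl, innerNl, inner0l); ring.
- move=> t tt; rewrite /rho /=; have [_ ->] := cl t tt.
  rewrite /source -[j (Bm (g1 t0))]/(lifting (g1 t0)).
  by apply: inner_injl => h; rewrite !(innerDl, innerNl, innerZl, inner0l); ring.
Qed.

(** The second stage adds the ramp of [w1], and the velocity of the ramp is compensated by
    the stationary solution [w2]; what remains is the linear part of the source. *)
Lemma corrector_evolution (t0 t1 : R) (un uE u1 : V) : 0 <= t0 -> t0 < t1 -> t1 <= T ->
    euler_step j A B Bm f g0 g1 t0 t1 un uE ->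
    corrector_step j A B Bm f g1 (t1 - t0) t0 t1 un uE u1 ->
  exists E rho, [/\ evolves j A B t0 t1 E rho,
    forall t, t \in `[t0, t1] -> B (E t) = 0, E t0 = un - u t0, E t1 = u1 - u t1 &
    forall t, t \in `[t0, t1] -> let theta := (t - t0) / (t1 - t0) in
      rho t = (1 - theta) *: (f t0 un - F0 t0) + theta *: (f t1 uE - F0 t1) +
              (source t0 + theta *: (source t1 - source t0) - source t)].
Proof.
move=> t00 t01 t1T es [w1 [w2 [z [sw1 sw2 hz ->]]]].
have [E1 [r1 [e1 BE1 E10 E11 r1E]]] := euler_evolution t00 t01 t1T es.
have [ez z0 Bz] := homogeneous_evolves t01 hz.
have [Bw1 _] := saddle_point_kernel sw1; have [Bw2 _] := saddle_point_kernel sw2.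
have i0 : t0 \in `[t0, t1] by rewrite in_itv /= lexx ltW.
have i1 : t1 \in `[t0, t1] by rewrite in_itv /= lexx ltW.
have tau0 : t1 - t0 != 0 by rewrite subr_eq0 gt_eqF.
have := evolvesD e1 (evolvesD (evolvesB ez (evolves_stationary t0 t1 sw2))
  (evolves_ramp t0 t1 t0 (t1 - t0) sw1)).
set E := (X in evolves _ _ _ _ _ X _); set rho := (X in evolves _ _ _ _ _ _ X) => e.
exists E, rho; split => //.
- move=> t tt; rewrite /E /= clamp_id//.
  by rewrite !linearD linearN linearZ /= BE1// Bz// Bw1 Bw2 oppr0 scaler0 !addr0.
- by rewrite /E /= clamp_id// z0 subrr E10 subrr mul0r scale0r !addr0.
- rewrite /E /= clamp_id// E11 divff// scale1r.
  by apply: inner_injl => h; rewrite !(innerDl, innerNl, inner0l); ring.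
- move=> t tt theta; rewrite /rho /= r1E// -/theta.
  rewrite /source.
  rewrite -[j (Bm (g1 t0))]/(lifting (g1 t0)) -[j (Bm (g1 t1))]/(lifting (g1 t1)).
  move: theta => th.
  by apply: inner_injl => h; rewrite !(innerDl, innerNl, innerZl, inner0l); ring.
Qed.

End Steps.

(** * The errors of one step *)

Section NormDensity.
Context {R : realType} {H : hilbertType R}.
Local Notation mu := (@lebesgue_measure R).

(** A Borel function standing for [t |-> `|w t|], which need not be Borel itself. *)
Definition norm_density (a b : R) (w : R -> H) (N : R -> R) : Prop :=
  [/\ measurable_fun setT N, forall t, 0 <= N t,
      {ae mu, forall t, `[a, b]%classic t -> N t = `|w t|} &
      (\int[mu]_(t in `[a, b]) (N t ^+ 2)%:E < +oo)%E].

Lemma norm_density_integrable a b w N : norm_density a b w N ->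
  forall x y, a <= x -> y <= b ->
  mu.-integrable `[x, y] (EFin \o N) /\ mu.-integrable `[x, y] (EFin \o (fun t => N t ^+ 2)).
Proof.
move=> [mN N0 _ N2] x y ax yb.
have Dfin : (mu `[a, b] < +oo)%E by rewrite lebesgue_measure_itv/=; case: ifP; rewrite ?ltry.
have [i1 i2] := sq_integrable_integrable (measurable_itv `[a, b]) Dfin
  (measurable_funTS mN) N2.
have sub : `[x, y] `<=` `[a, b] by apply: subset_itv; rewrite bnd_simp.
by split; [apply: integrableS i1|apply: integrableS i2]; rewrite //; exact: measurable_itv.
Qed.

Lemma norm_density_integral_le a b w1 w2 N1 N2 t : a <= t -> t <= b ->
    norm_density a b w1 N1 -> norm_density a b w2 N2 ->
  ((\int[mu]_(s in `[a, t]) (N1 s ^+ 2) + \int[mu]_(s in `[a, t]) (N2 s ^+ 2))%:E <=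
   \int[mu]_(s in `[a, t]) (`|w1 s| ^+ 2 + `|w2 s| ^+ 2)%:E)%E.
Proof.
move=> at_ tb d1 d2.
have [_ i1] := norm_density_integrable d1 (lexx a) tb.
have [_ i2] := norm_density_integrable d2 (lexx a) tb.
move: d1 d2 => [mN1 _ e1 _] [mN2 _ e2 _].
rewrite -RintegralD// /Rintegral fineK; last first.
  by apply: integrable_fin_num => //; apply: eq_integrable (integrableD _ i1 i2).
apply: ae_nonneg_integral_mono_l => //.
- apply/measurable_EFinP; apply: measurable_funD; apply: measurable_funX;
  exact: measurable_funTS.
- by move=> s _; rewrite lee_fin addr_ge0 ?sqr_ge0.
apply: ae_mono (ae_and e1 e2) => s [h1 h2] /=; rewrite in_itv/= => /andP[as_ st].
by rewrite h1 ?h2 ?lexx//= in_itv/= as_ (le_trans st).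
Qed.

Lemma sobolev_norm_density {X : completeNormedModType R} (M : clinear X H) (a b : R)
    (U : nat -> R -> X) (k : nat) : norming X -> a < b ->
    bochner_L2 `[a, b] (U k) -> bochner_L2 `[a, b] (U k.+1) ->
    weak_derivative a b (U k) (U k.+1) -> {within `[a, b], continuous (U k)} ->
  exists2 N, norm_density a b (fun t => M (U k.+1 t)) N &
    forall x y, a <= x -> x <= y -> y <= b ->
      `|M (U k y) - M (U k x)| <= \int[mu]_(t in `[x, y]) N t.
Proof.
move=> nX ab u2 v2 uv cu; have [c Mc] := clinear_bounded M.
by have [N [? ? ? ? ?]] := linear_image_increment (linearP M) Mc nX ab u2 v2 uv cu; exists N.
Qed.

End NormDensity.

Section ErrorBounds.
Context {R : realType} {V Q H : hilbertType R}.
Local Notation mu := (@lebesgue_measure R).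
Variables (j : clinear V H) (A A1 : clinear V (dual V)) (A2 : clinear V H).
Variables (muA c1 c2 cj : R).
Hypotheses (A1_sym : self_adjoint A1) (AE : forall v, A v = A1 v + pivot j (A2 v)).
Hypotheses (muA0 : 0 < muA) (c20 : 0 <= c2) (cj0 : 0 <= cj).
Hypotheses (A1_le : forall v, `|A1 v| <= c1 * `|v|).
Hypotheses (A2_le : forall v, `|A2 v| <= c2 * `|v|) (j_le : forall v, `|j v| <= cj * `|v|).
Variables (B : clinear V (dual Q)) (Bm : clinear (dual Q) V).
Hypotheses (hAB : elliptic_on A (ker B) muA) (BBm : cancel Bm B)
  (ABm : forall h w, B w = 0 -> A (Bm h) w = 0).
Variables (T : R) (g0 g1 : R -> dual Q) (f : R -> V -> H) (F0 : R -> H) (u : R -> V).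
Hypotheses (hu : evolves j A B 0 T (u \o clamp 0 T) (F0 \o clamp 0 T))
  (hg : evolves j A B 0 T (fun t => Bm (g0 (clamp 0 T t))) (fun t => lifting j Bm (g1 (clamp 0 T t))))
  (Bu : forall t, t \in `[0, T] -> B (u t) = g0 t).

Let Phi := energy j A1 muA c2.
Let c := energy_rate muA c2 cj.
Let src := source j Bm g1 F0.

Lemma energy_ge v : B v = 0 -> `|v| ^+ 2 <= 2 / muA * Phi v.
Proof.
move=> Bv; have := energy_coercive AE muA0 A2_le (hAB Bv).
by rewrite -/Phi => h; rewrite mulrAC ler_pdivlMr//; lra.
Qed.

Lemma energy_ker_ge0 v : B v = 0 -> 0 <= Phi v.
Proof.
move=> Bv; have := energy_coercive AE muA0 A2_le (hAB Bv); apply: le_trans.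
by rewrite mulr_ge0 ?sqr_ge0// divr_ge0// ltW.
Qed.

Let evolution_bound (t0 t1 m : R) E rho : t0 < t1 -> evolves j A B t0 t1 E rho ->
    (forall t, t \in `[t0, t1] -> B (E t) = 0) ->
    (forall t, t \in `[t0, t1] -> `|rho t| <= m) ->
  Phi (E t1) <= expR (c * (t1 - t0)) * Phi (E t0) + (expR (c * (t1 - t0)) - 1) * m ^+ 2.
Proof.
move=> t01 [cE cr s] BE rm.
have BE' t : t0 <= t -> t <= t1 -> B (E t) = 0 by move=> h1 h2; rewrite BE// in_itv/= h1.
have rm' t : t0 <= t -> t <= t1 -> `|rho t| <= m.
  by move=> h1 h2; rewrite rm// in_itv/= h1.
have := energy_estimate A1_sym AE muA0 c20 cj0 A1_le A2_le j_le hAB t01 cE cr BE' rm' s.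
rewrite -/Phi -/c; move: (expR _) (Phi _) (Phi _) => e p q; lra.
Qed.

Lemma euler_bound (t0 t1 l W : R) (un uE : V) : 0 <= t0 -> t0 < t1 -> t1 <= T ->
    euler_step j A B Bm f g0 g1 t0 t1 un uE -> `|f t0 un - F0 t0| <= l ->
    (forall t, t \in `[t0, t1] -> `|src t - src t0| <= W) ->
  [/\ B (un - u t0) = 0, B (uE - u t1) = 0 &
    Phi (uE - u t1) <= expR (c * (t1 - t0)) * Phi (un - u t0) +
      (expR (c * (t1 - t0)) - 1) * (l + W) ^+ 2].
Proof.
move=> t00 t01 t1T es hl hW.
have [E [rho [e BE E0 E1 rE]]] := euler_evolution BBm hu hg Bu t00 t01 t1T es.
have i0 : t0 \in `[t0, t1] by rewrite in_itv /= lexx ltW.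
have i1 : t1 \in `[t0, t1] by rewrite in_itv /= lexx ltW.
rewrite -E0 -E1; split; [exact: BE|exact: BE|].
apply: (evolution_bound t01 e BE) => t tt; rewrite rE//.
apply: le_trans (ler_normD _ _) _; apply: lerD => //.
by rewrite distrC; exact: hW.
Qed.

Lemma corrector_bound (t0 t1 l0 l1 W : R) (un uE u1 : V) :
    0 <= t0 -> t0 < t1 -> t1 <= T ->
    euler_step j A B Bm f g0 g1 t0 t1 un uE ->
    corrector_step j A B Bm f g1 (t1 - t0) t0 t1 un uE u1 ->
    `|f t0 un - F0 t0| <= l0 -> `|f t1 uE - F0 t1| <= l1 ->
    (forall t, t \in `[t0, t1] ->
      `|src t0 + ((t - t0) / (t1 - t0)) *: (src t1 - src t0) - src t| <= W) ->
  B (u1 - u t1) = 0 /\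
  Phi (u1 - u t1) <= expR (c * (t1 - t0)) * Phi (un - u t0) +
      (expR (c * (t1 - t0)) - 1) * (l0 + l1 + W) ^+ 2.
Proof.
move=> t00 t01 t1T es cs hl0 hl1 hW.
have [E [rho [e BE E0 E1 rE]]] := corrector_evolution BBm hu hg Bu t00 t01 t1T es cs.
have i1 : t1 \in `[t0, t1] by rewrite in_itv /= lexx ltW.
rewrite -E0 -E1; split; first exact: BE.
apply: (evolution_bound t01 e BE) => t tt; rewrite rE//.
have /andP[th0 th1] : 0 <= (t - t0) / (t1 - t0) <= 1.
  have d0 : 0 < t1 - t0 by rewrite subr_gt0.
  move: tt; rewrite in_itv /= => /andP[h0 h1].
  by rewrite ler_pdivrMr// divr_ge0 ?subr_ge0 ?(ltW t01)// mul1r lerB.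
apply: le_trans (ler_normD _ _) _; apply: lerD; last exact: hW.
apply: le_trans (ler_normD _ _) _; apply: lerD; rewrite normrZ.
  by rewrite ger0_norm ?subr_ge0//; apply: le_trans hl0; rewrite ler_piMl// gerBl.
by rewrite ger0_norm//; apply: le_trans hl1; rewrite ler_piMl.
Qed.

(** Both values at the ends of the interval are compared with the tangent at [t0]. *)
Lemma interpolation_bound (dsrc : R -> H) (t0 t1 W : R) : t0 < t1 ->
    (forall y, t0 <= y -> y <= t1 ->
      `|src y - src t0 - (y - t0) *: dsrc t0| <= (y - t0) * W) ->
  forall t, t \in `[t0, t1] ->
    `|src t0 + ((t - t0) / (t1 - t0)) *: (src t1 - src t0) - src t| <= 2 * (t1 - t0) * W.
Proof.
move=> t01 hW t; rewrite in_itv /= => /andP[h0 h1].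
have d0 : 0 < t1 - t0 by rewrite subr_gt0.
have W0 : 0 <= W.
  have := le_trans (normr_ge0 _) (hW t1 (ltW t01) (lexx _)).
  by rewrite pmulr_rge0.
set th := (t - t0) / (t1 - t0).
have th0 : 0 <= th by rewrite divr_ge0 ?subr_ge0// ltW.
have th1 : th <= 1 by rewrite ler_pdivrMr// mul1r lerB.
have -> : src t0 + th *: (src t1 - src t0) - src t =
    th *: (src t1 - src t0 - (t1 - t0) *: dsrc t0) - (src t - src t0 - (t - t0) *: dsrc t0).
  have tE : t - t0 = th * (t1 - t0) by rewrite /th divfK// gt_eqF.
  by apply: inner_injl => h; rewrite tE !(innerDl, innerNl, innerZl); ring.
apply: le_trans (ler_normB _ _) _.
rewrite -mulrA mulr_natl mulr2n; apply: lerD.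
  rewrite normrZ ger0_norm//; apply: (@le_trans _ _ (1 * ((t1 - t0) * W))).
    by apply: ler_pM => //; exact: hW (ltW t01) (lexx _).
  by rewrite mul1r.
by apply: le_trans (hW t h0 h1) _; rewrite ler_wpM2r// lerB.
Qed.

End ErrorBounds.

(** * Recursive error bounds *)

Section Recursion.
Context {R : realType}.
Implicit Types (c p S tau : R).

Lemma expR_sub1_le (z : R) : expR z - 1 <= z * expR z.
Proof.
rewrite -(@ler_pM2r _ (expR (- z))) ?expR_gt0// mulrBl -mulrA -expRD subrr expR0 mul1r mulr1.
by have := expR_ge1Dx (- z); lra.
Qed.

(** In this section [c] is the rate of the energy estimate, [p] bounds the squared
    Lipschitz constant of [f] with respect to the energy, and [S] bounds the step size. *)
Definition growth_rate c p S : R :=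
  c + 3 * c * p * (1 + expR (c * S) * (1 + 2 * c * S * p)).

Definition defect_factor c p S : R :=
  expR (c * S) * (12 * c ^+ 2 * p * expR (c * S) + 24 * c).

Lemma defect_factor_ge0 c p S : 0 <= c -> 0 <= p -> 0 <= defect_factor c p S.
Proof.
move=> c0 p0; rewrite mulr_ge0 ?expR_ge0// addr_ge0 ?mulr_ge0 ?expR_ge0 ?sqr_ge0//.
Qed.

Lemma growth_rate_ge0 c p S : 0 <= c -> 0 <= p -> 0 <= S -> 0 <= growth_rate c p S.
Proof. by move=> c0 p0 S0; rewrite !(addr_ge0, mulr_ge0) ?expR_ge0. Qed.

Lemma predictor_recursion c p S tau x y J1 : 0 <= c -> 0 <= p -> 0 <= tau ->
    tau <= S -> 0 <= x -> 0 <= J1 ->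
    y <= expR (c * tau) * x + (expR (c * tau) - 1) * (2 * p * x + 4 * tau * J1) ->
  y <= expR (c * S) * ((1 + 2 * c * S * p) * x + 4 * c * tau ^+ 2 * J1).
Proof.
move=> c0 p0 t0 tS x0 J0 hy; apply: le_trans hy _.
have e1 := expR_sub1_le (c * tau).
have M0 : 0 <= 2 * p * x + 4 * tau * J1 by rewrite !(addr_ge0, mulr_ge0).
have eS : expR (c * tau) <= expR (c * S) by rewrite ler_expR ler_wpM2l.
have e0 : 0 <= expR (c * tau) := expR_ge0 _.
apply: (@le_trans _ _ (expR (c * tau) * ((1 + 2 * c * tau * p) * x + 4 * c * tau ^+ 2 * J1))).
  apply: le_trans (lerD (lexx _) (ler_wpM2r M0 e1)) _; rewrite le_eqVlt; apply/orP; left.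
  by apply/eqP; ring.
apply: ler_pM => //.
  by rewrite !(addr_ge0, mulr_ge0, sqr_ge0).
rewrite lerD2r ler_wpM2r// lerD2l -!mulrA ler_wpM2l// ler_wpM2l// ler_wpM2r//.
Qed.

(** The defects [J1] and [J2] are multiplied by [expR (c * tau) - 1 = O(tau)], and [J1]
    enters through the predictor error [y], where it has met this factor once already. *)
Lemma scheme_recursion c p S tau x y x' J1 J2 : 0 <= c -> 0 <= p -> 0 <= tau ->
    tau <= S -> 0 <= x -> 0 <= J1 -> 0 <= J2 ->
    y <= expR (c * tau) * x + (expR (c * tau) - 1) * (2 * p * x + 4 * tau * J1) ->
    x' <= expR (c * tau) * x +
      (expR (c * tau) - 1) * (3 * (p * x + p * y + 8 * tau ^+ 3 * J2)) -> 0 <= y ->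
  x' <= expR (growth_rate c p S * tau) * x +
        defect_factor c p S * (tau ^+ 3 * J1 + tau ^+ 4 * J2).
Proof.
move=> c0 p0 t0 tS x0 J10 J20 hy hx y0.
have hy2 := predictor_recursion c0 p0 t0 tS x0 J10 hy.
have eS : expR (c * tau) <= expR (c * S) by rewrite ler_expR ler_wpM2l.
have e0 : 0 <= expR (c * tau) := expR_ge0 _.
set G := expR (c * S) in eS hy2 *; have G0 : 0 <= G := expR_ge0 _.
have M0 : 0 <= 3 * (p * x + p * y + 8 * tau ^+ 3 * J2).
  by rewrite !(addr_ge0, mulr_ge0, exprn_ge0).
pose al := 3 * c * p * (1 + G * (1 + 2 * c * S * p)).
pose ga := 12 * c ^+ 2 * p * G * (tau ^+ 3 * J1) + 24 * c * (tau ^+ 4 * J2).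
have h1 : x' <= expR (c * tau) * ((1 + al * tau) * x + ga).
  apply: le_trans hx _.
  apply: le_trans (lerD (lexx _) (ler_wpM2r M0 (expR_sub1_le (c * tau)))) _.
  rewrite [leLHS](_ : _ = expR (c * tau) *
    (x + c * tau * (3 * (p * x + p * y + 8 * tau ^+ 3 * J2)))); last by ring.
  rewrite ler_wpM2l//.
  have := ler_wpM2l (mulr_ge0 (mulr_ge0 (mulr_ge0 (ler0n R 3) c0) p0) t0) hy2.
  rewrite -subr_ge0 -[in X in _ -> X]subr_ge0; congr (_ <= _).
  by rewrite /ga /al; ring.
have ga_le : ga <= (12 * c ^+ 2 * p * G + 24 * c) * (tau ^+ 3 * J1 + tau ^+ 4 * J2).
  have j1 : 0 <= tau ^+ 3 * J1 by rewrite mulr_ge0// exprn_ge0.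
  have j2 : 0 <= tau ^+ 4 * J2 by rewrite mulr_ge0// exprn_ge0.
  have k1 : 0 <= 12 * c ^+ 2 * p * G by rewrite !mulr_ge0// sqr_ge0.
  have k2 : 0 <= 24 * c by rewrite mulr_ge0.
  rewrite /ga [leRHS]mulrDl; apply: lerD; [rewrite ler_wpM2l// lerDl//|].
  by rewrite ler_wpM2l// lerDr.
have ga0 : 0 <= ga by rewrite !(addr_ge0, mulr_ge0, sqr_ge0, exprn_ge0).
apply: le_trans h1 _; rewrite mulrDr mulrA; apply: lerD.
  rewrite ler_wpM2r// /growth_rate -/G -/al mulrDl expRD ler_wpM2l//.
  exact: expR_ge1Dx.
rewrite /defect_factor -/G -mulrA; apply: ler_pM => //.
Qed.

Lemma recursion_sum (al Ga : R) (tau : R) (x J1 J2 S1 S2 : nat -> R) (m : nat) :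
    0 <= al -> 0 <= Ga -> 0 <= tau -> x 0%N = 0 -> S1 0%N = 0 -> S2 0%N = 0 ->
    (forall n, 0 <= J1 n) -> (forall n, 0 <= J2 n) ->
    (forall n, (n < m)%N -> S1 n.+1 = S1 n + J1 n) ->
    (forall n, (n < m)%N -> S2 n.+1 = S2 n + J2 n) ->
    (forall n, (n < m)%N -> x n.+1 <= expR (al * tau) * x n +
       Ga * (tau ^+ 3 * J1 n + tau ^+ 4 * J2 n)) ->
  forall n, (n <= m)%N ->
    x n <= expR (al * (n%:R * tau)) * Ga * (tau ^+ 3 * S1 n + tau ^+ 4 * S2 n).
Proof.
move=> al0 Ga0 t0 x0 S10 S20 J10 J20 S1S S2S xS; elim=> [_|n IH nm].
  by rewrite x0 S10 S20 !mulr0 addr0 mulr0.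
apply: le_trans (xS n nm) _; have := IH (ltnW nm); rewrite S1S// S2S//.
have -> : expR (al * (n.+1%:R * tau)) = expR (al * tau) * expR (al * (n%:R * tau)).
  by rewrite -expRD -natr1; congr expR; ring.
set e1 := expR (al * tau); set en := expR (al * (n%:R * tau)) => h.
have e1_ge1 : 1 <= e1.
  by apply: le_trans (expR_ge1Dx _); rewrite lerDl mulr_ge0.
have en_ge1 : 1 <= en.
  by apply: le_trans (expR_ge1Dx _); rewrite lerDl !mulr_ge0.
have j0 : 0 <= Ga * (tau ^+ 3 * J1 n + tau ^+ 4 * J2 n).
  by rewrite !(addr_ge0, mulr_ge0, exprn_ge0).
have h1 := ler_wpM2l (le_trans ler01 e1_ge1) h.
have ee : 1 <= e1 * en by rewrite -[1]mulr1 ler_pM.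
have h2 := ler_wpM2r j0 ee.
by move: h1 h2; rewrite mul1r => h1 h2; apply: le_trans (lerD h1 h2) _; rewrite le_eqVlt;
  apply/orP; left; apply/eqP; ring.
Qed.

End Recursion.

(** * The convergence theorem *)

Section Grid.
Context {R : realType}.
Variables (T : R) (N : nat).
Hypotheses (T0 : 0 < T) (N0 : (0 < N)%N).

Lemma grid_diff n : grid T N n.+1 - grid T N n = T / N%:R.
Proof. by rewrite /grid -mulrBl -natr1 addrAC subrr add0r mul1r. Qed.

Lemma grid_step_gt0 : 0 < T / N%:R.
Proof. by rewrite divr_gt0// ltr0n. Qed.

Lemma grid_ge0 n : 0 <= grid T N n.
Proof. by rewrite mulr_ge0// ltW// grid_step_gt0. Qed.

Lemma grid_lt n : grid T N n < grid T N n.+1.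
Proof. by rewrite -subr_gt0 grid_diff grid_step_gt0. Qed.

Lemma grid_le n : (n <= N)%N -> grid T N n <= T.
Proof.
move=> nN; rewrite /grid mulrCA ger_pMr// ler_pdivrMr ?ltr0n// mul1r ler_nat//.
Qed.

Lemma grid_in n : (n <= N)%N -> grid T N n \in `[0, T].
Proof. by move=> nN; rewrite in_itv/= grid_ge0 grid_le. Qed.

Lemma grid_step_le n : (0 < n)%N -> T / N%:R <= grid T N n.
Proof. by move=> n0; rewrite /grid ler_peMl ?ler1n// ltW// grid_step_gt0. Qed.

End Grid.

Theorem theorem4p2 (R : realType) (V H : hilbertType R)
    (j : clinear V H) (hj : gelfand_embedding j)
    (A : clinear V (dual V)) (hA : splitting j A)
    (muA : R) (hmuA : 0 < muA) :
  exists C : R -> R -> R,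
  forall (Q : hilbertType R)
    (B : clinear V (dual Q)) (beta : R) (hbeta : 0 < beta)
    (hB : inf_sup_condition B beta)
    (hAB : elliptic_on A (ker B) muA)
    (Bm : dual Q -> V) (hBm : right_inverse_of A B Bm)
    (T : R) (hT : 0 < T)
    (g : nat -> R -> dual Q) (hg : sobolev 3 0 T g)
    (u0 : V) (hu0 : B u0 = g 0%N 0)
    (f : R -> V -> H)
    (hf1 : caratheodory T f) (hf2 : linear_growth T f)
    (hf3 : locally_lipschitz T f)
    (u : R -> V) (lam : R -> Q)
    (hu : solution j A B 0 T (fun t => f t (u t)) (g 0%N) u0 u lam)
    (F : nat -> R -> H) (hF : sobolev 2 0 T F)
    (hFu : {ae lebesgue_measure, forall t, t \in `[0, T] -> F 0%N t = f t (u t)})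
    (L r : R) (hL : 0 < L) (hr : 0 < r) (hstrip : lipschitz_strip T f u r L),
  exists2 tau0 : R, 0 < tau0 &
  forall (N : nat) (hN : (0 < N)%N) (u_ uE_ : nat -> V)
    (hint : exp_integrator j A B Bm f (g 0%N) (g 1%N) T N u0 u_ uE_)
    (hgrid : regular_at_grid f T N u (F 0%N) r L)
    (hu_strip : forall n, (n <= N)%N -> `|u_ n - u (grid T N n)| < r)
    (htau : T / N%:R <= tau0 \/
       forall n, (n < N)%N -> `|uE_ n.+1 - u (grid T N n.+1)| < r)
    (n : nat) (hn : (n <= N)%N),
  ((`|u_ n - u (grid T N n)| ^+ 2)%:E <=
   (C (grid T N n) L)%:E *
   (((T / N%:R) ^+ 3)%:E *
      \int[lebesgue_measure]_(t in `[0%R, grid T N n])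
        (`|F 1%N t| ^+ 2 + `|j (Bm (g 2%N t))| ^+ 2)%:E +
    ((T / N%:R) ^+ 4)%:E *
      \int[lebesgue_measure]_(t in `[0%R, grid T N n])
        (`|F 2%N t| ^+ 2 + `|j (Bm (g 3%N t))| ^+ 2)%:E))%E.
Proof.
have [A1 [A2 [A1_sym AE]]] := hA.
have [c1 c10 A1_le] := clinear_bounded_ge0 A1.
have [c2 c20 A2_le] := clinear_bounded_ge0 A2.
have [cj cj0 j_le] := clinear_bounded_ge0 j.
(* [nu] compares the squared norm with the energy, so that [p L] bounds squared Lipschitz
   defects in terms of the energy of the error. *)
pose nu := 2 / muA; have nu0 : 0 <= nu by rewrite divr_ge0// ltW.
pose c := energy_rate muA c2 cj; have c0 : 0 <= c by exact: energy_rate_ge0.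
pose p (L : R) := L ^+ 2 * nu; have p0 L : 0 <= p L by rewrite mulr_ge0// sqr_ge0.
exists (fun t L => nu * (expR (growth_rate c (p L) t * t) * defect_factor c (p L) t)).
move=> Q B beta hbeta hB hAB Bm0 hBm0 T hT g hg u0 hu0 f hf1 hf2 hf3 u lam hu F hF hFu
  L r hL hr hstrip.
(* From here on [Bm] is a bounded linear operator with the values of the given map. *)
have [k Bm_le] := right_inverse_bounded hbeta hB hmuA hAB hBm0.
have [Bm BmE] := bounded_linear_clinear (right_inverse_linear hmuA hAB hBm0) Bm_le.
have {BmE} : (Bm : dual Q -> V) = Bm0 by exact/funext.
move: hBm0 => /[swap] <- hBm {Bm0 Bm_le k}.
have BBm : cancel Bm B := hBm.1.
have ABm h w (Bw : B w = 0) : A (Bm h) w = 0 := right_inverse_orthogonal hBm h Bw.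
have [g2 dg cg] := hg; have [F2 dF cF] := hF.
have [cu _ _ Bu uini] := hu.
have eu : evolves j A B 0 T (u \o clamp 0 T) (F 0%N \o clamp 0 T).
  apply: (evolves_solution hT hu); first exact: cF.
  by apply: ae_mono hFu => t h tT; rewrite h.
have eg := evolves_lifting j ABm hT (g2 0%N isT) (g2 1%N isT) (dg 0%N isT)
  (cg 0%N isT) (cg 1%N isT).
(* Borel functions for the norms in the estimate: their integrals [I1] and [I2] bound the
   increments of the source, and those of their squares, [S1] and [S2], the defects. *)
have nQ := @dual_norming _ Q; have nH := @hilbert_norming _ H.
have [idH idHE] : exists I : clinear H H, forall x, I x = x.
  by apply: (@bounded_linear_clinear _ _ _ idfun 1) => // x; rewrite mul1r.
pose Lg := lifting j Bm.
have [NF1 dNF1 F1i] := sobolev_norm_density idH nH hT (F2 0%N isT) (F2 1%N isT)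
  (dF 0%N isT) (cF 0%N isT).
have [NF2 dNF2 F2i] := sobolev_norm_density idH nH hT (F2 1%N isT) (F2 2%N isT)
  (dF 1%N isT) (cF 1%N isT).
have [Ng2 dNg2 g2i] := sobolev_norm_density Lg nQ hT (g2 1%N isT) (g2 2%N isT)
  (dg 1%N isT) (cg 1%N isT).
have [Ng3 dNg3 g3i] := sobolev_norm_density Lg nQ hT (g2 2%N isT) (g2 3%N isT)
  (dg 2%N isT) (cg 2%N isT).
have iN (w : R -> H) N x y : norm_density 0 T w N -> 0 <= x -> y <= T ->
    lebesgue_measure.-integrable `[x, y] (EFin \o N) /\
    lebesgue_measure.-integrable `[x, y] (EFin \o (fun t => N t ^+ 2)).
  by move=> dN x0 yT; exact: (norm_density_integrable dN x0 yT).
pose I1 (x y : R) := \int[lebesgue_measure]_(t in `[x, y]) NF1 t +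
  \int[lebesgue_measure]_(t in `[x, y]) Ng2 t.
pose I2 (x y : R) := \int[lebesgue_measure]_(t in `[x, y]) NF2 t +
  \int[lebesgue_measure]_(t in `[x, y]) Ng3 t.
pose S1 (x y : R) := \int[lebesgue_measure]_(t in `[x, y]) (NF1 t ^+ 2) +
  \int[lebesgue_measure]_(t in `[x, y]) (Ng2 t ^+ 2).
pose S2 (x y : R) := \int[lebesgue_measure]_(t in `[x, y]) (NF2 t ^+ 2) +
  \int[lebesgue_measure]_(t in `[x, y]) (Ng3 t ^+ 2).
have S1_ge0 x y : 0 <= S1 x y by rewrite addr_ge0// Rintegral_ge0// => t _; exact: sqr_ge0.
have S2_ge0 x y : 0 <= S2 x y by rewrite addr_ge0// Rintegral_ge0// => t _; exact: sqr_ge0.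
have S1_split x y z : 0 <= x -> x <= y -> y <= z -> z <= T -> S1 x z = S1 x y + S1 y z.
  move=> x0 xy yz zT; rewrite /S1 !(Rintegral_itv_split xy yz) 1?addrACA//.
    by have [] := iN _ _ x z dNg2 x0 zT.
  by have [] := iN _ _ x z dNF1 x0 zT.
have S2_split x y z : 0 <= x -> x <= y -> y <= z -> z <= T -> S2 x z = S2 x y + S2 y z.
  move=> x0 xy yz zT; rewrite /S2 !(Rintegral_itv_split xy yz) 1?addrACA//.
    by have [] := iN _ _ x z dNg3 x0 zT.
  by have [] := iN _ _ x z dNF2 x0 zT.
have sq_add (v w d x y : R) : v ^+ 2 <= d * x -> w ^+ 2 <= d * y ->
    (v + w) ^+ 2 <= 2 * d * (x + y).
  by move=> h1 h2; have := sqr_ge0 (v - w); nra.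
have I1_sq x y : 0 <= x -> x <= y -> y <= T -> I1 x y ^+ 2 <= 2 * (y - x) * S1 x y.
  move=> x0 xy yT; have [? ?] := iN _ _ x y dNF1 x0 yT; have [? ?] := iN _ _ x y dNg2 x0 yT.
  by apply: sq_add; exact: Rintegral_sq_le.
have I2_sq x y : 0 <= x -> x <= y -> y <= T -> I2 x y ^+ 2 <= 2 * (y - x) * S2 x y.
  move=> x0 xy yT; have [? ?] := iN _ _ x y dNF2 x0 yT; have [? ?] := iN _ _ x y dNg3 x0 yT.
  by apply: sq_add; exact: Rintegral_sq_le.
pose src := source j Bm (g 1%N) (F 0%N).
pose dsrc t := F 1%N t - Lg (g 2%N t).
have src_increment x y z : 0 <= x -> x <= y -> y <= z -> z <= T ->
    `|src y - src x| <= I1 x z.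
  move=> x0 xy yz zT; have yT := le_trans yz zT.
  have -> : src y - src x = (F 0%N y - F 0%N x) - (Lg (g 1%N y) - Lg (g 1%N x)).
    by apply: inner_injl => h; rewrite !(innerDl, innerNl); ring.
  apply: le_trans (ler_normB _ _) _; apply: lerD.
    have := F1i x y x0 xy yT; rewrite !idHE => /le_trans; apply.
    rewrite (Rintegral_itv_split xy yz) ?lerDl ?Rintegral_ge0//.
      by move=> t _; case: dNF1.
    by have [] := iN _ _ x z dNF1 x0 zT.
  apply: le_trans (g2i x y x0 xy yT) _.
  rewrite (Rintegral_itv_split xy yz) ?lerDl ?Rintegral_ge0//.
    by move=> t _; case: dNg2.
  by have [] := iN _ _ x z dNg2 x0 zT.
have src_taylor x y z : 0 <= x -> x <= y -> y <= z -> z <= T ->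
    `|src y - src x - (y - x) *: dsrc x| <= (y - x) * I2 x z.
  move=> x0 xy yz zT.
  have -> : src y - src x - (y - x) *: dsrc x =
     (F 0%N y - F 0%N x - (y - x) *: F 1%N x) -
     (Lg (g 1%N y) - Lg (g 1%N x) - (y - x) *: Lg (g 2%N x)).
    by apply: inner_injl => h; rewrite !(innerDl, innerNl, innerZl); ring.
  apply: le_trans (ler_normB _ _) _; rewrite mulrDr; apply: lerD.
    have := linear_image_taylor (M := idH) nH hT (F2 0%N isT) (F2 1%N isT)
      (dF 0%N isT) (cF 0%N isT) (cF 1%N isT) (N := NF2).
    move=> /(_ _ _ F2i x y z x0 xy yz zT); rewrite !idHE; apply.
      by case: dNF2.
    by move=> x' y' x'0 y'T; have [] := iN _ _ x' y' dNF2 x'0 y'T.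
  apply: (linear_image_taylor (M := Lg) nQ hT (g2 1%N isT) (g2 2%N isT)
      (dg 1%N isT) (cg 1%N isT) (cg 2%N isT) (N := Ng3)) => //.
    by case: dNg3.
  by move=> x' y' x'0 y'T; have [] := iN _ _ x' y' dNg3 x'0 y'T.
pose Phi := energy j A1 muA c2.
have Phi_ge v : B v = 0 -> `|v| ^+ 2 <= nu * Phi v := energy_ge AE hmuA A2_le hAB (v := v).
have Phi_ge0 v : B v = 0 -> 0 <= Phi v := energy_ker_ge0 AE hmuA A2_le hAB (v := v).
have Phi0 : Phi 0 = 0.
  by rewrite /Phi /energy /energy_form !linear0 inner0l mulr0 addr0.
pose al := growth_rate c (p L) T; pose Ga := defect_factor c (p L) T.
have al0 : 0 <= al by apply: growth_rate_ge0 => //; exact: ltW.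
have Ga0 : 0 <= Ga by exact: defect_factor_ge0.
(* [tau * X] bounds the squared predictor errors on the whole of [[0, T]]. *)
pose X := nu * (expR (c * T) * ((1 + 2 * c * T * p L) *
    (expR (al * T) * Ga * (S1 0 T + S2 0 T)) + 4 * c * S1 0 T)).
have X0 : 0 <= X.
  have T_ge0 := ltW hT; rewrite /X; move: (p L) (p0 L) => q q0.
  have w0 : 0 <= 1 + 2 * c * T * q by rewrite addr_ge0// !mulr_ge0.
  have z0 : 0 <= expR (al * T) * Ga * (S1 0 T + S2 0 T).
    by apply: mulr_ge0; [apply: mulr_ge0 => //; exact: expR_ge0|exact: addr_ge0].
  apply: mulr_ge0 => //; apply: mulr_ge0; first exact: expR_ge0.
  by apply: addr_ge0; apply: mulr_ge0 => //; rewrite mulr_ge0.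
exists (Num.min 1 (r ^+ 2 / (X + 1))).
  by rewrite lt_min ltr01 divr_gt0 ?exprn_gt0// ltr_wpDl.
move=> N hN u_ uE_ [u_0 steps] hgrid hu_strip htau n hn.
set tau := T / N%:R in htau *.
have tau0 : 0 < tau := grid_step_gt0 hT hN.
pose t_ := grid T N.
pose x_ n := Phi (u_ n - u (t_ n)).
pose y_ n := Phi (uE_ n.+1 - u (t_ n.+1)).
have x_0 : x_ 0%N = 0 by rewrite /x_ /t_ /grid mul0r uini u_0 subrr Phi0.
have lip m v : (m <= N)%N -> `|v - u (t_ m)| < r ->
    `|f (t_ m) v - F 0%N (t_ m)| <= L * `|v - u (t_ m)|.
  move=> mN vr; have [-> hl] := hgrid m mN; apply: hl (grid_in hT hN mN) _ _ _ _.
    by rewrite -ball_normE /= distrC.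
  by rewrite -ball_normE /= subrr normr0.
have step_facts m : (m < N)%N ->
  [/\ B (u_ m - u (t_ m)) = 0, B (uE_ m.+1 - u (t_ m.+1)) = 0,
      B (u_ m.+1 - u (t_ m.+1)) = 0,
      y_ m <= expR (c * tau) * x_ m +
        (expR (c * tau) - 1) * (2 * p L * x_ m + 4 * tau * S1 (t_ m) (t_ m.+1)) &
      `|uE_ m.+1 - u (t_ m.+1)| < r ->
      x_ m.+1 <= expR (c * tau) * x_ m + (expR (c * tau) - 1) *
        (3 * (p L * x_ m + p L * y_ m + 8 * tau ^+ 3 * S2 (t_ m) (t_ m.+1)))].
  move=> mN; have [es cs] := steps m mN; have mN' := ltnW mN.
  have t0_ge0 : 0 <= t_ m := grid_ge0 hT hN m.
  have t01 : t_ m < t_ m.+1 := grid_lt hT hN m.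
  have t1T : t_ m.+1 <= T := grid_le hT hN mN.
  have tauE : t_ m.+1 - t_ m = tau := grid_diff T N m.
  have lip0 := lip m (u_ m) mN' (hu_strip m mN').
  have ge1 : 0 <= expR (c * tau) - 1.
    by rewrite subr_ge0 (le_trans _ (expR_ge1Dx _))// lerDl mulr_ge0// ltW.
  have Wsrc t : t \in `[t_ m, t_ m.+1] -> `|src t - src (t_ m)| <= I1 (t_ m) (t_ m.+1).
    by rewrite in_itv/= => /andP[h1 h2]; exact: src_increment.
  have [Bu0 BuE yb] := euler_bound A1_sym AE hmuA c20 cj0 A1_le A2_le j_le hAB BBm eu eg Bu
    t0_ge0 t01 t1T es lip0 Wsrc.
  have sq0 : (L * `|u_ m - u (t_ m)|) ^+ 2 <= p L * x_ m.
    by rewrite exprMn /p -mulrA ler_wpM2l ?sqr_ge0//; exact: Phi_ge.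
  have sq1 : (L * `|uE_ m.+1 - u (t_ m.+1)|) ^+ 2 <= p L * y_ m.
    by rewrite exprMn /p -mulrA ler_wpM2l ?sqr_ge0//; exact: Phi_ge.
  have := I1_sq _ _ t0_ge0 (ltW t01) t1T; have := I2_sq _ _ t0_ge0 (ltW t01) t1T.
  rewrite tauE in yb *; set s1 := S1 _ _; set s2 := S2 _ _ => sqI2 sqI1.
  have Wtaylor t (tt : t \in `[t_ m, t_ m.+1]) := interpolation_bound t01
    (fun y h1 h2 => src_taylor (t_ m) y (t_ m.+1) t0_ge0 h1 h2 t1T) tt.
  have cs' : corrector_step j A B Bm f (g 1%N) (t_ m.+1 - t_ m) (t_ m) (t_ m.+1)
    (u_ m) (uE_ m.+1) (u_ m.+1) by rewrite tauE.
  split => //.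
  - (* Outside the strip, the Lipschitz defect of the predictor is bounded by itself. *)
    have [] := corrector_bound A1_sym AE hmuA c20 cj0 A1_le A2_le j_le hAB BBm eu eg Bu
      t0_ge0 t01 t1T es cs' lip0 (lexx _) Wtaylor.
    by [].
  - apply: le_trans yb _; rewrite lerD2l ler_wpM2l//.
    have := sqr_ge0 (L * `|u_ m - u (t_ m)| - I1 (t_ m) (t_ m.+1)); nra.
  - move=> strip; have lip1 := lip m.+1 _ mN strip.
    have [_ xb] := corrector_bound A1_sym AE hmuA c20 cj0 A1_le A2_le j_le hAB BBm eu eg Bu
      t0_ge0 t01 t1T es cs' lip0 lip1 Wtaylor.
    rewrite tauE in xb; apply: le_trans xb _; rewrite lerD2l ler_wpM2l//.
    have sqW : (2 * tau * I2 (t_ m) (t_ m.+1)) ^+ 2 <= 8 * tau ^+ 3 * s2.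
      have -> : 8 * tau ^+ 3 * s2 = (2 * tau) ^+ 2 * (2 * tau * s2) by ring.
      by rewrite exprMn ler_wpM2l ?sqr_ge0.
    move: sq0 sq1 sqW; move: (L * _) (L * _) (2 * tau * _) => a1 a2 a3 h1 h2 h3.
    have := sqr_ge0 (a1 - a2); have := sqr_ge0 (a2 - a3); have := sqr_ge0 (a1 - a3).
    by nra.
have x_ge0 m : (m <= N)%N -> 0 <= x_ m.
  case: m => [_|m mN]; first by rewrite x_0.
  by have [_ _ h _ _] := step_facts m mN; exact: Phi_ge0.
(* [S] is [t_ n] in the final estimate, whose constant is a function of [t_ n], and [T]
   when the strip condition is propagated. At [t_ 0 = 0] the step exceeds [S]. *)
have x_bound S m : (m <= N)%N -> 0 <= S -> ((0 < m)%N -> tau <= S) ->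
    (forall k, (k < m)%N -> `|uE_ k.+1 - u (t_ k.+1)| < r) ->
    x_ m <= expR (growth_rate c (p L) S * t_ m) * defect_factor c (p L) S *
      (tau ^+ 3 * S1 0 (t_ m) + tau ^+ 4 * S2 0 (t_ m)).
  move=> mN S0 tauS strip.
  apply: (@recursion_sum _ _ _ tau x_ (fun k => S1 (t_ k) (t_ k.+1))
    (fun k => S2 (t_ k) (t_ k.+1)) (fun k => S1 0 (t_ k)) (fun k => S2 0 (t_ k)) m) => //.
  - exact: growth_rate_ge0.
  - exact: defect_factor_ge0.
  - exact: ltW.
  - by rewrite /S1 /t_ /grid mul0r set_itv1 !Rintegral_set1 addr0.
  - by rewrite /S2 /t_ /grid mul0r set_itv1 !Rintegral_set1 addr0.
  - move=> k km; apply: S1_split => //; [exact: grid_ge0|exact/ltW/grid_lt|].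
    by apply: grid_le => //; exact: leq_trans km mN.
  - move=> k km; apply: S2_split => //; [exact: grid_ge0|exact/ltW/grid_lt|].
    by apply: grid_le => //; exact: leq_trans km mN.
  - move=> k km; have kN := leq_trans km mN.
    have [_ BE _ yb xb] := step_facts k kN.
    apply: (scheme_recursion c0 (p0 L) (ltW tau0) (tauS (leq_ltn_trans (leq0n k) km))
      (x_ge0 k (ltnW kN)) (S1_ge0 _ _) (S2_ge0 _ _) yb (xb (strip k km))).
    exact: Phi_ge0.
(* If the predictors of the previous steps lie in the strip, the error bound holds up to
   [t_ m], and the next predictor error is controlled by it. *)
have strip m : (m < N)%N -> `|uE_ m.+1 - u (t_ m.+1)| < r.
  case: htau => [tau_le|]; last exact.
  elim/ltn_ind: m => m IH mN.
  have mT : t_ m <= T := grid_le hT hN (ltnW mN).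
  have tauT : tau <= T by rewrite /tau ler_pdivrMr ?ltr0n// ler_peMr ?ler1n// ltW.
  have hx := x_bound T m (ltnW mN) (ltW hT) (fun=> tauT) (fun k km => IH k km (ltn_trans km mN)).
  have [_ BE _ yb _] := step_facts m mN.
  have hy := predictor_recursion c0 (p0 L) (ltW tau0) tauT (x_ge0 m (ltnW mN)) (S1_ge0 _ _) yb.
  move: tau_le; rewrite le_min => /andP[tau1 tau2].
  have S1T : S1 0 (t_ m.+1) <= S1 0 T.
    rewrite (S1_split 0 (t_ m.+1) T) ?lerDl//; [exact: grid_ge0|exact: grid_le].
  have S1j : S1 (t_ m) (t_ m.+1) <= S1 0 T.
    apply: le_trans S1T; rewrite (S1_split 0 (t_ m) (t_ m.+1)) ?lerDr//.
    - exact: grid_ge0.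
    - exact/ltW/grid_lt.
    - exact: grid_le.
  have S1m : S1 0 (t_ m) <= S1 0 T.
    by rewrite (S1_split 0 (t_ m) T) ?lerDl//; exact: grid_ge0.
  have S2m : S2 0 (t_ m) <= S2 0 T.
    by rewrite (S2_split 0 (t_ m) T) ?lerDl//; exact: grid_ge0.
  have tau_pow q : tau ^+ q.+1 <= tau.
    by rewrite exprS ler_piMr ?(ltW tau0)// exprn_ile1// ltW.
  have hx2 : x_ m <= tau * (expR (al * T) * Ga * (S1 0 T + S2 0 T)).
    apply: le_trans hx _; rewrite -/al -/Ga.
    have e1 : expR (al * t_ m) <= expR (al * T) by rewrite ler_expR ler_wpM2l.
    have e2 : tau ^+ 3 * S1 0 (t_ m) + tau ^+ 4 * S2 0 (t_ m) <= tau * (S1 0 T + S2 0 T).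
      by rewrite (mulrDr tau); apply: lerD; apply: ler_pM; rewrite ?exprn_ge0 ?(ltW tau0).
    rewrite [leRHS]mulrCA; apply: ler_pM => //.
    - by rewrite mulr_ge0// expR_ge0.
    - by apply: addr_ge0; apply: mulr_ge0 => //; rewrite exprn_ge0// ltW.
    - by rewrite ler_wpM2r.
  have hy2 : nu * y_ m <= tau * X.
    rewrite /X [leRHS]mulrCA ler_wpM2l//; apply: le_trans hy _.
    rewrite [leRHS]mulrCA ler_wpM2l ?expR_ge0// (mulrDr tau); apply: lerD.
      rewrite [leRHS]mulrCA ler_wpM2l// addr_ge0//.
      by rewrite mulr_ge0// mulr_ge0 ?(ltW hT)// mulr_ge0.
    rewrite [leRHS]mulrCA -mulrA; apply: ler_wpM2l; first exact: mulr_ge0.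
    by apply: ler_pM; rewrite ?exprn_ge0 ?(ltW tau0).
  rewrite -(@ltr_pXn2r _ 2) ?nnegrE ?(ltW hr)//.
  apply: le_lt_trans (Phi_ge _ BE) _; apply: le_lt_trans hy2 _.
  apply: (@le_lt_trans _ _ (r ^+ 2 / (X + 1) * X)); first by rewrite ler_wpM2r.
  by rewrite mulrAC ltr_pdivrMr ?ltr_wpDl// ltr_pM2l ?exprn_gt0// ltrDl ltr01.
have tn0 : 0 <= t_ n := grid_ge0 hT hN n.
have hx : x_ n <= expR (growth_rate c (p L) (t_ n) * t_ n) * defect_factor c (p L) (t_ n) *
    (tau ^+ 3 * S1 0 (t_ n) + tau ^+ 4 * S2 0 (t_ n)).
  apply: x_bound => //; first exact: grid_step_le.
  by move=> k kn; apply: strip; exact: leq_trans kn hn.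
have Bn : B (u_ n - u (t_ n)) = 0.
  case: (n) hn => [_|m mN]; last by have [] := step_facts m mN.
  by rewrite /t_ /grid mul0r uini u_0 subrr linear0.
set Cn := nu * _.
have Cn0 : 0 <= Cn by rewrite mulr_ge0// mulr_ge0 ?expR_ge0// defect_factor_ge0.
have real_bound : `|u_ n - u (t_ n)| ^+ 2 <=
    Cn * (tau ^+ 3 * S1 0 (t_ n) + tau ^+ 4 * S2 0 (t_ n)).
  apply: le_trans (Phi_ge _ Bn) _; rewrite /Cn -mulrA ler_wpM2l//.
have tnT : t_ n <= T := grid_le hT hN hn.
have i1 := norm_density_integral_le tn0 tnT dNF1 dNg2.
have i2 := norm_density_integral_le tn0 tnT dNF2 dNg3.
apply: (@le_trans _ _ (Cn * (tau ^+ 3 * S1 0 (t_ n) + tau ^+ 4 * S2 0 (t_ n)))%:E).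
  by rewrite lee_fin.
rewrite EFinM EFinD (EFinM (tau ^+ 3)) (EFinM (tau ^+ 4)); apply: lee_wpmul2l; first by rewrite lee_fin.
apply: leeD; apply: lee_wpmul2l.
- by rewrite lee_fin; apply: exprn_ge0; exact: ltW.
- apply: (le_trans i1); rewrite le_eqVlt; apply/orP; left; apply/eqP.
  by apply: eq_integral => t _; rewrite idHE.
- by rewrite lee_fin; apply: exprn_ge0; exact: ltW.
- apply: (le_trans i2); rewrite le_eqVlt; apply/orP; left; apply/eqP.
  by apply: eq_integral => t _; rewrite idHE.
Qed.
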